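(* Let $(\nu_n)_{n\ge 1}$ be a spherical model satisfying the following assumption: there exist a deterministic sequence $(a_n)_n$ of nonzero real numbers and constants $d_1,d_2,\alpha>0$, $\rho_0\in(0,1)$ such that, for every $n$ and every $\rho\in(0,\rho_0)$, $$\nu_n\left(\left|\frac{\|b_1^{(n)}\|^2}{a_n}-1\right|\ge\rho\right)\le d_1e^{-nd_2\rho^\alpha}.$$ Let $\mathcal{M}_n^k,\mathcal{I}_n^k$ be the reduction level and index of worst local reduction of a random basis of codimension $k$ in $\mathbb{R}^n$ under $\nu_n$, and let $\mathcal{M}^k,\mathcal{I}^k$ be the limit objects defined in the context. Then, as $n\to\infty$: (i) For each integer $k\ge0$, $\mathcal{M}_n^k$ converges in distribution to $\mathcal{M}^k$. (ii) Let $g:\mathbb{N}\to\mathbb{N}$ be such that $g(n)\le n-2$ (for $n\ge 2$) and $g(n)\to\infty$. Then $\mathcal{M}_n^{g(n)}$ converges in probability to $1$. (iii) For any integer $k\ge1$, $\mathcal{I}_n^k$ converges in distribution to $\mathcal{I}^k$.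
   Context: Spherical model: a sequence $(\nu_n)_{n\ge1}$ where each $\nu_n$ is a probability distribution on $\mathbb{R}^n$ that is invariant by rotation and satisfies $\nu_n(\{0\})=0$. In the assumption, $b_1^{(n)}$ denotes a random vector with distribution $\nu_n$. A random basis of codimension $g$ consists of $n-g$ independent vectors $b_1^{(n)},\dots,b_{n-g}^{(n)}$ of $\mathbb{R}^n$ with distribution $\nu_n$; they are a.s. linearly independent. Gram--Schmidt: $\widehat b_1^{(n)}=b_1^{(n)}$ and $\widehat b_j^{(n)}=b_j^{(n)}-\sum_{i=1}^{j-1}\frac{\langle b_j^{(n)},\widehat b_i^{(n)}\rangle}{\|\widehat b_i^{(n)}\|^2}\widehat b_i^{(n)}$ for $j\ge2$ (no normalization). For $g+1\le j\le n-1$ set $r_j^{(n)}=\|\widehat b_{n-j+1}^{(n)}\|^2/\|\widehat b_{n-j}^{(n)}\|^2$. For $g\le n-2$, the reduction level is $\mathcal{M}_n^g=\min_{g+1\le j\le n-1}r_j^{(n)}$ and the index of worst local reduction is $\mathcal{I}_n^g=\min\{j\in\{g+1,\dots,n-1\}: r_j^{(n)}=\mathcal{M}_n^g\}$. Limit objects: let $(\eta_i)_{i\ge1}$ be independent random variables, $\eta_i$ with gamma distribution $\gamma_{i/2}$, where $\gamma_a$ has density $e^{-x}x^{a-1}/\Gamma(a)$ on $[0,\infty)$. Set $\mathcal{R}_j=\eta_j/\eta_{j+1}$ for $j\ge1$, $\mathcal{M}^k=\inf\{\mathcal{R}_j: j\ge k+1\}$, and let $\mathcal{I}^k$ be the (a.s.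 unique) index $j\ge k+1$ such that $\mathcal{R}_j=\mathcal{M}^k$. *)

(* Defs.v *)
From HB Require Import structures.
From mathcomp Require Import all_boot all_order all_algebra finmap.
From mathcomp Require Import all_classical all_reals all_analysis.

Set Implicit Arguments.
Unset Strict Implicit.
Unset Printing Implicit Defensive.

Import Order.TTheory GRing.Theory Num.Theory.
Import numFieldNormedType.Exports.

Local Open Scope classical_set_scope.
Local Open Scope ring_scope.

(* The Borel sigma-algebra on R^n. *)
Section borel_rV.
Variables (R : realType) (n : nat).
Let opens : set (set 'rV[R]_n) := @open 'rV[R]_n.

HB.instance Definition _ := @isMeasurable.Build (sigma_display opens) 'rV[R]_n
  <<s opens >> (@sigma_algebra0 _ setT opens) (@sigma_algebraC _ opens)
  (@sigma_algebra_bigcup _ setT opens).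

End borel_rV.

Section euclidean.
Context {R : realType} {n : nat}.
Implicit Types (u v : 'rV[R]_n) (b : nat -> 'rV[R]_n).

Definition dotv u v : R := \sum_(i < n) u 0 i * v 0 i.

(* Squared Euclidean norm; the library's `|u| is the sup norm. *)
Definition sqnorm u : R := dotv u u.

Definition rotation (U : 'M[R]_n) : Prop := U *m U^T = 1%:M /\ \det U = 1.

(* Gram-Schmidt without normalization. Vectors are numbered from 1, so that
   gs_seq b m = [:: gs b 1; ...; gs b m], see gsE below. *)
Fixpoint gs_seq b (m : nat) : seq 'rV[R]_n :=
  if m is m'.+1 then
    let s := gs_seq b m' in
    rcons s (b m - \sum_(v <- s) (dotv (b m) v / sqnorm v) *: v)
  else [::].

Definition gs b (j : nat) : 'rV[R]_n := last 0 (gs_seq b j).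

Lemma gs_seqE b m : gs_seq b m = [seq gs b i | i <- index_iota 1 m.+1].
Proof.
elim: m => [//|m IHm].
have -> : index_iota 1 m.+2 = rcons (index_iota 1 m.+1) m.+1.
  by rewrite /index_iota !subn1 -cats1 -(iotaD 1 m 1) addn1.
by rewrite map_rcons -IHm /gs /= last_rcons.
Qed.

Lemma gsE b j : (0 < j)%N ->
  gs b j = b j - \sum_(1 <= i < j) (dotv (b j) (gs b i) / sqnorm (gs b i)) *: gs b i.
Proof.
by case: j => // j _; rewrite {1}/gs /= last_rcons gs_seqE big_map.
Qed.

Definition gs_ratio b (j : nat) : R :=
  sqnorm (gs b (n - j).+1) / sqnorm (gs b (n - j)).

(* Meaningful for g <= n - 2, when the range g < j < n is nonempty. *)
Definition reduction_level (g : nat) b : R :=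
  \big[Order.min/gs_ratio b g.+1]_(g.+1 <= j < n) gs_ratio b j.

Definition worst_index (g : nat) b : nat :=
  \big[minn/n]_(g.+1 <= j < n | gs_ratio b j == reduction_level g b) j.

End euclidean.

Section probability_notions.
Context {R : realType}.

(* Mutual independence of the random variables X i, i in D. *)
Definition independent_RVs d d' (T : measurableType d) (T' : measurableType d')
    (P : probability T R) (I : choiceType) (D : set I)
    (X : I -> {RV P >-> T'}) : Prop :=
  forall (J : {fset I}) (E : I -> set T'),
    [set` J] `<=` D -> (forall i, measurable (E i)) ->
    P (\bigcap_(i in [set` J]) (X i @^-1` E i)) =
    (\prod_(i <- J) P (X i @^-1` E i))%E.

(* Weak convergence of the laws; the X n may live on different spaces. *)
Definition cvg_in_distribution (d : nat -> measure_display)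
    (T : forall n, measurableType (d n)) (P : forall n, probability (T n) R)
    d' (T' : measurableType d') (P' : probability T' R)
    (S : topologicalType) (X : forall n, T n -> S) (Y : T' -> S) : Prop :=
  forall f : S -> R, continuous f -> bounded_fun f ->
    ('E_(P n)[f \o X n] @[n --> \oo] --> 'E_P'[f \o Y])%E.

Definition cvg_in_probability (d : nat -> measure_display)
    (T : forall n, measurableType (d n)) (P : forall n, probability (T n) R)
    (X : forall n, T n -> R) (c : R) : Prop :=
  forall e : R, 0 < e ->
    P n [set w | e <= `|X n w - c|] @[n --> \oo] --> 0%E.

Definition Gamma (a : R) : R :=
  \int[@lebesgue_measure R]_(x in `[0, +oo[) (expR (- x) * x `^ (a - 1)).

Definition gamma_pdf (a : R) : R -> R :=
  (fun x => expR (- x) * x `^ (a - 1) / Gamma a) \_ `[0, +oo[.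

Definition gamma_distributed d (T : measurableType d) (P : probability T R)
    (a : R) (X : {RV P >-> R}) : Prop :=
  forall A : set R, measurable A ->
    distribution P X A = (\int[lebesgue_measure]_(x in A) (gamma_pdf a x)%:E)%E.

End probability_notions.

Section model.
Context {R : realType}.

Definition spherical_model (nu : forall n, probability 'rV[R]_n R) : Prop :=
  forall n, (0 < n)%N ->
    nu n [set 0] = 0%E /\
    forall (U : 'M[R]_n) (A : set 'rV[R]_n), rotation U -> measurable A ->
      nu n [set x | A (x *m U)] = nu n A.

(* b 1, ..., b (n - g) are independent with distribution nu;
   the other b i are irrelevant. *)
Definition random_basis n (nu : probability 'rV[R]_n R) (g : nat)
    d (T : measurableType d) (P : probability T R)
    (b : nat -> {RV P >-> 'rV[R]_n}) : Prop :=
  independent_RVs [set i | (1 <= i <= n - g)%N] b /\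
  forall i, (1 <= i <= n - g)%N -> forall A : set 'rV[R]_n, measurable A ->
    distribution P (b i) A = nu A.

End model.

Section limit_objects.
Context {R : realType}.
Implicit Types e : nat -> R.

Definition lim_ratio e (j : nat) : R := e j / e j.+1.

Definition lim_level (k : nat) e : R :=
  inf [set lim_ratio e j | j in [set j | (k < j)%N]].

(* The unique index at which the infimum is attained, 0 if there is none. *)
Definition lim_index (k : nat) e : nat :=
  xget 0%N [set j | unique (fun i => (k < i)%N /\ lim_ratio e i = lim_level k e) j].

End limit_objects.

(* Main.v *)
(** Let Q be the orthogonal projection, of rank m, onto the complement of the
    vectors already drawn, and x a rotation-invariant vector of R^n. The
    fraction |xQ|^2/|x|^2 does not depend on the law of the norm: if H is an
    independent gamma variable of parameter n/2, then H |xQ|^2/|x|^2 is gamma of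
    parameter m/2. Enlarging the space by independent gamma variables H_i, the
    vector of the H_i |b^_i|^2/|b_i|^2 therefore has exactly the law of
    (eta_n, ..., eta_{g+1}). The squared norms |b_i|^2/a_n concentrate by
    assumption and the H_i/(n/2) by a Chernoff bound, uniformly in i, so that
    with high probability all local ratios r_j agree with the ratios of this
    vector up to a factor close to 1.

    The statement is thereby reduced to almost sure properties of the eta_j. By
    Borel-Cantelli eta_j/(j/2) tends to 1, hence so does eta_j/eta_{j+1}; the
    infimum of these ratios is below 1 and attained, at a single index, with a
    gap to all other ratios. So for large n the minimum over k < j < n and its
    index coincide with their limits and survive a perturbation of the ratios by
    a factor close to 1; if k = g(n) tends to infinity the minimum tends to 1. *)
Require Import Defs.
From mathcomp Require Import all_boot all_order all_algebra finmap.
From mathcomp Require Import all_classical all_reals all_analysis measurable_realfun.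
From mathcomp Require Import ring lra.

Set Implicit Arguments.
Unset Strict Implicit.
Unset Printing Implicit Defensive.

Import Order.TTheory GRing.Theory Num.Theory.
Import numFieldNormedType.Exports.

Local Open Scope classical_set_scope.
Local Open Scope ring_scope.

(** * Borel measurability and orthogonal projections of row vectors *)

(** The fraction u = |xQ|^2/|x|^2 has a beta law, but the proof computes no density on the sphere.
    If x is rotation-invariant, the integral of f(x G_t) is constant in t for the rotations G_t of a
    coordinate plane. Differentiating at t = 0 and summing over all planes gives an integration by
    parts formula for the spherical Laplacian on functions of u. Applied to (1 + s u)^(-n/2), it
    becomes a linear differential equation in s, with solution E (1 + s u)^(-n/2) = (1 + s)^(-m/2).
    The left side is the Laplace transform of H u, the right side that of a gamma variable of
    parameter m/2. The projection Q is random, but the law of H u depends on its rank only. So the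
    conditional law given the past is constant, which is what yields joint independence. The H_i are
    built from [eta] itself: two independent copies on a product space, in which parameters adding
    up to n/2 are paired. Convergence in distribution involves laws only, so each n may use its own
    product space for the coupling. *)

Section borel_row_vectors.
Context {R : realType} {n : nat}.

Lemma open_measurable_rV (A : set 'rV[R]_n) : open A -> measurable A.
Proof. by move=> oA; apply: sub_sigma_algebra. Qed.

Lemma continuous_measurable_rV (f : 'rV[R]_n -> R) :
  continuous f -> measurable_fun setT f.
Proof.
move=> cf; apply: (measurability _ (RGenOInfty.measurableE R)) => //.
move=> _ [_ [x ->] <-]; rewrite setTI; apply: open_measurable_rV.
by apply: open_comp => // y _; exact: cf.
Qed.

Lemma measurable_coord (i : 'I_n) : measurable_fun setT (fun x : 'rV[R]_n => x 0 i).
Proof. by apply: continuous_measurable_rV => x; exact: coord_continuous. Qed.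

Lemma mulmxr_continuous (U : 'M[R]_n) : continuous (fun x : 'rV[R]_n => x *m U).
Proof.
move=> x; apply/(@cvg_ballP _ _ _ _ (nbhs_filter x)) => e e0.
suff : \forall y \near x, forall ij : 'I_1 * 'I_n,
    ball ((x *m U) ij.1 ij.2) e ((y *m U) ij.1 ij.2).
  by apply: filterS => y H; split => // i j; exact: (H (i, j)).
apply: (@filter_forall _ _ _ _ (nbhs_filter x)) => -[i j] /=.
have : (fun y : 'rV[R]_n => (y *m U) i j) @ x --> (x *m U) i j.
  rewrite mxE (_ : (fun y : 'rV[R]_n => _) = fun y => \sum_k y i k * U k j); last first.
    by apply/funext => y; rewrite mxE.
  elim: (index_enum _) => [|k s IH].
    by under eq_fun do rewrite big_nil; rewrite big_nil; exact: (@cvg_cst _ _ _ _ (nbhs_filter x)).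
  under eq_fun do rewrite big_cons; rewrite big_cons.
  apply: (@cvgD _ _ _ _ (nbhs_filter x)) => //.
  apply: (@cvgM _ _ _ (nbhs_filter x)); first exact: coord_continuous.
  exact: (@cvg_cst _ _ _ _ (nbhs_filter x)).
by move/(@cvg_ballP _ _ _ _ (nbhs_filter x)) => /(_ _ e0).
Qed.

Lemma measurable_mulmxr (U : 'M[R]_n) : measurable_fun setT (fun x : 'rV[R]_n => x *m U).
Proof.
apply: (measurability _ (erefl : @measurable _ 'rV[R]_n = <<s @open 'rV[R]_n >>)) => //.
move=> _ [B oB <-]; rewrite setTI; apply: open_measurable_rV.
by apply: open_comp => // y _; exact: mulmxr_continuous.
Qed.

Lemma measurable_row d (T : measurableType d) m (Q : T -> 'M[R]_(n, m)) (f : T -> 'rV[R]_n) :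
  (forall i j, measurable_fun setT (fun w => Q w i j)) ->
  (forall i, measurable_fun setT (fun w => f w 0 i)) ->
  forall j, measurable_fun setT (fun w => (f w *m Q w) 0 j).
Proof.
move=> mQ mf j; under eq_fun do rewrite mxE.
by apply: measurable_sum => k; apply: measurable_funM.
Qed.

Lemma measurable_sqnorm d (T : measurableType d) (f : T -> 'rV[R]_n) :
  (forall i, measurable_fun setT (fun w => f w 0 i)) ->
  measurable_fun setT (fun w => sqnorm (f w)).
Proof. by move=> mf; apply: measurable_sum => i; apply: measurable_funM. Qed.

Lemma sqnorm_ge0 (x : 'rV[R]_n) : 0 <= sqnorm x.
Proof. by apply: sumr_ge0 => i _; rewrite -expr2 sqr_ge0. Qed.

Lemma sqnorm_eq0 (x : 'rV[R]_n) : (sqnorm x == 0) = (x == 0).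
Proof.
apply/eqP/eqP => [x0|->]; last by apply: big1 => i _; rewrite mxE mul0r.
apply/rowP => i; rewrite mxE; apply/eqP; rewrite -sqrf_eq0 expr2.
by have /psumr_eq0P -> // := x0 => j _; rewrite -expr2 sqr_ge0.
Qed.

Lemma dotvE (x y : 'rV[R]_n) : dotv x y = (x *m y^T) 0 0.
Proof. by rewrite mxE; apply: eq_bigr => i _; rewrite mxE. Qed.

Lemma dotvC (x y : 'rV[R]_n) : dotv x y = dotv y x.
Proof. by apply: eq_bigr => i _; rewrite mulrC. Qed.

Lemma norm_coordM_le (x : 'rV[R]_n) i j : `|x 0 i * x 0 j| <= sqnorm x.
Proof.
have h k : x 0 k ^+ 2 <= sqnorm x.
  rewrite /sqnorm /dotv (bigD1 k) //= -expr2 lerDl.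
  by apply: sumr_ge0 => l _; rewrite -expr2 sqr_ge0.
have := h i; have := h j; rewrite -!(@real_normK _ (x 0 _)) ?num_real // normrM.
set a := `|x 0 i|; set b := `|x 0 j|; have := sqr_ge0 (a - b) => ? ? ?.
by nra.
Qed.

End borel_row_vectors.

Lemma measurable_funV d (T : measurableType d) (R : realType) (f : T -> R) :
  measurable_fun setT f -> measurable_fun setT (fun w => (f w)^-1).
Proof.
move=> mf; rewrite (_ : (fun w => _) = fun w => f w * (f w ^+ 2) `^ (-1)).
  apply: measurable_funM => //.
  apply: (measurableT_comp (measurable_powR _)).
  exact: measurable_funX.
apply/funext => w; rewrite powR_inv1 ?sqr_ge0 // expr2 invfM.
by have [->|f0] := eqVneq (f w) 0; [rewrite invr0 mul0r|rewrite mulVKf].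
Qed.

Section projections.
Context {R : realType} {n : nat}.
Implicit Types (x : 'rV[R]_n) (Q : 'M[R]_n).

(** At x = 0 the value is 0 by the convention on division, so the bounds 0 and 1 hold everywhere. *)
Definition frac Q x : R := sqnorm (x *m Q) / sqnorm x.

Lemma frac_ge0 Q x : 0 <= frac Q x.
Proof. by rewrite divr_ge0 ?sqnorm_ge0. Qed.

Definition ortho_proj Q := Q^T = Q /\ Q *m Q = Q.

Lemma dotv_proj Q x y : ortho_proj Q -> dotv (x *m Q) (y *m Q) = dotv (x *m Q) y.
Proof. by case=> QT QQ; rewrite !dotvE trmx_mul QT -!mulmxA (mulmxA Q Q) QQ. Qed.

Lemma frac_le1 Q x : ortho_proj Q -> frac Q x <= 1.
Proof.
move=> pQ; have [->|x0] := eqVneq x 0.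
  by rewrite /frac mul0mx (_ : sqnorm 0 = 0) ?mul0r ?ler01 //; apply/eqP; rewrite sqnorm_eq0.
rewrite ler_pdivrMr ?mul1r ?lt_def ?sqnorm_eq0 ?x0 ?sqnorm_ge0 //.
have : 0 <= sqnorm (x - x *m Q) by exact: sqnorm_ge0.
have -> : sqnorm (x - x *m Q) = sqnorm x - 2 * dotv (x *m Q) x + sqnorm (x *m Q).
  rewrite /sqnorm /dotv mulr_sumr -sumrB -big_split /=.
  by apply: eq_bigr => i _; rewrite !mxE; ring.
by rewrite -dotv_proj // /sqnorm; lra.
Qed.

Lemma measurable_frac d (T : measurableType d) (Q : T -> 'M[R]_n) (f : T -> 'rV[R]_n) :
  (forall i j, measurable_fun setT (fun w => Q w i j)) ->
  (forall i, measurable_fun setT (fun w => f w 0 i)) ->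
  measurable_fun setT (fun w => frac (Q w) (f w)).
Proof.
move=> mQ mf; apply: measurable_funM.
  by apply: measurable_sqnorm; exact: measurable_row.
apply: measurable_funV; exact: measurable_sqnorm.
Qed.
End projections.

(** * Rotations in coordinate planes *)

Section real_derivatives.
Context {R : realType}.
Implicit Types (f g : R -> R) (t : R).

Lemma is_derive_cst_fun (c : R) t : is_derive t (1:R) (fun=> c) 0.
Proof. exact: is_derive_cst. Qed.

Lemma is_derive_add f g t df dg : is_derive t (1:R) f df -> is_derive t (1:R) g dg ->
  is_derive t (1:R) (fun t => f t + g t) (df + dg).
Proof. exact: is_deriveD. Qed.

Lemma is_derive_mul f g t df dg : is_derive t (1:R) f df -> is_derive t (1:R) g dg ->
  is_derive t (1:R) (fun t => f t * g t) (df * g t + f t * dg).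
Proof.
move=> hf hg; apply: (is_derive_eq (is_deriveM hf hg)).
by rewrite /GRing.scale /= addrC mulrC.
Qed.

Lemma is_derive_mulr f (c : R) t df : is_derive t (1:R) f df ->
  is_derive t (1:R) (fun t => f t * c) (df * c).
Proof.
move=> hf; apply: (is_derive_eq (is_derive_mul hf (is_derive_cst_fun c t))).
by rewrite mulr0 addr0.
Qed.

Lemma is_derive_sum_fun (I : Type) (s : seq I) (f : I -> R -> R) t (df : I -> R) :
  (forall i, is_derive t (1:R) (f i) (df i)) ->
  is_derive t (1:R) (fun t => \sum_(i <- s) f i t) (\sum_(i <- s) df i).
Proof.
move=> h; elim: s => [|i s IH].
  under eq_fun do rewrite big_nil.
  by rewrite big_nil; exact: is_derive_cst_fun.
under eq_fun do rewrite big_cons.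
by rewrite big_cons; exact: is_derive_add.
Qed.

End real_derivatives.

Section rotations.
Context {R : realType} {n : nat}.
Implicit Types (x : 'rV[R]_n) (Q M : 'M[R]_n) (i j : 'I_n).

Definition plane_diag i j : 'M[R]_n := delta_mx i i + delta_mx j j.
Definition plane_skew i j : 'M[R]_n := delta_mx i j - delta_mx j i.

(** For i != j this is the exponential of [t *: plane_skew i j], the rotation by the angle t in the
    (i, j)-plane. *)
Definition givens i j (t : R) : 'M[R]_n :=
  1%:M + (cos t - 1) *: plane_diag i j + sin t *: plane_skew i j.

Lemma plane_mul i j : i != j ->
  [/\ plane_diag i j *m plane_diag i j = plane_diag i j,
      plane_diag i j *m plane_skew i j = plane_skew i j,
      plane_skew i j *m plane_diag i j = plane_skew i j &
      plane_skew i j *m plane_skew i j = - plane_diag i j].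
Proof.
move=> ij; have ji : (j == i) = false by rewrite eq_sym (negbTE ij).
have {ij}ij : (i == j) = false by apply/negbTE.
by split; rewrite /plane_diag /plane_skew !(mulmxDl, mulmxDr, mulmxBl, mulmxBr, mulNmx, mulmxN);
  rewrite !mul_delta_mx_cond ?eqxx ?ij ?ji ?mulr1n ?mulr0n;
  rewrite ?(addr0, add0r, subr0, sub0r, opprB, opprD, opprK, oppr0) // addrC.
Qed.

Lemma givensM i j s t : i != j -> givens i j s *m givens i j t = givens i j (s + t).
Proof.
move=> /plane_mul[DD DS SD SS]; rewrite /givens.
set D := plane_diag i j in DD DS SD SS *; set S := plane_skew i j in DD DS SD SS *.
rewrite !(mulmxDl, mulmxDr) !mul1mx !mulmx1 -!scalemxAl -!scalemxAr !DD DS SD SS.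
rewrite cosD sinD; apply/matrixP => a b; rewrite !mxE; ring.
Qed.

Lemma givens0 i j : givens i j 0 = 1%:M.
Proof. by rewrite /givens cos0 sin0 subrr !scale0r !addr0. Qed.

Lemma givens_tr i j t : (givens i j t)^T = givens i j (- t).
Proof.
apply/matrixP => a b; rewrite !mxE cosN sinN (eq_sym b a) !(andbC (b == _)).
ring.
Qed.

Lemma givens_rotation i j t : i != j -> rotation (givens i j t).
Proof.
move=> ij; have oG s : givens i j s *m (givens i j s)^T = 1%:M.
  by rewrite givens_tr givensM // subrr givens0.
split; first exact: oG.
(* Orthogonality alone leaves the sign of the determinant open; it is 1 because the matrix is the
   square of the rotation by t / 2. *)
rewrite (splitr t) -givensM // det_mulmx.
by have := oG (t / 2); move/(congr1 determinant); rewrite det_mulmx det_tr det1.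
Qed.

Lemma sqnorm_givens i j t x : i != j -> sqnorm (x *m givens i j t) = sqnorm x.
Proof.
move=> ij; rewrite /sqnorm !dotvE trmx_mul -mulmxA (mulmxA (givens i j t)).
by case: (givens_rotation t ij) => -> _; rewrite mul1mx.
Qed.

(** Differentiating a one-parameter group inserts its generator. The free matrix [M] covers the
    coordinates of both x and xQ. *)
Lemma is_derive_givens i j x M k t : i != j ->
  is_derive t (1:R) (fun t => (x *m givens i j t *m M) 0 k)
    ((x *m givens i j t *m plane_skew i j *m M) 0 k).
Proof.
rewrite /givens => /plane_mul.
move: (plane_diag i j) (plane_skew i j) => D S [DD DS SD SS].
rewrite (_ : (fun t => _) = fun t => (x *m M) 0 k + (cos t - 1) * (x *m D *m M) 0 k
    + sin t * (x *m S *m M) 0 k); last first.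
  apply/funext => s; rewrite !(mulmxDl, mulmxDr) mulmx1.
  by rewrite -!scalemxAr -!scalemxAl !mxE.
have -> : (x *m (1%:M + (cos t - 1) *: D + sin t *: S) *m S *m M) 0 k =
    - sin t * (x *m D *m M) 0 k + cos t * (x *m S *m M) 0 k.
  rewrite -(mulmxA x) !mulmxDl mul1mx -!scalemxAl DS SS.
  rewrite !(mulmxDr, mulmxDl) -!scalemxAr -!scalemxAl !(mulmxN, mulNmx).
  have addE (u v : 'rV[R]_n) : (u + v) 0 k = u 0 k + v 0 k by rewrite mxE.
  have scaleE c (u : 'rV[R]_n) : (c *: u) 0 k = c * u 0 k by rewrite mxE.
  have oppE (u : 'rV[R]_n) : (- u) 0 k = - u 0 k by rewrite mxE.
  rewrite !(addE, scaleE, oppE); ring.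
apply: is_derive_add; last exact: is_derive_mulr.
rewrite -[X in is_derive _ _ _ X]add0r; apply: is_derive_add.
apply: is_derive_mulr; rewrite -[X in is_derive _ _ _ X]addr0.
exact: is_derive_add.
Qed.

End rotations.

(** * The law of the projected fraction of a spherical vector *)

Definition RV_of {R : realType} d d' {T : measurableType d} {T' : measurableType d'}
  (P : probability T R) (f : T -> T') (mf : measurable_fun setT f) : {RV P >-> T'} :=
  mfun_Sub (mem_set mf).

Section probability_integrals.
Context {R : realType} d {T : measurableType d} (P : probability T R).

Lemma Rintegrable_bounded (f : T -> R) (M : R) :
  measurable_fun setT f -> (forall x, `|f x| <= M) -> P.-integrable setT (EFin \o f).
Proof.
move=> mf fM; apply: measurable_bounded_integrable => //; first exact: (le_lt_trans (probability_le1 _ _) (ltry _)).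
by exists M; split; [exact: num_real|] => N MN x _; exact: le_trans (fM x) (ltW MN).
Qed.

Lemma Rintegral_cst_prob (r : R) : \int[P]_x cst r x = r.
Proof. by rewrite Rintegral_cst // [X in fine X](probability_setT P : _ = 1%E) mulr1. Qed.

Lemma Rintegral_invariant (phi : T -> T) (f : T -> R) (M : R) :
  measurable_fun setT phi -> (forall A, measurable A -> P (phi @^-1` A) = P A) ->
  measurable_fun setT f -> (forall x, `|f x| <= M) ->
  \int[P]_x f (phi x) = \int[P]_x f x.
Proof.
move=> mphi Pphi mf fM; rewrite /Rintegral; congr fine.
pose X : {RV P >-> T} := RV_of P mphi.
transitivity (\int[distribution P X]_x (f x)%:E)%E.
  rewrite integral_distribution //; first exact/measurable_EFinP.
  apply: (@Rintegrable_bounded (f \o phi) M); first exact: measurableT_comp.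
  by move=> x; exact: fM.
by apply: eq_measure_integral => A mA _; exact: Pphi.
Qed.

End probability_integrals.

Section rotation_invariance.
Context {R : realType} {n : nat} (nu : probability 'rV[R]_n R) (Q : 'M[R]_n).
Hypothesis nu_inv : forall (U : 'M[R]_n) (A : set 'rV[R]_n),
  rotation U -> measurable A -> nu [set x | A (x *m U)] = nu A.
Hypothesis projQ : ortho_proj Q.
Implicit Types (x y : 'rV[R]_n).

Lemma Rintegral_rotation (U : 'M[R]_n) (f : 'rV[R]_n -> R) (C : R) : rotation U ->
  measurable_fun setT f -> (forall x, `|f x| <= C) ->
  \int[nu]_x f (x *m U) = \int[nu]_x f x.
Proof.
move=> rU mf fC; apply: (Rintegral_invariant (measurable_mulmxr U) _ mf fC).
by move=> A mA; exact: nu_inv.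
Qed.

Variables (h dh : R -> R) (C : R).
Hypothesis mh : measurable_fun setT h.
Hypothesis mdh : measurable_fun setT dh.
Hypothesis h_derive : forall u : R, 0 <= u <= 1 -> is_derive u (1:R) h (dh u).
Hypothesis hC : forall u : R, 0 <= u <= 1 -> `|h u| <= C.
Hypothesis dhC : forall u : R, 0 <= u <= 1 -> `|dh u| <= C.

(** Let q = xQ, u the fraction, and L the derivative along the rotations of the (i, j)-plane. Since
    L u = 2 (x_i q_j - x_j q_i) / |x|^2, the difference of [rot_fun i j] and [rot_fun j i] is -h(u)
    (L u) / 2. Exchanging i and j also changes the sign of L, so the sum over i, j of the
    derivatives is -1/2 times the spherical Laplacian of a primitive of h at u. *)
Definition rot_fun (i j : 'I_n) x : R :=
  (x *m Q) 0 i * x 0 j / sqnorm x * h (frac Q x).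

(* The derivative of rot_fun along the rotations of the (i, j)-plane; invariance makes its integral
   vanish. *)
Definition rot_dfun (i j : 'I_n) x : R :=
  let K := plane_skew i j in
  ((x *m K *m Q) 0 i * x 0 j + (x *m Q) 0 i * (x *m K) 0 j) / sqnorm x * h (frac Q x)
  + (x *m Q) 0 i * x 0 j / sqnorm x
    * (dh (frac Q x) * (2 * dotv (x *m Q) (x *m K *m Q) / sqnorm x)).

Lemma frac01 x : 0 <= frac Q x <= 1.
Proof. by rewrite frac_ge0 frac_le1. Qed.

Lemma is_derive_rot_fun i j x t : i != j ->
  is_derive t (1:R) (fun t => rot_fun i j (x *m givens i j t))
    (rot_dfun i j (x *m givens i j t)).
Proof.
move=> ij; rewrite /rot_fun /rot_dfun /= /frac.
(* The norm is constant along the rotation, so only the numerators get differentiated. *)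
under eq_fun do rewrite sqnorm_givens //.
rewrite sqnorm_givens //.
have d1 k := is_derive_givens x Q k t ij.
have d2 : is_derive t (1:R) (fun t => (x *m givens i j t) 0 j)
    ((x *m givens i j t *m plane_skew i j) 0 j).
  have := is_derive_givens x 1%:M j t ij; rewrite mulmx1.
  by under eq_fun do rewrite mulmx1.
apply: is_derive_mul; first by apply: is_derive_mulr; exact: is_derive_mul.
apply: (@is_derive1_comp _ h (fun t => sqnorm (x *m givens i j t *m Q) / sqnorm x)).
  by apply: h_derive; have := frac01 (x *m givens i j t); rewrite /frac sqnorm_givens.
apply: is_derive_mulr.
have -> : 2 * dotv (x *m givens i j t *m Q) (x *m givens i j t *m plane_skew i j *m Q) =
   \sum_k ((x *m givens i j t *m plane_skew i j *m Q) 0 k * (x *m givens i j t *m Q) 0 k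
   + (x *m givens i j t *m Q) 0 k * (x *m givens i j t *m plane_skew i j *m Q) 0 k).
  rewrite big_split /= mulr_natl mulr2n; congr (_ + _).
  by apply: eq_bigr => k _; rewrite mulrC.
by apply: is_derive_sum_fun => k; exact: is_derive_mul.
Qed.

(** A quadratic form divided by |x|^2 is bounded by homogeneity. Such bounds provide the constant
    dominating functions for differentiating under the integral. *)
Lemma bounded_quadratic (A B : 'M[R]_n) i j :
  exists2 M : R, 0 <= M & forall x, `|(x *m A) 0 i * (x *m B) 0 j / sqnorm x| <= M.
Proof.
exists (\sum_k \sum_l `|A k i * B l j|).
  by apply: sumr_ge0 => k _; exact: sumr_ge0.
move=> x; rewrite !mxE mulr_suml mulr_suml; apply: le_trans (ler_norm_sum _ _ _) _.
apply: ler_sum => k _; rewrite mulr_sumr mulr_suml.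
apply: le_trans (ler_norm_sum _ _ _) _; apply: ler_sum => l _.
have -> : x 0 k * A k i * (x 0 l * B l j) / sqnorm x
   = x 0 k * x 0 l / sqnorm x * (A k i * B l j) by ring.
rewrite normrM ler_piMl // normrM normfV (ger0_norm (sqnorm_ge0 x)).
have [->|x0] := eqVneq (sqnorm x) 0; first by rewrite invr0 mulr0.
by rewrite ler_pdivrMr ?mul1r ?norm_coordM_le // lt_def x0 sqnorm_ge0.
Qed.

Lemma bounded_rot_fun i j : exists M : R, forall x, `|rot_fun i j x| <= M.
Proof.
have [M M0 hM] := bounded_quadratic Q 1%:M i j.
exists (M * C) => x; rewrite normrM; apply: ler_pM => //; last exact/hC/frac01.
by have := hM x; rewrite mulmx1.
Qed.

Lemma bounded_rot_dfun i j : exists2 M : R, 0 <= M & forall x, `|rot_dfun i j x| <= M.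
Proof.
have [M1 M10 hM1] := bounded_quadratic (plane_skew i j *m Q) 1%:M i j.
have [M2 M20 hM2] := bounded_quadratic Q (plane_skew i j) i j.
have [M3 M30 hM3] := bounded_quadratic Q 1%:M i j.
have /(_ _)/cid2-/all_sig2[M4 M40 hM4] := fun k => bounded_quadratic Q (plane_skew i j *m Q) k k.
have C0 : 0 <= C by apply: le_trans (normr_ge0 (h 0)) (hC _); rewrite lexx ler01.
exists ((M1 + M2) * C + M3 * (C * (2 * \sum_k M4 k))).
  rewrite addr_ge0 // ?mulr_ge0 // ?addr_ge0 // sumr_ge0 // => k _; exact: M40.
move=> x; rewrite /rot_dfun /=.
apply: le_trans (ler_normD _ _) _; apply: lerD.
  rewrite normrM; apply: ler_pM => //; last exact/hC/frac01.
  rewrite mulrDl; apply: le_trans (ler_normD _ _) _; apply: lerD.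
    by have := hM1 x; rewrite mulmx1 mulmxA.
  exact: hM2.
rewrite normrM; apply: ler_pM => //; first by have := hM3 x; rewrite mulmx1.
rewrite normrM; apply: ler_pM => //; first exact/dhC/frac01.
rewrite -mulrA normrM ger0_norm // ler_pM2l //.
rewrite /dotv mulr_suml; apply: le_trans (ler_norm_sum _ _ _) _.
by apply: ler_sum => k _; have := hM4 k x; rewrite mulmxA.
Qed.

Lemma measurable_rot_fun i j : measurable_fun setT (rot_fun i j).
Proof.
have mc := @measurable_coord R n.
apply: measurable_funM; last by apply: (measurableT_comp mh); exact: measurable_frac.
apply: measurable_funM; last by apply: measurable_funV; exact: measurable_sqnorm.
by apply: measurable_funM => //; exact: measurable_row.
Qed.

Lemma measurable_rot_dfun i j : measurable_fun setT (rot_dfun i j).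
Proof.
have mc := @measurable_coord R n.
have mi : measurable_fun setT (fun x : 'rV[R]_n => (sqnorm x)^-1).
  by apply: measurable_funV; exact: measurable_sqnorm.
have mr M k : measurable_fun setT (fun x : 'rV[R]_n => (x *m M) 0 k).
  exact: measurable_row.
have mr2 k : measurable_fun setT (fun x : 'rV[R]_n => (x *m plane_skew i j *m Q) 0 k).
  by under eq_fun do rewrite -mulmxA; exact: mr.
have mf (g : R -> R) : measurable_fun setT g -> measurable_fun setT (fun x : 'rV[R]_n => g (frac Q x)).
  by move=> mg; apply: (measurableT_comp mg); exact: measurable_frac.
apply: measurable_funD; apply: measurable_funM.
- apply: measurable_funM => //; apply: measurable_funD; exact: measurable_funM.
- exact: mf.
- by apply: measurable_funM => //; exact: measurable_funM.
- apply: measurable_funM; first exact: mf.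
  apply: measurable_funM => //; apply: measurable_funM => //.
  by apply: measurable_sum => k; exact: measurable_funM.
Qed.

Lemma Rintegral_rot_dfun i j : \int[nu]_x rot_dfun i j x = 0.
Proof.
(* For i = j there is no plane to rotate, but the generator is 0 and so is [rot_dfun]. *)
have [->|ij] := eqVneq i j.
  rewrite (_ : rot_dfun j j = fun=> 0) ?Rintegral_cst ?mul0r //.
  apply/funext => x; rewrite /rot_dfun /plane_skew subrr !mulmx0 !mul0mx.
  rewrite /dotv big1 => [|k _]; last by rewrite [X in _ * X]mxE mulr0.
  have mx00 (l : 'I_n) : (0 : 'rV[R]_n) 0 l = 0 by rewrite mxE.
  by rewrite !mx00; ring.
have [M hM] := bounded_rot_fun i j.
have [M' M'0 hM'] := bounded_rot_dfun i j.
pose f (t : R) (x : 'rV[R]_n) := rot_fun i j (x *m givens i j t).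
have df t x : partial1of2 f t x = rot_dfun i j (x *m givens i j t).
  by rewrite partial1of2E; have := is_derive_rot_fun x t ij => dr; rewrite derive_val.
have m1 t : measurable_fun setT (f t).
  by apply: (measurableT_comp (measurable_rot_fun i j)); exact: measurable_mulmxr.
have I0 : `](-1 : R), 1[%classic 0 by rewrite /= in_itv /= ltrN10 ltr01.
have H : derive1 (fun t => \int[nu]_x f t x) 0 = \int[nu]_x partial1of2 f 0 x.
  apply: (@differentiation_under_integral R _ _ nu f setT measurableT 0 (-1) 1 I0 _ _ (cst M')).
  - by move=> t _; apply: (@Rintegrable_bounded _ _ _ _ _ M) => // x; exact: hM.
  - by move=> t x _ _; have := is_derive_rot_fun x t ij => -[].
  - by [].
  - by apply: (@Rintegrable_bounded _ _ _ _ _ M') => // x; rewrite ger0_norm.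
  - by move=> t x _ _; rewrite df.
have -> : \int[nu]_x rot_dfun i j x = \int[nu]_x partial1of2 f 0 x.
  by apply: eq_Rintegral => x _; rewrite df givens0 mulmx1.
rewrite -H.
rewrite (_ : (fun t => _) = cst (\int[nu]_x rot_fun i j x)) ?derive1_cst //.
apply/funext => t; apply: (@Rintegral_rotation _ _ M) => //; first exact: givens_rotation.
exact: measurable_rot_fun.
Qed.

End rotation_invariance.

(** * The spherical Laplacian on functions of the projected fraction *)

Section casimir.
Context {R : realType} {n : nat} (Q : 'M[R]_n).
Hypothesis projQ : ortho_proj Q.
Implicit Types (x : 'rV[R]_n) (M : 'M[R]_n) (h dh : R -> R).

Lemma plane_skewE i j x M k :
  (x *m plane_skew i j *m M) 0 k = x 0 i * M j k - x 0 j * M i k.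
Proof.
have dE (a b : 'I_n) : (x *m delta_mx a b *m M) 0 k = x 0 a * M b k.
  have -> : x *m delta_mx a b = x 0 a *: delta_mx 0 b.
    apply/rowP => c; rewrite !mxE (bigD1 a) //= big1 => [|l la]; rewrite !mxE.
      by rewrite !eqxx addr0.
    by rewrite (negbTE la) mulr0.
  by rewrite -scalemxAl -rowE !mxE.
by rewrite /plane_skew mulmxBr mulmxBl mxE dE mxE dE.
Qed.

Lemma dotv_skew i j x : dotv (x *m Q) (x *m plane_skew i j *m Q) =
  x 0 i * (x *m Q) 0 j - x 0 j * (x *m Q) 0 i.
Proof.
rewrite dotv_proj // /dotv.
under eq_bigr => k _.
  have := plane_skewE i j x 1%:M k; rewrite mulmx1 => ->.
  rewrite mulrBr !mxE.
  over.
have dE (a b : 'I_n) : \sum_(k < n) (x *m Q) 0 k * (x 0 a * (b == k)%:R) = x 0 a * (x *m Q) 0 b.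
  rewrite (bigD1 b) //= big1 ?addr0 => [|k kb]; first by rewrite eqxx mulr1 mulrC.
  by rewrite eq_sym (negbTE kb) !mulr0.
by rewrite sumrB; congr (_ - _); rewrite -dE; apply: eq_bigr => k _; rewrite mxE.
Qed.

(** On the unit sphere the Laplacian of u is 2 (tr Q - n u) and its squared gradient is 4 (u - u^2);
    the right side is -1/2 times the resulting Laplacian of a primitive of h. That these are
    functions of u alone rests on |xQ|^2 = <xQ, x> for an orthogonal projection. *)
Lemma sum_rot_dfun h dh x : x != 0 ->
  \sum_i \sum_j rot_dfun Q h dh i j x =
  (n%:R * frac Q x - \tr Q) * h (frac Q x) + 2 * (frac Q x ^+ 2 - frac Q x) * dh (frac Q x).
Proof.
move=> x0; have N0 : sqnorm x != 0 by rewrite sqnorm_eq0.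
set q := x *m Q; set N := sqnorm x; set u := frac Q x.
have uN : dotv q x = u * N by rewrite -dotv_proj // /u /frac mulfVK.
have uN' : sqnorm q = u * N by rewrite /u /frac mulfVK.
(* The expansion of [rot_dfun], with the factors independent of i and j moved to the right; [s1] to
   [s6] evaluate the six double sums. *)
pose a (i j : 'I_n) := (x 0 i * Q j i * x 0 j) * (h u / N) - (x 0 j ^+ 2 * Q i i) * (h u / N)
  + (q 0 i * x 0 i) * (h u / N) - (q 0 i * x 0 j * (i == j)%:R) * (h u / N)
  + ((q 0 i * x 0 i) * (x 0 j * q 0 j)) * (2 * dh u / N ^+ 2)
  - ((q 0 i ^+ 2) * (x 0 j ^+ 2)) * (2 * dh u / N ^+ 2).
have rE i j : rot_dfun Q h dh i j x = a i j.
  rewrite /rot_dfun /= dotv_skew plane_skewE.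
  have -> : (x *m plane_skew i j) 0 j = x 0 i - x 0 j * (i == j)%:R.
    by have := plane_skewE i j x 1%:M j; rewrite mulmx1 => ->; rewrite !mxE eqxx mulr1.
  by rewrite -/q -/N -/u /a; field.
have s1 : \sum_i \sum_j x 0 i * Q j i * x 0 j = u * N.
  rewrite -uN dotvC; apply: eq_bigr => i _; rewrite /q mxE mulr_sumr.
  by apply: eq_bigr => j _; ring.
have sq : \sum_j x 0 j ^+ 2 = N by apply: eq_bigr => j _; rewrite expr2.
have sqq : \sum_j q 0 j ^+ 2 = u * N by rewrite -uN'; apply: eq_bigr => j _; rewrite expr2.
have s2 : \sum_i \sum_(j < n) x 0 j ^+ 2 * Q i i = N * \tr Q.
  by rewrite mulr_sumr; apply: eq_bigr => i _; rewrite -mulr_suml sq.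
have s3 : \sum_(i < n) \sum_(j < n) q 0 i * x 0 i = n%:R * (u * N).
  rewrite -uN mulr_sumr; apply: eq_bigr => i _.
  by rewrite sumr_const card_ord mulr_natl.
have s4 : \sum_(i < n) \sum_(j < n) q 0 i * x 0 j * (i == j)%:R = u * N.
  rewrite -uN; apply: eq_bigr => i _; rewrite (bigD1 i) //= big1 ?eqxx ?mulr1 ?addr0 // => j ji.
  by rewrite eq_sym (negbTE ji) mulr0.
have s5 : \sum_(i < n) \sum_(j < n) (q 0 i * x 0 i) * (x 0 j * q 0 j) = (u * N) ^+ 2.
  rewrite -uN expr2 mulr_suml; apply: eq_bigr => i _; rewrite mulr_sumr.
  by apply: eq_bigr => j _; rewrite [x 0 j * _]mulrC.
have s6 : \sum_(i < n) \sum_(j < n) (q 0 i ^+ 2) * (x 0 j ^+ 2) = u * N * N.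
  by rewrite -sqq mulr_suml; apply: eq_bigr => i _; rewrite -mulr_sumr sq.
transitivity (\sum_i \sum_j a i j).
  by apply: eq_bigr => i _; apply: eq_bigr => j _.
have sumE (f : 'I_n -> 'I_n -> R) c : \sum_i \sum_j f i j * c = (\sum_i \sum_j f i j) * c.
  by rewrite mulr_suml; apply: eq_bigr => i _; rewrite mulr_suml.
have sumD (f g : 'I_n -> 'I_n -> R) :
    \sum_i \sum_j (f i j + g i j) = (\sum_i \sum_j f i j) + (\sum_i \sum_j g i j).
  by rewrite -big_split; apply: eq_bigr => i _; rewrite -big_split.
have sumN (f : 'I_n -> 'I_n -> R) : \sum_i \sum_j - f i j = - (\sum_i \sum_j f i j).
  by rewrite -sumrN; apply: eq_bigr => i _; rewrite -sumrN.
rewrite /a !(sumD, sumN, sumE) s1 s2 s3 s4 s5 s6; field.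
exact: N0.
Qed.

End casimir.

Section spherical_law.
Context {R : realType} {n : nat} (nu : probability 'rV[R]_n R) (Q : 'M[R]_n).
Hypothesis nu_inv : forall (U : 'M[R]_n) (A : set 'rV[R]_n),
  rotation U -> measurable A -> nu [set x | A (x *m U)] = nu A.
Hypothesis nu0 : nu [set 0] = 0%E.
Hypothesis projQ : ortho_proj Q.
Implicit Types (x : 'rV[R]_n).

Lemma set0_measurable_rV : measurable [set (0 : 'rV[R]_n)].
Proof.
have -> : [set 0] = (@sqnorm R n) @^-1` [set 0].
  apply/seteqP; split => x /= => [->|/eqP]; last by rewrite sqnorm_eq0 => /eqP.
  by apply/eqP; rewrite sqnorm_eq0.
rewrite -[X in measurable X]setTI; apply: measurable_sqnorm => //.
exact: measurable_coord.
Qed.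

Lemma Rintegral_sum_fun (I : finType) (f : I -> 'rV[R]_n -> R) (M : I -> R) :
  (forall i, measurable_fun setT (f i)) -> (forall i x, `|f i x| <= M i) ->
  \int[nu]_x (\sum_i f i x) = \sum_i \int[nu]_x f i x.
Proof.
move=> mf fM.
suff H (s : seq I) : \int[nu]_x (\sum_(i <- s) f i x) = \sum_(i <- s) \int[nu]_x f i x by exact: H.
elim: s => [|i s IH].
  rewrite big_nil; under eq_Rintegral do rewrite big_nil.
  by rewrite Rintegral_cst // mul0r.
rewrite big_cons -IH; under eq_Rintegral do rewrite big_cons.
rewrite RintegralD //; first exact: (@Rintegrable_bounded _ _ _ _ _ (M i)).
apply: (@Rintegrable_bounded _ _ _ _ _ (\sum_(j <- s) M j)).
  exact: measurable_sum.
by move=> x; apply: le_trans (ler_norm_sum _ _ _) _; apply: ler_sum.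
Qed.

(* Sum over i, j of the identities Rintegral_rot_dfun. *)
Lemma casimir_identity (h dh : R -> R) (C : R) :
  measurable_fun setT h -> measurable_fun setT dh ->
  (forall u : R, 0 <= u <= 1 -> is_derive u (1:R) h (dh u)) ->
  (forall u : R, 0 <= u <= 1 -> `|h u| <= C) ->
  (forall u : R, 0 <= u <= 1 -> `|dh u| <= C) ->
  \int[nu]_x ((n%:R * frac Q x - \tr Q) * h (frac Q x)
     + 2 * (frac Q x ^+ 2 - frac Q x) * dh (frac Q x)) = 0.
Proof.
move=> mh mdh hd hC dhC.
have mr i j : measurable_fun setT (rot_dfun Q h dh i j) by exact: measurable_rot_dfun.
have /(_ _)/cid2-/all_sig2 := fun ij : 'I_n * 'I_n => bounded_rot_dfun projQ hC dhC ij.1 ij.2.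
move=> [M M0 hM].
transitivity (\int[nu]_x (\sum_(ij : 'I_n * 'I_n) rot_dfun Q h dh ij.1 ij.2 x)).
  rewrite /Rintegral; congr fine.
  have mfr : measurable_fun setT (frac Q) by apply: measurable_frac => // i; exact: measurable_coord.
  apply: ae_eq_integral => //.
  - apply/measurable_EFinP; apply: measurable_funD; apply: measurable_funM.
    + by apply: measurable_funB => //; exact: measurable_funM.
    + exact: measurableT_comp.
    + apply: measurable_funM => //; apply: measurable_funB => //; exact: measurable_funX.
    + exact: measurableT_comp.
  - by apply/measurable_EFinP; apply: measurable_sum => ij.
  (* The pointwise identity [sum_rot_dfun] requires x != 0, and 0 has measure 0. *)
  - exists [set 0]; split => //; first exact: set0_measurable_rV.
    move=> x /= /not_implyP[_ xE]; apply: contrapT => x0; apply: xE; congr (_%:E).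
    rewrite -(sum_rot_dfun projQ); last exact/eqP.
    by rewrite pair_bigA.
rewrite (Rintegral_sum_fun (fun ij => mr ij.1 ij.2) hM).
by apply: big1 => ij _; exact: (Rintegral_rot_dfun nu_inv projQ mh hd hC dhC ij.1 ij.2).
Qed.

End spherical_law.

(** * The transform of the projected fraction by a differential equation *)

Section spherical_laplace.
Context {R : realType} {n : nat} (nu : probability 'rV[R]_n R) (Q : 'M[R]_n).
Hypothesis nu_inv : forall (U : 'M[R]_n) (A : set 'rV[R]_n),
  rotation U -> measurable A -> nu [set x | A (x *m U)] = nu A.
Hypothesis nu0 : nu [set 0] = 0%E.
Hypothesis projQ : ortho_proj Q.
Implicit Types (x : 'rV[R]_n) (s t u v l p : R).

Lemma powRN_le l v p : 0 < l -> l <= v -> 0 <= p -> v `^ (- p) <= l `^ (- p).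
Proof.
move=> l0 lv p0; have v0 : 0 < v by exact: lt_le_trans lv.
rewrite !powRN lef_pV2 ?posrE ?powR_gt0 //.
by apply: ge0_ler_powR => //; rewrite nnegrE ltW.
Qed.

Lemma powR_mulB1 v p : 0 < v -> v `^ p = v * v `^ (p - 1).
Proof.
move=> v0; rewrite -{2}[v]powRr1 ?ltW // -powRD; first by rewrite addrC subrK.
by rewrite (gt_eqF v0) implybT.
Qed.

Lemma affine_ge s l u : l <= 1 -> l <= 1 + s -> 0 <= u <= 1 -> l <= 1 + s * u.
Proof. by move=> l1 ls /andP[u0 u1]; nra. Qed.

(* The case h(u) = (1 + s u)^(-n/2) of casimir_identity: a linear differential equation for the
   transform of spherical_laplace in the variable t = ln (1 + s). *)
Lemma frac_pow_identity s : -1 < s ->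
  \int[nu]_x ((n%:R * (1 + s) * frac Q x - \tr Q * (1 + s * frac Q x))
     * (1 + s * frac Q x) `^ (- (n%:R / 2) - 1)) = 0.
Proof.
move=> s1.
(* As [1 + s * u] lies between 1 and [1 + s], this [l] keeps the base of the powers away from 0,
   which bounds [h] and [dh] on [0, 1]. *)
have [l [l0 l1 ls]] : exists l, [/\ 0 < l, l <= 1 & l <= 1 + s].
  by exists (Num.min 1 (1 + s)); rewrite lt_min !ge_min !lexx orbT; split=> //; lra.
pose p : R := n%:R / 2; have p0 : 0 <= p by rewrite divr_ge0.
(* With the exponent n/2 the terms in u^2 cancel, which leaves an affine function of u times a
   single power. *)
pose h (u : R) := (1 + s * u) `^ (- p).
pose dh (u : R) := - p * (1 + s * u) `^ (- p - 1) * s.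
have mlin : measurable_fun setT (fun u : R => 1 + s * u).
  by apply: measurable_funD => //; exact: measurable_funM.
have mpow q : measurable_fun setT (fun u : R => (1 + s * u) `^ q).
  exact: (measurableT_comp (measurable_powR q) mlin).
have hd (u : R) : 0 <= u <= 1 -> is_derive u (1:R) h (dh u).
  move=> u01; have v0 : 0 < 1 + s * u by apply: lt_le_trans l0 _; exact: affine_ge.
  apply: (@is_derive1_comp _ (fun v => v `^ (- p)) (fun u => 1 + s * u)); first exact: is_derive1_powR.
  apply: (is_derive_eq (is_derive_add (is_derive_cst_fun 1 u)
    (is_derive_mul (is_derive_cst_fun s u) (is_derive_id u (1:R))))).
  by rewrite mul0r !add0r mulr1.
pose C := l `^ (- p) + p * l `^ (- p - 1) * `|s|.
have lp q : 0 <= l `^ q by exact: powR_ge0.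
have hC (u : R) : 0 <= u <= 1 -> `|h u| <= C.
  move=> u01; rewrite ger0_norm ?powR_ge0 // -[leLHS]addr0.
  by rewrite lerD ?mulr_ge0 ?powRN_le ?affine_ge.
have dhC (u : R) : 0 <= u <= 1 -> `|dh u| <= C.
  move=> u01; rewrite !normrM normrN (ger0_norm p0) (ger0_norm (powR_ge0 _ _)) -[leLHS]add0r.
  rewrite lerD // ler_wpM2r // ler_wpM2l // -opprD powRN_le ?affine_ge //.
  by rewrite addr_ge0.
have mdh : measurable_fun setT dh by apply: measurable_funM => //; exact: measurable_funM.
rewrite -[RHS](casimir_identity nu_inv nu0 projQ (mpow (- p)) mdh hd hC dhC).
apply: eq_Rintegral => x _; rewrite /h /dh -/p.
have v0 : 0 < 1 + s * frac Q x by apply: lt_le_trans l0 _; apply: affine_ge => //; exact: frac01.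
rewrite (powR_mulB1 (- p) v0) /p; set w := _ `^ _; set u := frac Q x; set k : R := n%:R; by field.
Qed.

Let v t x := 1 + (expR t - 1) * frac Q x.

(** The first factor is the integrating factor of the differential equation: with it the integral
    over x does not depend on t. *)
Let psi t x : R := expR (\tr Q / 2 * t) * v t x `^ (- (n%:R / 2)).

Let v_ge l t x : l <= 1 -> l <= expR t -> l <= v t x.
Proof. by move=> l1 lt; apply: affine_ge => //; [lra|exact: frac01]. Qed.

Let v_gt0 t x : 0 < v t x.
Proof.
have : Num.min 1 (expR t) <= v t x by apply: v_ge; rewrite ge_min lexx ?orbT.
by apply: lt_le_trans; rewrite lt_min ltr01 expR_gt0.
Qed.

Let psi_derive t x : is_derive t (1:R) (psi ^~ x)
  (2^-1 * expR (\tr Q / 2 * t) *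
    - ((n%:R * (1 + (expR t - 1)) * frac Q x - \tr Q * (1 + (expR t - 1) * frac Q x))
     * (1 + (expR t - 1) * frac Q x) `^ (- (n%:R / 2) - 1))).
Proof.
have d1 : is_derive t (1:R) (fun t => expR (\tr Q / 2 * t)) (expR (\tr Q / 2 * t) * (\tr Q / 2)).
  apply: (@is_derive1_comp _ expR (fun t => \tr Q / 2 * t)).
  apply: (is_derive_eq (is_derive_mul (is_derive_cst_fun _ t) (is_derive_id t (1:R)))).
  by rewrite mul0r add0r mulr1.
have d2 : is_derive t (1:R) (fun t => v t x) (expR t * frac Q x).
  apply: (is_derive_eq (is_derive_add (is_derive_cst_fun 1 t)
    (is_derive_mulr (frac Q x) (is_derive_add (is_derive_expR t) (is_derive_cst_fun (-1) t))))).
  by rewrite add0r addr0.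
have d3 : is_derive t (1:R) (fun t => v t x `^ (- (n%:R / 2)))
    (- (n%:R / 2) * v t x `^ (- (n%:R / 2) - 1) * (expR t * frac Q x)).
  apply: (@is_derive1_comp _ (fun v => v `^ (- (n%:R / 2))) (fun t => v t x)).
  exact: is_derive1_powR.
apply: (is_derive_eq (is_derive_mul d1 d3)).
rewrite (powR_mulB1 (- (n%:R / 2)) (v_gt0 t x)) -/(v t x); set w := _ `^ _; rewrite /v; by field.
Qed.

(** Put s = e^t - 1 and let H be an independent gamma variable of parameter n/2. The left side is
    the Laplace transform at s of [H * frac Q x], the right side is (1 + s)^(-tr Q / 2). The
    integral of [psi] has derivative 0 by [frac_pow_identity] and equals 1 at t = 0; the variable t
    turns the domain s > -1 into the whole line. *)
Lemma spherical_laplace t :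
  \int[nu]_x ((1 + (expR t - 1) * frac Q x) `^ (- (n%:R / 2))) = expR (- (\tr Q / 2 * t)).
Proof.
have p0 : 0 <= n%:R / 2 :> R by rewrite divr_ge0.
have mfr : measurable_fun setT (frac Q) by apply: measurable_frac => // i; exact: measurable_coord.
have mv s q : measurable_fun setT (fun x => v s x `^ q).
  apply: (measurableT_comp (measurable_powR q)).
  by apply: measurable_funD => //; exact: measurable_funM.
have mpsi s : measurable_fun setT (psi s) by exact: measurable_funM.
have psi_int s : nu.-integrable setT (EFin \o psi s).
  pose l := Num.min 1 (expR s).
  have l0 : 0 < l by rewrite lt_min ltr01 expR_gt0.
  apply: (@Rintegrable_bounded _ _ _ _ _ (expR (\tr Q / 2 * s) * l `^ (- (n%:R / 2)))) => //.
  move=> x; rewrite ger0_norm ?mulr_ge0 ?expR_ge0 ?powR_ge0 // ler_wpM2l ?expR_ge0 //.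
  by apply: powRN_le => //; apply: v_ge; rewrite ge_min lexx ?orbT.
have dpsi s : is_derive s (1:R) (fun s => \int[nu]_x psi s x) 0.
  (* On the window of radius 1 around s, [l] bounds [v] from below, [E] bounds the integrating
     factor, and [M] dominates the derivative of [psi]. *)
  pose l := Num.min 1 (expR (s - 1)).
  have l0 : 0 < l by rewrite lt_min ltr01 expR_gt0.
  pose E := expR (`|\tr Q / 2| * (`|s| + 1)).
  pose M := 2^-1 * E * ((n%:R * expR (s + 1) + `|\tr Q| * (1 + expR (s + 1))) * l `^ (- (n%:R / 2) - 1)).
  have M0 : 0 <= M.
    by rewrite !mulr_ge0 ?expR_ge0 ?powR_ge0 ?addr_ge0 ?mulr_ge0 ?addr_ge0 ?expR_ge0.
  have Is : `](s - 1), (s + 1)[%classic s by rewrite /= in_itv /=; apply/andP; split; lra.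
  have bnd (r : R) x : `](s - 1), (s + 1)[%classic r -> `|partial1of2 psi r x| <= M.
    rewrite /= in_itv /= => /andP[r1 r2].
    rewrite partial1of2E; have dr := psi_derive r x; rewrite derive_val {dr}.
    have /andP[u0 u1] := frac01 projQ x; set u := frac Q x in u0 u1 *.
    have er0 := expR_gt0 r.
    have er : expR r <= expR (s + 1) by rewrite ler_expR ltW.
    rewrite !normrM normrN !normrM /M.
    rewrite (ger0_norm (powR_ge0 _ _)) (ger0_norm (expR_ge0 _)) ger0_norm ?invr_ge0 //.
    apply: ler_pM; rewrite ?mulr_ge0 ?invr_ge0 ?expR_ge0 ?powR_ge0 //.
      rewrite ler_wpM2l ?invr_ge0 // ler_expR; apply: le_trans (ler_norm _) _.
      rewrite normrM ler_wpM2l // ler_norml; have := ler_norm s; have := ler_norm (- s).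
      by rewrite normrN => ? ?; apply/andP; split; lra.
    apply: ler_pM; rewrite ?powR_ge0 //.
      have -> : 1 + (expR r - 1) = expR r by ring.
      apply: le_trans (ler_normB _ _) _; rewrite lerD //.
        rewrite -mulrA normrM ger0_norm // ler_wpM2l // ger0_norm; first by nra.
        exact: mulr_ge0 (ltW er0) u0.
      rewrite normrM ler_wpM2l // ler_norml; apply/andP; split; nra.
    rewrite -opprD powRN_le ?addr_ge0 //.
    by apply: v_ge; rewrite ge_min ?lexx // ler_expR (ltW r1) orbT.
  have H1 := @derivable_under_integral R _ _ nu psi setT measurableT s _ _ Is.
  have H2 := @differentiation_under_integral R _ _ nu psi setT measurableT s _ _ Is.
  have side1 (r : R) : `](s - 1), (s + 1)[%classic r -> nu.-integrable setT (EFin \o psi r) by [].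
  have side2 (r : R) x : `](s - 1), (s + 1)[%classic r -> setT x -> derivable (psi ^~ x) r 1.
    by move=> _ _; have [] := psi_derive r x.
  have side3 : nu.-integrable setT (EFin \o cst M).
    by apply: (@Rintegrable_bounded _ _ _ _ _ M) => // x; rewrite ger0_norm.
  have {}H1 := H1 side1 side2 (cst M) (fun=> M0) side3 (fun r x hr _ => bnd r x hr).
  have {}H2 := H2 side1 side2 (cst M) (fun=> M0) side3 (fun r x hr _ => bnd r x hr).
  apply: DeriveDef => //; rewrite -derive1E H2.
  have s1 : -1 < expR s - 1 by have := expR_gt0 s; lra.
  have := frac_pow_identity s1 => I0.
  rewrite -[RHS](mulr0 (- (2^-1 * expR (\tr Q / 2 * s)))) -[in RHS]I0 -RintegralZl //.
    apply: eq_Rintegral => x _; rewrite partial1of2E; have dr := psi_derive s x.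
    by rewrite derive_val mulrN mulNr.
  pose l' := Num.min 1 (expR s).
  have l'0 : 0 < l' by rewrite lt_min ltr01 expR_gt0.
  apply: (@Rintegrable_bounded _ _ _ _ _ ((n%:R * expR s + `|\tr Q| * (1 + expR s)) * l' `^ (- (n%:R / 2) - 1))).
    apply: measurable_funM; last exact: mv.
    apply: measurable_funB; apply: measurable_funM => //.
    by apply: measurable_funD => //; exact: measurable_funM.
  move=> x; rewrite normrM (ger0_norm (powR_ge0 _ _)).
  have /andP[u0 u1] := frac01 projQ x; set u := frac Q x in u0 u1 *.
  have er0 := expR_gt0 s.
  apply: ler_pM; rewrite ?powR_ge0 //.
    have -> : 1 + (expR s - 1) = expR s by ring.
    apply: le_trans (ler_normB _ _) _; rewrite lerD //.
      rewrite -mulrA normrM ger0_norm // ler_wpM2l // ger0_norm; first by nra.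
      exact: mulr_ge0 (ltW er0) u0.
    rewrite normrM ler_wpM2l // ler_norml; apply/andP; split; nra.
  rewrite -opprD powRN_le ?addr_ge0 //.
  by apply: v_ge; rewrite ge_min ?lexx // orbT.
have psi0 : \int[nu]_x psi 0 x = 1.
  transitivity (\int[nu]_x cst (1:R) x).
    by apply: eq_Rintegral => x _; rewrite /psi mulr0 expR0 /v expR0 subrr mul0r addr0 powR1 mul1r.
  exact: Rintegral_cst_prob.
have := is_derive_0_is_cst t 0 dpsi; rewrite psi0 => psit.
rewrite -[RHS]mulr1 -[X in _ = _ * X]psit -RintegralZl //.
by apply: eq_Rintegral => x _; rewrite /psi mulrA -expRD addNr expR0 mul1r.
Qed.

End spherical_laplace.

(** * Gamma laws and Laplace transforms *)

Section lebesgue_scaling.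
Context {R : realType}.
Local Notation mu := (@lebesgue_measure R).

Lemma measurable_mulrl (c : R) : measurable_fun setT (fun x : R => c * x).
Proof. exact: measurable_funM. Qed.

(** Lebesgue measure equals c times its image under x -> c x, because this measure also gives every
    half-open interval its length. *)
Lemma ge0_integral_scale (c : R) (f : R -> \bar R) : 0 < c ->
  measurable_fun setT f -> (forall x, 0 <= f x)%E ->
  (\int[mu]_x f x = c%:E * \int[mu]_x f (c * x)%R)%E.
Proof.
move=> c0 mf f0.
pose phi (x : measurableTypeR R) : measurableTypeR R := c * x.
have mphi : measurable_fun setT phi by exact: measurable_mulrl.
pose k : {nonneg R} := NngNum (ltW c0).
pose m0 : {measure set (measurableTypeR R) -> \bar R} := mscale k (pushforward mu phi).
pose m := m0 mphi.
have mE : forall A, measurable A -> mu A = m A.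
  apply: lebesgue_measure_unique => _ [[a b] /= _ <-].
  rewrite /m /m0 /= /mscale /= /pushforward.
  have -> : phi @^-1` `]a, b] = `](a / c), (b / c)]%classic.
    apply/seteqP; split => x /=; rewrite !in_itv /= ltr_pdivrMr // ler_pdivlMr //;
    by rewrite /phi [c * x]mulrC.
  rewrite !lebesgue_measure_itv /= !lte_fin ltr_pM2r ?invr_gt0 //.
  case: ifPn => _; last by rewrite mule0.
  by rewrite -!EFinD -EFinM -mulrBl mulrC divfK ?gt_eqF.
transitivity (\int[m]_x f x)%E.
  apply: eq_measure_integral => A mA _. exact: mE.
rewrite /m /m0 ge0_integral_mscale //=; congr (_ * _)%E.
by rewrite ge0_integral_pushforward.
Qed.

End lebesgue_scaling.

Section density.
Context {R : realType} d {T : measurableType d} (P : probability T R) (X : {RV P >-> R}).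
Local Notation mu := (@lebesgue_measure R).
Variable f : R -> R.
Hypothesis mf : measurable_fun setT f.
Hypothesis Xf : forall A : set R, measurable A ->
  distribution P X A = (\int[mu]_(x in A) (f x)%:E)%E.

(** By hypothesis [f] and the Radon-Nikodym derivative of the law of [X] have the same integral over
    every measurable set, so they agree almost everywhere; the rest is the change of variables for
    that derivative. *)
Lemma ge0_integral_density (g : R -> \bar R) : measurable_fun setT g ->
  (forall x, 0 <= g x)%E ->
  (\int[P]_w g (X w) = \int[mu]_x (g x * (f x)%:E))%E.
Proof.
move=> mg g0.
have mX : measurable_fun setT (X : T -> measurableTypeR R) := measurable_funPT X.
pose X' : {RV P >-> measurableTypeR R} := RV_of P mX.
pose nu : {finite_measure set (measurableTypeR R) -> \bar R} := distribution P X'.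
have numu : nu `<< mu.
  apply/null_content_dominatesP => A mA A0.
  rewrite [LHS](Xf mA); apply: null_set_integral => //.
  exact/measurable_EFinP/measurable_funTS.
rewrite -(ge0_integral_distribution X' mg g0).
rewrite -(Radon_Nikodym_SigmaFinite.change_of_variables numu g0 measurableT mg).
have If : mu.-integrable setT (Radon_Nikodym_SigmaFinite.f nu mu).
  exact: Radon_Nikodym_SigmaFinite.f_integrable.
apply: ae_eq_integral => //.
- by apply: emeasurable_funM => //; exact: (measurable_int mu).
- by apply: emeasurable_funM => //; exact/measurable_EFinP.
- apply: ae_eqe_mul2l; apply: integral_ae_eq => //; first exact/measurable_EFinP.
  move=> A _ mA; rewrite -Radon_Nikodym_SigmaFinite.f_integral //.
  exact: Xf.
Qed.

End density.

Section gamma.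
Context {R : realType}.
Local Notation mu := (@lebesgue_measure R).
Implicit Types (a t x : R).

Lemma Gamma_ge0 a : 0 <= Gamma a.
Proof.
by apply: Rintegral_ge0 => x _; rewrite mulr_ge0 ?expR_ge0 ?powR_ge0.
Qed.

Lemma gamma_pdf_ge0 a x : 0 <= gamma_pdf a x.
Proof.
rewrite /gamma_pdf patchE; case: ifP => // _.
by rewrite divr_ge0 ?Gamma_ge0 // mulr_ge0 ?expR_ge0 ?powR_ge0.
Qed.

Lemma measurable_gamma_pdf a : measurable_fun setT (gamma_pdf a).
Proof.
rewrite /gamma_pdf; apply/(measurable_restrictT _ _).1 => //; apply: measurable_funTS.
apply: measurable_funM => //; apply: measurable_funM; last exact: measurable_powR.
by apply: measurableT_comp => //; exact: measurable_funN.
Qed.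

(** Exponential tilting turns the gamma density into a rescaled copy of itself, so the Laplace
    transform reduces to the total mass. *)
Lemma gamma_pdf_scale a t x : -1 < t ->
  expR (- (t * x)) * gamma_pdf a x = (1 + t) `^ (1 - a) * gamma_pdf a ((1 + t) * x).
Proof.
move=> t1; have c0 : 0 < 1 + t by lra.
rewrite /gamma_pdf !patchE.
have -> : ((1 + t) * x \in `[0, +oo[%classic) = (x \in `[0, +oo[%classic).
  by rewrite !mem_setE !in_itv /= !andbT pmulr_rge0.
case: ifP => [|_]; last by rewrite !mulr0.
rewrite mem_setE in_itv /= andbT => x0.
rewrite (powRM _ (ltW c0) x0) -(opprB a 1) powRN.
rewrite mulrDl mul1r opprD expRD.
have p0 : (1 + t) `^ (a - 1) != 0 by rewrite gt_eqF ?powR_gt0.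
set g := (Gamma a)^-1; set p := (1 + t) `^ (a - 1) in p0 *.
by field.
Qed.

Variables (d : measure_display) (T : measurableType d) (P : probability T R).

Lemma gamma_mgf a (X : {RV P >-> R}) t : gamma_distributed a X -> -1 < t ->
  (\int[P]_w (expR (- (t * X w)))%:E = ((1 + t) `^ (- a))%:E)%E.
Proof.
move=> Xa t1; have c0 : 0 < 1 + t by lra.
have mg := measurable_gamma_pdf a.
have me : measurable_fun setT (fun x : R => (expR (- (t * x)))%:E).
  apply/measurable_EFinP; apply: measurableT_comp => //.
  by apply: measurable_funN; exact: measurable_funM.
rewrite (ge0_integral_density mg Xa me); last by move=> x; rewrite lee_fin expR_ge0.
(* The mass 1 is read off from the law of [X], not from the integral defining [Gamma]. *)
have total : (\int[mu]_x (gamma_pdf a x)%:E = 1)%E.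
  by rewrite -(Xa setT measurableT) -(probability_setT (distribution P X)).
have m2 : measurable_fun setT (fun x => (gamma_pdf a ((1 + t) * x))%:E).
  by apply/measurable_EFinP; apply: measurableT_comp => //; exact: measurable_mulrl.
under eq_integral do rewrite -EFinM gamma_pdf_scale // EFinM.
rewrite ge0_integralZl_EFin ?powR_ge0 //; last by move=> x _; rewrite lee_fin gamma_pdf_ge0.
have mgE : measurable_fun setT (fun x => (gamma_pdf a x)%:E) by exact/measurable_EFinP.
have g0 x : (0 <= (gamma_pdf a x)%:E)%E by rewrite lee_fin gamma_pdf_ge0.
have := ge0_integral_scale c0 mgE g0; rewrite total => I1.
have -> : (1 + t) `^ (1 - a) = (1 + t) `^ (- a) * (1 + t).
  rewrite -[X in _ = _ * X](powRr1 (ltW c0)) -powRD; first by rewrite [- a + 1]addrC.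
  by rewrite (gt_eqF c0) implybT.
by rewrite EFinM -muleA -I1 mule1.
Qed.


End gamma.

Section bounded_convergence.
Context {R : realType} d {T : measurableType d} (P : probability T R).

Lemma bounded_convergence (f_ : nat -> T -> R) (f : T -> R) (C : R) :
  (forall n, measurable_fun setT (f_ n)) -> measurable_fun setT f ->
  {ae P, forall x, f_ n x @[n --> \oo] --> f x} ->
  {ae P, forall x n, `|f_ n x| <= C} ->
  (\int[P]_x f_ n x) @[n --> \oo] --> \int[P]_x f x.
Proof.
move=> mf_ mf ff fC.
have iC : P.-integrable setT (EFin \o cst C).
  by apply: (@Rintegrable_bounded _ _ _ _ _ `|C|).
have [||||fi _ fcvg] := @dominated_convergence _ T R P setT measurableT
  (fun n x => (f_ n x)%:E) (fun x => (f x)%:E) (EFin \o cst C) _ _ _ iC.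
- by move=> n; exact/measurable_EFinP.
- exact/measurable_EFinP.
- by apply: filterS ff => x h _; apply: cvg_EFin => //; exact: nearW.
- by apply: filterS fC => x h n _; rewrite /= lee_fin.
apply: fine_cvg; rewrite fineK //; exact: integrable_fin_num.
Qed.

Lemma markov_ineq (f : T -> R) (c : R) : measurable_fun setT f ->
  (forall x, 0 <= f x) -> 0 <= c ->
  (c%:E * P [set x | c <= f x]%R <= \int[P]_x (f x)%:E)%E.
Proof.
move=> mf f0 c0.
have mA : measurable [set x | c <= f x].
  by rewrite -[X in measurable X]setTI; exact: measurable_fun_ler.
set A := [set x | c <= f x] in mA *.
have h1 : (\int[P]_(x in A) c%:E <= \int[P]_(x in A) (f x)%:E)%E.
  by apply: ge0_le_integral => //=; exact/measurable_EFinP/measurable_funTS.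
have h2 : (\int[P]_(x in A) (f x)%:E <= \int[P]_x (f x)%:E)%E.
  apply: ge0_subset_integral => //; first exact/measurable_EFinP.
  by move=> x _; rewrite lee_fin.
by rewrite integral_cst // in h1; exact: le_trans h1 h2.
Qed.

End bounded_convergence.

(** * Nonnegative variables are determined by their Laplace transform at the integers *)

Section laplace_transform.
Context {R : realType}.
Implicit Types (a t y : R).

Lemma expR_mulN_cvg0 (e : R) : 0 < e -> (k%:R * expR (- (k%:R * e))) @[k --> \oo] --> (0 : R).
Proof.
move=> e0; apply: (@squeeze_cvgr _ _ _ _ (cst 0) (fun k => 2 / e ^+ 2 * k%:R^-1)).
- near=> k; have k0 : 0 < k%:R :> R by rewrite ltr0n; near: k; exact: nbhs_infty_gt.
  apply/andP; split; first by rewrite /= mulr_ge0 ?expR_ge0 // ltW.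
  rewrite expRN ler_pdivrMr ?expR_gt0 //.
  have ke0 : 0 <= k%:R * e by rewrite mulr_ge0 ?ltW.
  have := expR_ge1Dxn 1 ke0; rewrite factE /= => H.
  have {}H : (k%:R * e) ^+ 2 / 2 <= expR (k%:R * e) by apply: le_trans H; rewrite lerDr.
  apply: (@le_trans _ _ (2 / e ^+ 2 / k%:R * ((k%:R * e) ^+ 2 / 2))).
    rewrite le_eqVlt; apply/orP; left; apply/eqP; field.
    by rewrite !gt_eqF.
  by rewrite ler_wpM2l // !mulr_ge0 ?invr_ge0 ?exprn_ge0 // ltW.
- exact: cvg_cst.
- rewrite -[X in _ --> X](mulr0 (2 / e ^+ 2)).
  apply: cvgM; first exact: cvg_cst.
  apply/gtr0_cvgV0; last exact: cvgr_idn.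
  by near=> k; rewrite ltr0n; near: k; exact: nbhs_infty_gt.
Unshelve. all: end_near. Qed.

Lemma bernoulli_ge (z : R) (m : nat) : 0 <= 1 - z -> 0 <= z -> 1 - m%:R * z <= (1 - z) ^+ m.
Proof.
move=> z1 z0; elim: m => [|m IH]; first by rewrite mul0r subr0 expr0.
rewrite exprS; apply: le_trans (ler_wpM2l z1 IH).
by rewrite -natr1; have := ler0n R m; nra.
Qed.

(** The power is close to exp(-k e^(k (y - x))). The additional factor k in the exponent settles the
    case x = y, where the limit has to be 0. *)
Lemma laplace_kernel_cvg y (x : R) : 0 <= y -> 0 <= x ->
  (1 - expR (- (k%:R * x))) ^+ Num.truncn (k%:R * expR (k%:R * y)) @[k --> \oo] --> ((y < x)%R%:R : R).
Proof.
move=> y0 x0; pose z (k : nat) := expR (- (k%:R * x)).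
pose M (k : nat) := Num.truncn (k%:R * expR (k%:R * y)).
have z1 k : 0 <= 1 - z k by rewrite subr_ge0 expR_le1 oppr_le0 mulr_ge0.
have z0 k : 0 < z k by exact: expR_gt0.
have [M1 M2] : (forall k, (M k)%:R <= k%:R * expR (k%:R * y)) /\
    (forall k, k%:R * expR (k%:R * y) <= (M k)%:R + 1 :> R).
  split=> k; first by rewrite truncn_le mulr_ge0 ?expR_ge0.
  by rewrite natr1 ltW // truncnS_gt.
have [yx|xy] := ltP y x; rewrite ?mulr1n ?mulr0n.
- apply: (@squeeze_cvgr _ _ _ _ (fun k : nat => 1 - k%:R * expR (- (k%:R * (x - y)))) (cst 1)).
  + near=> k; apply/andP; split; last first.
      apply: exprn_ile1; first exact: z1.
      by have := z0 k; rewrite /z => ?; lra.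
    apply: (@le_trans _ _ (1 - (M k)%:R * z k)).
      have -> : k%:R * expR (- (k%:R * (x - y))) = k%:R * expR (k%:R * y) * z k.
        by rewrite -mulrA -expRD mulrBr opprB.
      by rewrite lerB // ler_wpM2r // ltW.
    exact: (bernoulli_ge (M k) (z1 k) (ltW (z0 k))).
  + rewrite -[X in _ --> X]subr0; apply: cvgB; first exact: cvg_cst.
    by apply: expR_mulN_cvg0; rewrite subr_gt0.
  + exact: cvg_cst.
(* For x <= y the number of factors times e^(-k x) is at least k - 1, the 1 being the loss from
   truncation. *)
- apply: (@squeeze_cvgr _ _ _ _ (cst 0) (fun k : nat => expR (1 - k%:R))).
  + near=> k; apply/andP; split; first exact: exprn_ge0 (z1 k).
    apply: (@le_trans _ _ (expR (- z k) ^+ M k)).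
      by apply: lerXn2r; [exact: z1|exact: expR_ge0|exact: expR_ge1Dx].
    rewrite -expRM_natl ler_expR.
    have h1 : k%:R <= k%:R * expR (k%:R * y) * z k.
      rewrite -mulrA -expRD ler_peMr // -expR0 ler_expR subr_ge0 ler_wpM2l //.
    have := M2 k; have := z0 k; have := z1 k; nra.
  + exact: cvg_cst.
  + have H : (expR 1 * expR (- k%:R)) @[k --> \oo] --> expR 1 * (0 : R).
      by apply: cvgM; [exact: cvg_cst|exact: cvgn_expR].
    by rewrite mulr0 in H; under eq_fun do rewrite expRD.
Unshelve. all: end_near. Qed.

End laplace_transform.

Section almost_everywhere.
Context {R : realType} d {T : measurableType d} (P : probability T R).

Lemma ae_probability1 (A : set T) : measurable A -> {ae P, forall w, A w} -> P A = 1%E.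
Proof.
move=> mA hA; have mC := measurableC mA.
have C0 : P (~` A) = 0%E by apply/negligibleP.
by have := probability_setC P mC; rewrite setCK C0 sube0.
Qed.

End almost_everywhere.

Section laplace_uniqueness.
Context {R : realType}.

(* The transform at the integers p suffices: polynomials in expR (- X) converge to the indicator
   of y < X, see laplace_kernel_cvg. *)
Definition laplace_moments d (T : measurableType d) (P : probability T R)
    (X : T -> R) (r : nat -> R) :=
  forall p : nat, (\int[P]_w (expR (- (p%:R * X w)))%:E = (r p)%:E)%E.

Section one_law.
Context d {T : measurableType d} (P : probability T R) (X : T -> R) (r : nat -> R).
Hypotheses (mX : measurable_fun setT X) (X0 : {ae P, forall w, 0 <= X w}).
Hypothesis Xr : laplace_moments P X r.

Let kernel (y : R) (k : nat) (x : R) : R :=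
  (1 - expR (- (k%:R * x))) ^+ Num.truncn (k%:R * expR (k%:R * y)).

(** The binomial expansion of [kernel] integrated term by term: the powers of e^(-k X) are e^(-k i
    X), so [r] is evaluated at integers only. *)
Let coef (y : R) (k : nat) : R := let m := Num.truncn (k%:R * expR (k%:R * y)) in
  \sum_(i < m.+1) ('C(m, i)%:R * (-1) ^+ i) * r (k * i)%N.

Lemma measurable_expR_mul (c : R) : measurable_fun setT (fun w => expR (- (c * X w))).
Proof.
by apply: measurableT_comp => //; apply: measurable_funN; exact: measurable_funM.
Qed.

Let integrable_exp (p : nat) : P.-integrable setT (fun w => (expR (- (p%:R * X w)))%:E).
Proof.
apply/integrableP; split; first by apply/measurable_EFinP; exact: measurable_expR_mul.
under eq_integral do rewrite /= ger0_norm ?expR_ge0 //.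
by rewrite Xr ltry.
Qed.

Let Rintegral_exp (p : nat) : \int[P]_w expR (- (p%:R * X w)) = r p.
Proof. by rewrite /Rintegral Xr. Qed.

Let Rintegral_kernel y k : \int[P]_w kernel y k (X w) = coef y k.
Proof.
rewrite /kernel /coef; set m := Num.truncn _.
pose c (i : nat) : R := 'C(m, i)%:R * (-1) ^+ i.
pose F (i : nat) w := c i * expR (- ((k * i)%N%:R * X w)).
have FE w : (1 - expR (- (k%:R * X w))) ^+ m = \sum_(i < m.+1) F i w.
  rewrite exprDn; apply: eq_bigr => i _; rewrite /F /c expr1n mul1r.
  rewrite -mulr_natl [in LHS]exprNn mulrA; congr (_ * _).
  by rewrite natrM -mulrA mulrCA -[in RHS]mulrN [RHS]expRM_natl.
under eq_Rintegral do rewrite FE.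
have intF i : P.-integrable setT (EFin \o F i).
  by rewrite /F; have := integrableZl measurableT (c i) (integrable_exp (k * i)).
elim: m.+1 {FE} => [|n IH].
  by under eq_Rintegral do rewrite big_ord0; rewrite big_ord0 Rintegral_cst // mul0r.
under eq_Rintegral do rewrite big_ord_recr /=.
rewrite big_ord_recr /= -IH RintegralD //.
- by congr (_ + _); rewrite /F (@RintegralZl _ _ _ P setT (fun w => expR (- ((k * n)%N%:R * X w))) (c n) measurableT (integrable_exp _)) Rintegral_exp.
- have -> : EFin \o (fun w => \sum_(i < n) F i w) = (fun w => \sum_(i < n) (F i w)%:E)%E.
    by apply/funext => w; rewrite /= sumEFin.
  apply: integrable_sum => // i _; exact: intF.
Qed.

Let mem_tail y w : (w \in X @^-1` `]y, +oo[) = (y < X w).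
Proof.
apply/idP/idP => [/set_mem|h]; first by rewrite /= in_itv /= andbT.
by apply/mem_set; rewrite /= in_itv /= andbT.
Qed.

Lemma coef_cvg y : 0 <= y -> coef y k @[k --> \oo] --> fine (P (X @^-1` `]y, +oo[)).
Proof.
move=> y0; have mA : measurable (X @^-1` `]y, +oo[).
  by rewrite -[X in measurable X]setTI; exact: mX.
have -> : fine (P (X @^-1` `]y, +oo[)) = \int[P]_w ((y < X w)%R%:R).
  rewrite /Rintegral (_ : (fun w => _) = fun w => (\1_(X @^-1` `]y, +oo[) w)%:E) ?integral_indic ?setIT //.
  apply/funext => w; rewrite indicE; congr (_%:R%:E).
  by rewrite mem_tail.
under eq_fun do rewrite -Rintegral_kernel.
have mk k : measurable_fun setT (fun w => kernel y k (X w)).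
  apply: measurable_funX; apply: measurable_funB => //; exact: measurable_expR_mul.
apply: (@bounded_convergence _ _ _ _ _ _ 1) => //.
- rewrite (_ : (fun w => _) = (\1_(X @^-1` `]y, +oo[) : T -> R)); first exact: measurable_indic.
  apply/funext => w; rewrite indicE; congr (_%:R).
  by rewrite mem_tail.
- by apply: filterS X0 => w Xw; exact: laplace_kernel_cvg.
- apply: filterS X0 => w Xw k; rewrite /kernel.
  have z0 := expR_gt0 (- (k%:R * X w)).
  have z1 : expR (- (k%:R * X w)) <= 1 by rewrite expR_le1 oppr_le0 mulr_ge0.
  by rewrite ger0_norm ?exprn_ge0 ?exprn_ile1 ?subr_ge0 // lerBlDr lerDl ltW.
Qed.

Lemma tail_neg y : y < 0 -> P (X @^-1` `]y, +oo[) = 1%E.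
Proof.
move=> y0; have mA : measurable (X @^-1` `]y, +oo[).
  by rewrite -[X in measurable X]setTI; exact: mX.
apply: ae_probability1 => //; apply: filterS X0 => w Xw /=.
by rewrite in_itv /= andbT (lt_le_trans y0).
Qed.

End one_law.


(** For y >= 0 the tail P(X > y) is the limit of [coef y k], which involves [r] only; for y < 0 it
    is 1. The rays ]y, +oo[ are stable under intersection and generate the Borel sets. *)
Lemma laplace_unique d1 (T1 : measurableType d1) (P1 : probability T1 R)
    d2 (T2 : measurableType d2) (P2 : probability T2 R)
    (X1 : T1 -> R) (X2 : T2 -> R) (r : nat -> R) :
  measurable_fun setT X1 -> measurable_fun setT X2 ->
  {ae P1, forall w, 0 <= X1 w} -> {ae P2, forall w, 0 <= X2 w} ->
  laplace_moments P1 X1 r -> laplace_moments P2 X2 r ->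
  forall A : set R, measurable A -> P1 (X1 @^-1` A) = P2 (X2 @^-1` A).
Proof.
move=> m1 m2 X10 X20 r1 r2 A mA.
pose Y1 : {RV P1 >-> R} := RV_of P1 m1; pose Y2 : {RV P2 >-> R} := RV_of P2 m2.
have tails y : P1 (X1 @^-1` `]y, +oo[) = P2 (X2 @^-1` `]y, +oo[).
  have [y0|y0] := leP 0 y; last by rewrite !tail_neg.
  have mS1 : measurable (X1 @^-1` `]y, +oo[) by rewrite -[X in measurable X]setTI; exact: (m1).
  have mS2 : measurable (X2 @^-1` `]y, +oo[) by rewrite -[X in measurable X]setTI; exact: (m2).
  have := cvg_lim (@Rhausdorff R) (coef_cvg m1 X10 r1 y0).
  rewrite (cvg_lim (@Rhausdorff R) (coef_cvg m2 X20 r2 y0)) => fE.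
  rewrite -(fineK (fin_num_measure P1 _ mS1)) -(fineK (fin_num_measure P2 _ mS2)).
  by rewrite fE.
apply: (@measure_unique _ R R (@measurable_realfun.RGenOInfty.G R)
  (fun n => `](- n%:R), +oo[%classic) _ _ _ _ (distribution P1 Y1) (distribution P2 Y2)) => //.
- exact: measurable_realfun.RGenOInfty.measurableE.
- move=> _ _ [x ->] [y ->]; exists (Num.max x y).
  by apply/seteqP; split => z /=; rewrite !in_itv /= !andbT gt_max => /andP.
- by move=> n; exists (- n%:R).
- apply/seteqP; split => // z _; exists (Num.truncn `|z|).+1 => //=.
  rewrite in_itv /= andbT ltrNl; apply: le_lt_trans (ler_norm _) _.
  by rewrite normrN truncnS_gt.
- by move=> _ [x ->]; exact: tails.
- by move=> n; apply: le_lt_trans (probability_le1 _ _) (ltry _).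
Qed.

End laplace_uniqueness.

(** * Exponential concentration of gamma variables *)

Section concentration.
Context {R : realType}.

(* Gamma laws are handled through their Laplace transform; this includes the constant 0 for a = 0. *)
Definition gamma_law d (T : measurableType d) (P : probability T R) (a : R) (X : T -> R) :=
  measurable_fun setT X /\
  forall t, -1 < t -> (\int[P]_w (expR (- (t * X w)))%:E = ((1 + t) `^ (- a))%:E)%E.

Lemma gamma_law_moments d (T : measurableType d) (P : probability T R) a (X : T -> R) :
  gamma_law P a X -> laplace_moments P X (fun p => (1 + p%:R) `^ (- a)).
Proof. by move=> [_ h] p; apply: h; apply: lt_le_trans (ler0n _ p); rewrite ltrN10. Qed.

(** By exp(x) >= 1 + x it suffices that (1 - t) (1 + t (1 + rho)) > 1 and (1 + t) (1 - t (1 - rho))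
    > 1. For t = rho / 2 the margins are rho^2 (1 - rho) / 4 and rho^2 (1 + rho) / 4. *)
Lemma chernoff_rate (rho t : R) : 0 < rho < 1 -> t = rho / 2 ->
  expR (- (t * (1 + rho))) / (1 - t) < 1 /\ expR (t * (1 - rho)) / (1 + t) < 1.
Proof.
move=> /andP[r0 r1] tE; have t0 : 0 < t by rewrite tE divr_gt0.
have t1 : t < 1 by lra.
split.
- rewrite ltr_pdivrMr ?subr_gt0 // mul1r expRN -[X in _ < X]invrK ltf_pV2 ?posrE ?expR_gt0 ?invr_gt0 ?subr_gt0 //.
  apply: lt_le_trans (expR_ge1Dx _).
  have h : 0 < rho * rho * (1 - rho) by rewrite !mulr_gt0 ?subr_gt0.
  rewrite -[X in X < _]mul1r ltr_pdivrMr ?subr_gt0 // tE; lra.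
- rewrite ltr_pdivrMr ?addr_gt0 // mul1r -[t * _]opprK expRN -[X in _ < X]invrK ltf_pV2 ?posrE ?expR_gt0 ?invr_gt0 ?addr_gt0 //.
  apply: lt_le_trans (expR_ge1Dx _).
  have h : 0 < rho * rho * (1 + rho) by rewrite !mulr_gt0 ?addr_gt0.
  rewrite -[X in X < _]mul1r ltr_pdivrMr ?addr_gt0 // tE; lra.
Qed.

(** The rate [q] depends on rho alone, which makes the bound uniform over the variables and
    geometric in the parameter. The factor 2 counts the two tails, bounded through the transform at
    -rho/2 and rho/2. *)
Lemma chernoff (rho : R) : 0 < rho < 1 -> exists2 q : R, 0 < q < 1 &
  forall d (T : measurableType d) (P : probability T R) (a : R) (X : T -> R),
    0 < a -> gamma_law P a X ->
    (P [set w | rho <= `|X w / a - 1|]%R <= (2 * q `^ a)%:E)%E.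
Proof.
move=> rho01; have /andP[r0 r1] := rho01.
have [q1 q2] := chernoff_rate rho01 erefl.
set t := rho / 2 in q1 q2.
have t0 : 0 < t by rewrite divr_gt0. have t1 : t < 1 by rewrite /t; lra.
set p1 := expR _ / _ in q1; set p2 := expR _ / _ in q2.
have p10 : 0 < p1 by rewrite divr_gt0 ?expR_gt0 ?subr_gt0.
have p20 : 0 < p2 by rewrite divr_gt0 ?expR_gt0 ?addr_gt0.
exists (Num.max p1 p2); first by rewrite lt_max p10 gt_max q1 q2.
move=> d T P a X a0 [mX Xl].
have bound (s c : R) : -1 < s -> (P [set w | expR c <= expR (- (s * X w))]%R <=
    (expR (- c) * (1 + s) `^ (- a))%:E)%E.
  move=> s1; have mf : measurable_fun setT (fun w => expR (- (s * X w))).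
    by apply: measurableT_comp => //; apply: measurable_funN; exact: measurable_funM.
  have := markov_ineq P mf (fun w => expR_ge0 _) (expR_ge0 c); rewrite Xl // => H.
  rewrite EFinM expRN lee_pdivlMl ?expR_gt0 //.
have mX1 c : measurable [set w | c <= X w].
  by rewrite -[X in measurable X]setTI; apply: measurable_fun_ler.
have mX2 c : measurable [set w | X w <= c].
  by rewrite -[X in measurable X]setTI; apply: measurable_fun_ler.
apply: (@le_trans _ _ (P ([set w | (1 + rho) * a <= X w]%R `|` [set w | X w <= (1 - rho) * a]%R))).
  apply: le_measure; rewrite ?inE.
  - rewrite -[X in measurable X]setTI; apply: measurable_fun_ler => //.
    by apply: measurableT_comp => //; apply: measurable_funB => //; exact: measurable_funM.
  - exact: measurableU.
  - move=> w /=; rewrite ler_normr => /orP[h|h]; [left|right].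
      by rewrite -ler_pdivlMr //; lra.
    by rewrite -ler_pdivrMr //; lra.
apply: le_trans (measureU2 _ _ _) _ => //.
rewrite mulr_natl mulr2n EFinD; apply: leeD.
- have := bound (- t) (t * ((1 + rho) * a)); rewrite ltrN2 => /(_ t1).
  have -> : [set w | expR (t * ((1 + rho) * a)) <= expR (- (- t * X w))] = [set w | (1 + rho) * a <= X w].
    by apply/seteqP; split => w /=; rewrite ler_expR mulNr opprK ler_pM2l.
  move=> H; apply: le_trans H _; rewrite lee_fin.
  have -> : expR (- (t * ((1 + rho) * a))) * (1 - t) `^ (- a) = p1 `^ a.
    rewrite /p1 powRM ?expR_ge0 ?invr_ge0 ?subr_ge0 ?(ltW t1) // -powR_inv1 ?subr_ge0 ?(ltW t1) //.
    by rewrite -powRrM mulN1r -expRM mulNr mulrA.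
  by apply: ge0_ler_powR; rewrite ?nnegrE ?le_max ?lexx ?(ltW a0) ?(ltW p10) ?orbT.
- have := bound t (- (t * ((1 - rho) * a))); have tN1 : -1 < t by lra.
  move=> /(_ tN1).
  have -> : [set w | expR (- (t * ((1 - rho) * a))) <= expR (- (t * X w))] = [set w | X w <= (1 - rho) * a].
    by apply/seteqP; split => w /=; rewrite ler_expR lerN2 ler_pM2l.
  move=> H; apply: le_trans H _; rewrite lee_fin opprK.
  have -> : expR (t * ((1 - rho) * a)) * (1 + t) `^ (- a) = p2 `^ a.
    have t1' : 0 <= 1 + t by rewrite addr_ge0 // ltW.
    rewrite /p2 powRM ?expR_ge0 ?invr_ge0 // -powR_inv1 //.
    by rewrite -powRrM mulN1r -expRM mulrA.
  by apply: ge0_ler_powR; rewrite ?nnegrE ?le_max ?lexx ?(ltW a0) ?(ltW p20) ?orbT.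
Qed.

End concentration.

(** * Independence *)

Section tuple_laws.
Context {R : realType} d {T : measurableType d} {N : nat}.

Definition rect (A : 'I_N -> set T) : set (N.-tuple T) := [set t | forall i, A i (tnth t i)].

Lemma measurable_rect (A : 'I_N -> set T) : (forall i, measurable (A i)) -> measurable (rect A).
Proof.
move=> mA; rewrite (_ : rect A = \bigcap_(i in [set: 'I_N]) ((@tnth N T)^~ i @^-1` A i)).
  apply: fin_bigcap_measurable; first exact: finite_finset.
  by move=> i _; rewrite -[X in measurable X]setTI; exact: measurable_tnth.
by apply/seteqP; split => t /= h i; [move=> _|]; apply: h.
Qed.

Lemma tuple_measure_unique (m1 m2 : probability (N.-tuple T) R) :
  (forall A : 'I_N -> set T, (forall i, measurable (A i)) -> m1 (rect A) = m2 (rect A)) ->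
  forall E, measurable E -> m1 E = m2 E.
Proof.
move=> m12 E mE.
pose G : set (set (N.-tuple T)) := [set rect A | A in [set A | forall i, measurable (A i)]].
apply: (@g_sigma_algebra_measure_unique _ R _ G _ (fun=> setT) _ _ m1 m2).
- by move=> _ [A mA <-]; exact: measurable_rect.
- by move=> _; exists (fun=> setT) => //; apply/seteqP; split.
- by apply/seteqP; split => // t _; exists 0%N.
- move=> _ _ [A mA <-] [B mB <-]; exists (fun i => A i `&` B i).
    by move=> i; exact: measurableI.
  apply/seteqP; split => t /=; first by move=> h; split => i; case: (h i).
  by move=> [h1 h2] i; split; [exact: h1|exact: h2].
- by move=> _ [A mA <-]; exact: m12.
- by move=> k; apply: le_lt_trans (probability_le1 _ _) (ltry _).
- move: E mE; apply: smallest_sub; first exact: smallest_sigma_algebra.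
  (* A generator of the product sigma-algebra constrains one coordinate, so it is a rectangle whose
     other sides are full. *)
  apply: (big_ind (fun S : set (set (N.-tuple T)) => S `<=` <<s G >>)) => //.
    by move=> S1 S2 h1 h2 E [/h1|/h2].
  move=> i _ _ [B mB <-]; apply: sub_sigma_algebra; exists (fun j => if j == i then B else setT).
    by move=> j; case: ifP.
  rewrite setTI; apply/seteqP; split => t /=.
    by move=> /(_ i); rewrite eqxx.
  by move=> h j; case: ifPn => // /eqP ->.
Qed.

End tuple_laws.

Section independence.
Context {R : realType} d {Om : measurableType d} (P : probability Om R).
Context d' {T : measurableType d'} {N : nat} (X : 'I_N -> Om -> T).

(** The product formula for the full family contains those for subfamilies: take [A i = setT]
    elsewhere. *)
Definition independent_tuple := forall A : 'I_N -> set T, (forall i, measurable (A i)) ->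
  P [set w | forall i, A i (X i w)] = (\prod_(i < N) P (X i @^-1` A i))%E.

Hypothesis mX : forall i, measurable_fun setT (X i).
Hypothesis iX : independent_tuple.

Definition tuple_of w : N.-tuple T := [tuple X i w | i < N].

(** Under independence, reading coordinate l at a second independent point does not change the law
    of the tuple. Integrating over [w'] then plays the role of the conditional expectation given the
    other coordinates. *)
Definition resample (l : 'I_N) (w w' : Om) : N.-tuple T :=
  [tuple X i (if i == l then w' else w) | i < N].

Lemma measurable_tuple_of : measurable_fun setT tuple_of.
Proof.
apply/measurable_fun_tnthP => i; rewrite (_ : _ \o _ = X i) //.
by apply/funext => w; rewrite /= tnth_mktuple.
Qed.

Lemma measurable_resample l : measurable_fun setT (fun ww : Om * Om => resample l ww.1 ww.2).
Proof.
apply/measurable_fun_tnthP => i.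
rewrite (_ : _ \o _ = fun ww : Om * Om => X i (if i == l then ww.2 else ww.1)).
  by case: (i == l); apply: (measurableT_comp (mX i)).
by apply/funext => w; rewrite /= tnth_mktuple.
Qed.

Lemma measurable_resample2 l w : measurable_fun setT (resample l w).
Proof.
apply/measurable_fun_tnthP => i.
rewrite (_ : _ \o _ = fun w' => X i (if i == l then w' else w)).
  by case: (i == l); [exact: mX|exact: measurable_cst].
by apply/funext => w'; rewrite /= tnth_mktuple.
Qed.

Lemma resample_law l (E : set (N.-tuple T)) : measurable E ->
  P (tuple_of @^-1` E) = (P \x P)%E ((fun ww : Om * Om => resample l ww.1 ww.2) @^-1` E).
Proof.
move=> mE.
pose Y1 : {RV P >-> N.-tuple T} := RV_of P measurable_tuple_of.
pose PP : probability (Om * Om)%type R := (P \x P)%E.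
pose Y2 : {RV PP >-> N.-tuple T} := RV_of PP (measurable_resample l).
apply: (@tuple_measure_unique _ _ _ _ (distribution P Y1) (distribution PP Y2)) => // A mA.
have mXA i : measurable (X i @^-1` A i) by rewrite -[Z in measurable Z]setTI; exact: mX.
pose A' i := if i == l then setT else A i.
have mA' i : measurable (A' i) by rewrite /A'; case: ifP.
pose S1 := [set w | forall i, A' i (X i w)].
pose S2 := X l @^-1` A l.
have mS1 : measurable S1.
  rewrite (_ : S1 = tuple_of @^-1` rect A').
    by rewrite -[Z in measurable Z]setTI; apply: measurable_tuple_of => //; exact: measurable_rect.
  by apply/seteqP; split => w /= h i; have := h i; rewrite tnth_mktuple.
have mS2 : measurable S2 by exact: mXA.
have E1 : Y1 @^-1` rect A = [set w | forall i, A i (X i w)].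
  by apply/seteqP; split => w /= h i; have := h i; rewrite tnth_mktuple.
have E2 : Y2 @^-1` rect A = S1 `*` S2.
  apply/seteqP; split => -[w w'] /=.
    move=> h; split=> [i|]; last by have := h l; rewrite tnth_mktuple eqxx.
    by have := h i; rewrite tnth_mktuple /A'; case: ifP.
  move=> [h1 h2] i; rewrite tnth_mktuple; have := h1 i; rewrite /A'.
  by case: ifP => [/eqP -> _|].
transitivity (P [set w | forall i, A i (X i w)]); first by rewrite -E1.
transitivity ((P \x P)%E (S1 `*` S2)); last by rewrite -E2.
rewrite product_measure1E //.
rewrite [Z in _ = (Z * _)%E](iX mA' : _ = _) iX // (bigD1 l) //= [in RHS](bigD1 l) //= /A' eqxx preimage_setT.
rewrite [P setT](probability_setT P) mul1e muleC; congr (_ * _)%E.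
by apply: eq_bigr => i il; rewrite (negbTE il).
Qed.

Lemma ge0_integral_resample l (F : N.-tuple T -> \bar R) : measurable_fun setT F ->
  (forall t, 0 <= F t)%E ->
  (\int[P]_w F (tuple_of w) = \int[P]_w \int[P]_w' F (resample l w w'))%E.
Proof.
move=> mF F0.
pose Y1 : {RV P >-> N.-tuple T} := RV_of P measurable_tuple_of.
pose PP : probability (Om * Om)%type R := (P \x P)%E.
pose Y2 : {RV PP >-> N.-tuple T} := RV_of PP (measurable_resample l).
transitivity (\int[distribution P Y1]_t F t)%E; first by rewrite ge0_integral_distribution.
transitivity (\int[distribution PP Y2]_t F t)%E.
  by apply: eq_measure_integral => E mE _; exact: resample_law.
rewrite ge0_integral_distribution // fubini_tonelli1 //; last by move=> ww; exact: F0.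
by apply: measurableT_comp => //; exact: measurable_resample.
Qed.

(* Each factor has constant conditional expectation given the past. *)
Lemma sequential_product (Phi : 'I_N -> N.-tuple T -> \bar R) (c : 'I_N -> \bar R) :
  (forall i, measurable_fun setT (Phi i)) -> (forall i t, 0 <= Phi i t)%E ->
  (forall (i : 'I_N) t t', (forall j : 'I_N, (j <= i)%N -> tnth t j = tnth t' j) -> Phi i t = Phi i t') ->
  (forall i, 0 <= c i)%E ->
  (forall i, {ae P, forall w, \int[P]_w' Phi i (resample i w w') = c i}%E) ->
  (\int[P]_w \prod_(i < N) Phi i (tuple_of w) = \prod_(i < N) c i)%E.
Proof.
move=> mPhi Phi0 Phi_past c0 Phic.
suff H (m : nat) : (m <= N)%N -> (\int[P]_w \prod_(i < N | (i < m)%N) Phi i (tuple_of w) =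
    \prod_(i < N | (i < m)%N) c i)%E.
  have := H N (leqnn N); under eq_bigl do rewrite ltn_ord.
  by under eq_integral do under eq_bigl do rewrite ltn_ord.
have prod_ge0 (Q : pred 'I_N) t : (0 <= \prod_(i < N | Q i) Phi i t)%E.
  by apply: (big_ind (fun x => 0 <= x)%E) => // *; exact: mule_ge0.
have mprod (Q : pred 'I_N) : measurable_fun setT (fun t => \prod_(i < N | Q i) Phi i t)%E.
  rewrite /index_enum; elim: (Finite.enum _) => [|i s IH].
    by under eq_fun do rewrite big_nil; exact: measurable_cst.
  under eq_fun do rewrite big_cons; case: (Q i) => //.
  exact: emeasurable_funM.
elim: m => [_|m IH mN].
  rewrite big1 //; under eq_integral do rewrite big1 //.
  by rewrite integral_cst // mul1e [LHS](probability_setT P : _ = 1%E).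
pose l := Ordinal mN.
have split_prod (f : 'I_N -> \bar R) : (\prod_(i < N | (i < m.+1)%N) f i =
    f l * \prod_(i < N | (i < m)%N) f i)%E.
  rewrite (bigD1 l) //=; congr (_ * _)%E; apply: eq_bigl => i.
  by rewrite ltnS [in RHS]ltn_neqAle andbC.
rewrite split_prod -(IH (ltnW mN)).
under eq_integral do rewrite split_prod.
rewrite (ge0_integral_resample l (F := fun t => Phi l t * \prod_(i < N | (i < m)%N) Phi i t)%E); last first.
- by move=> t; exact: mule_ge0.
- exact: emeasurable_funM.
(* The earlier factors do not see coordinate l and come out of the inner integral. *)
have past w w' : (\prod_(i < N | (i < m)%N) Phi i (resample l w w') =
    \prod_(i < N | (i < m)%N) Phi i (tuple_of w))%E.
  apply: eq_bigr => i im; apply: Phi_past => j ji; rewrite !tnth_mktuple.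
  by rewrite ifN //; apply: contraTneq (leq_ltn_trans ji im) => ->; rewrite ltnn.
under eq_integral => w _.
  under eq_integral do rewrite past.
  rewrite ge0_integralZr //; last by apply: measurableT_comp => //; exact: measurable_resample2.
  over.
rewrite -ge0_integralZl //; last exact: (measurableT_comp (mprod _) measurable_tuple_of).
set Pi := fun t => (\prod_(i < N | (i < m)%N) Phi i t)%E.
have mPi : measurable_fun setT (fun w => Pi (tuple_of w)).
  exact: (measurableT_comp (mprod _) measurable_tuple_of).
have mI : measurable_fun setT (fun w => \int[P]_w' Phi l (resample l w w'))%E.
  apply: (@measurable_fun_fubini_tonelli_F _ _ _ _ _ P (fun ww => Phi l (resample l ww.1 ww.2))) => //.
  by apply: measurableT_comp => //; exact: measurable_resample.
apply: ge0_ae_eq_integral => //.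
- exact: emeasurable_funM.
- exact: measurable_funeM.
- by move=> w _; apply: mule_ge0 => //; apply: integral_ge0.
- by move=> w _; exact: mule_ge0.
- by apply: filterS (Phic l) => w -> _.
Qed.

End independence.

Section independent_subfamily.
Context {R : realType} d {Om : measurableType d} (P : probability Om R).
Context d' {T : measurableType d'} {I : choiceType} (D : pred I) (X : I -> {RV P >-> T}).
Hypothesis iX : independent_RVs [set i | D i] X.
Context {N : nat} (f : 'I_N -> I).
Hypothesis f_inj : injective f.
Variable z : T.

(** Indices outside [D], where nothing is known about [X], give a constant, which is independent of
    everything. This covers the index 0 of [eta]. *)
Definition subfamily (i : 'I_N) (w : Om) : T := if D (f i) then X (f i) w else z.

Lemma independent_subfamily : independent_tuple P subfamily.
Proof.
move=> A mA.
pose s : seq I := [seq f i | i <- enum 'I_N & D (f i)].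
have us : uniq s by rewrite map_inj_uniq // filter_uniq // enum_uniq.
pose J : {fset I} := seq_fset tt s.
have Js : perm_eq J s by rewrite -[X in perm_eq _ X](undup_id us) seq_fset_perm.
pose E (y : I) : set T := if [pick i | f i == y] is Some i then A i else setT.
have Ef i : E (f i) = A i.
  rewrite /E; case: pickP => [j /eqP /f_inj -> //|/(_ i)]; by rewrite eqxx.
have mE y : measurable (E y) by rewrite /E; case: pickP.
have JD : [set` J] `<=` [set i | D i].
  move=> y /=; rewrite (perm_mem Js) => /mapP[i].
  by rewrite mem_filter => /andP[Di _] ->.
have := iX JD mE; rewrite (perm_big _ Js) /= big_map big_filter big_enum_cond /= => PJ.
(* If a constant coordinate violates its event, both sides are 0; otherwise the constant coordinates
   contribute factors 1. *)
have [[i /andP[nDi /negP zA]]|H] := pselect (exists i, ~~ D (f i) && ~~ `[< A i z >]).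
  rewrite (bigD1 i) //=.
  have -> : subfamily i @^-1` A i = set0.
    apply/seteqP; split => // w; rewrite /= /subfamily (negbTE nDi) => Az.
    by apply: zA; apply/asboolP.
  rewrite measure0 mul0e (_ : [set w | _] = set0) ?measure0 //.
  apply/seteqP; split => // w /= /(_ i); rewrite /subfamily (negbTE nDi) => Az.
  by apply: zA; apply/asboolP.
have {}H i : ~~ D (f i) -> A i z.
  move=> nDi; apply: contrapT => nA; apply: H; exists i; rewrite nDi /=.
  by apply/negP => /asboolP.
transitivity (P (\bigcap_(i in [set` J]) (X i @^-1` E i))).
  congr (P _); apply/seteqP; split => w /= h.
    move=> y /=; rewrite (perm_mem Js) => /mapP[i]; rewrite mem_filter => /andP[Di _] ->.
    by have := h i; rewrite /subfamily Di Ef.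
  move=> i; rewrite /subfamily; case: ifPn => [Di|/H //].
  have := h (f i); rewrite /= Ef; apply; rewrite (perm_mem Js).
  by apply: map_f; rewrite mem_filter Di mem_enum.
rewrite PJ [RHS](bigID (fun i => D (f i))) /= [X in (_ * X)%E]big1 ?mule1.
  by apply: eq_bigr => i Di; rewrite /subfamily Di Ef.
move=> i nDi; rewrite -[RHS](probability_setT P); congr (P _).
by apply/seteqP; split => // w _ /=; rewrite /subfamily (negbTE nDi); exact: H.
Qed.

End independent_subfamily.

(** * Independent gamma variables of parameter n/2 from two copies of the family *)

Section gamma_family.
Context {R : realType} d {T : measurableType d} (P : probability T R) (eta : nat -> {RV P >-> R}).
Hypothesis ieta : independent_RVs [set i | (1 <= i)%N] eta.
Hypothesis geta : forall i, (1 <= i)%N -> gamma_distributed (i%:R / 2) (eta i).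

Lemma gamma_law_eta i : (1 <= i)%N -> gamma_law P (i%:R / 2) (eta i).
Proof. by move=> i1; split=> [//|t t1]; apply: gamma_mgf => //; exact: geta. Qed.

Lemma eta_neq (i : nat) (r : R) : (1 <= i)%N -> P (eta i @^-1` [set r]) = 0%E.
Proof.
move=> i1; have := geta i1 (measurable_set1 r); rewrite /distribution /pushforward => ->.
by rewrite integral_set1.
Qed.

Context (n : nat).

Let P2 : probability (T * T)%type R := (P \x P)%E.

(* eta_{i+1} and an independent copy of eta_{n-i-1} add up to a gamma variable of parameter n/2;
   the last index contributes 0. *)
Definition gamma_shift (i : 'I_n) (w : T) : R :=
  if (1 <= n - i.+1)%N then eta (n - i.+1)%N w else 0.

Definition gamma_sum (i : 'I_n) (w : T * T) : R := gamma_shift i w.1 + eta i.+1 w.2.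

Lemma measurable_gamma_shift i : measurable_fun setT (gamma_shift i).
Proof. by rewrite /gamma_shift; case: (0 < n - i.+1)%N => //; exact: measurable_cst. Qed.

Lemma measurable_gamma_sum i : measurable_fun setT (gamma_sum i).
Proof.
apply: measurable_funD; first exact: (measurableT_comp (measurable_gamma_shift i)).
exact: (measurableT_comp (measurable_funPT (eta i.+1))).
Qed.

Lemma gamma_law_shift (i : 'I_n) : gamma_law P ((n - i.+1)%N%:R / 2) (gamma_shift i).
Proof.
rewrite /gamma_shift; case: (ltnP 0 (n - i.+1)) => [h|]; first exact: gamma_law_eta.
rewrite leqn0 => /eqP ->; split=> [|t _]; first exact: measurable_cst.
under eq_integral do rewrite mulr0 oppr0 expR0.
by rewrite integral_cst // mul1e mul0r oppr0 powRr0 [LHS](probability_setT P : _ = 1%E).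
Qed.

Lemma gamma_law_sum i : gamma_law P2 (n%:R / 2) (gamma_sum i).
Proof.
split=> [|t t1]; first exact: measurable_gamma_sum.
have [mS lS] := gamma_law_shift i.
have [mE lE] := gamma_law_eta (ltn0Sn i).
have mexp (f : T -> R) : measurable_fun setT f ->
    measurable_fun setT (fun w => (expR (- (t * f w)))%:E).
  move=> mf; apply/measurable_EFinP; apply: measurableT_comp => //.
  by apply: measurable_funN; exact: measurable_funM.
have meS := mexp _ mS; have meE := mexp _ mE.
rewrite fubini_tonelli1 /=; last first.
- by move=> w; rewrite lee_fin expR_ge0.
- apply/measurable_EFinP; apply: measurableT_comp => //; apply: measurable_funN.
  by apply: measurable_funM => //; exact: measurable_gamma_sum.
under eq_integral => w _.
  rewrite /fubini_F /gamma_sum /=.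
  under eq_integral do rewrite mulrDr opprD expRD EFinM.
  rewrite ge0_integralZl_EFin ?expR_ge0 //.
  rewrite lE //.
  over.
rewrite ge0_integralZr ?lee_fin ?powR_ge0 //.
rewrite lS // -EFinM -powRD; last by rewrite (_ : 1 + t != 0) ?implybT // gt_eqF; lra.
congr (_ `^ _)%:E; rewrite -opprD -mulrDl -natrD subnK //; exact: ltn_ord.
Qed.

(** For a fixed first point, independence of the eta_{i+1} in the second point gives a product of
    functions of the single shifts; then independence of the shifts factors the integral over the
    first point. *)
Lemma independent_gamma_sum : independent_tuple P2 gamma_sum.
Proof.
move=> A mA.
have iE : independent_tuple P (subfamily (fun i => (1 <= i)%N) eta (fun i : 'I_n => i.+1) 0).
  by apply: independent_subfamily => // i j /succn_inj /ord_inj.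
have iS : independent_tuple P gamma_shift.
  apply: (@independent_subfamily _ _ _ _ _ _ _ (fun i => (1 <= i)%N) eta ieta n (fun i : 'I_n => (n - i.+1)%N)).
  move=> i j /= ij; apply: ord_inj; apply: succn_inj.
  by rewrite -(subKn (ltn_ord i)) ij (subKn (ltn_ord j)).
pose U (i : 'I_n) (c : R) := P [set w | A i (c + eta i.+1 w)].
have mset (i : 'I_n) : measurable [set cw : R * T | A i (cw.1 + eta i.+1 cw.2)].
  rewrite -[X in measurable X]setTI.
  have mf : measurable_fun setT (fun cw : R * T => cw.1 + eta i.+1 cw.2).
    apply: measurable_funD; first exact: measurable_fst.
    exact: (measurableT_comp (measurable_funPT (eta i.+1)) measurable_snd).
  exact: mf.
have UE i : U i = P \o xsection [set cw : R * T | A i (cw.1 + eta i.+1 cw.2)].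
  apply/funext => c; rewrite /U /=; congr (P _).
  by apply/seteqP; split => w; rewrite /xsection /= in_setE.
have mU i : measurable_fun setT (U i).
  by rewrite UE; exact: measurable_fun_xsection.
have mS1 : measurable [set w | forall i, A i (gamma_sum i w)].
  rewrite (_ : [set w | _] = \bigcap_(i in [set: 'I_n]) (gamma_sum i @^-1` A i)).
    apply: fin_bigcap_measurable; first exact: finite_finset.
    by move=> i _; rewrite -[X in measurable X]setTI; exact: measurable_gamma_sum.
  by apply/seteqP; split => w /= h i; [move=> _|]; apply: h.
have sec (B : set (T * T)) : (P2 B = \int[P]_w P (xsection B w))%E by [].
rewrite sec.
have -> : (\int[P]_w P (xsection [set w | forall i, A i (gamma_sum i w)] w) =
   \int[P]_w \prod_(i < n) U i (tnth (tuple_of gamma_shift w) i))%E.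
  apply: eq_integral => w _.
  pose B (i : 'I_n) := [set x | A i (gamma_shift i w + x)].
  have mB i : measurable (B i).
    rewrite -[X in measurable X]setTI.
    have mf : measurable_fun setT (fun x : R => gamma_shift i w + x) by exact: measurable_funD.
    exact: mf.
  transitivity (P [set w' | forall i, B i (subfamily (fun i => (1 <= i)%N) eta (fun i : 'I_n => i.+1) 0 i w')]).
    congr (P _); apply/seteqP; split => w'; rewrite /xsection /= in_setE /=.
      by move=> h i; exact: h.
    by move=> h i; exact: h.
  rewrite iE //; apply: eq_bigr => i _ /=; rewrite tnth_mktuple /U; congr (P _).
have -> : (\int[P]_w \prod_(i < n) U i (tnth (tuple_of gamma_shift w) i) =
    \prod_(i < n) \int[P]_w U i (gamma_shift i w))%E.
  apply: (sequential_product measurable_gamma_shift iS (Phi := fun i t => U i (tnth t i))).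
  - by move=> i; exact: (measurableT_comp (mU i) (measurable_tnth i)).
  - by move=> i t; exact: measure_ge0.
  - by move=> i t t' /= h; rewrite h.
  - by move=> i; apply: integral_ge0 => w _; exact: measure_ge0.
  - move=> i; apply: aeW => w /=; apply: eq_integral => w' _.
    by rewrite tnth_mktuple eqxx.
apply: eq_bigr => i _; rewrite sec; apply: eq_integral => w _; congr (P _).
by apply/seteqP; split => w'; rewrite /xsection /= in_setE.
Qed.

End gamma_family.

(** * Gram-Schmidt vectors as projections *)

Section gram_schmidt.
Context {R : realType} {n : nat}.
Implicit Types (b : nat -> 'rV[R]_n) (x v : 'rV[R]_n) (Q : 'M[R]_n).

(* The orthogonal projection onto the complement of b 1, ..., b m. *)
Fixpoint gs_proj b (m : nat) : 'M[R]_n :=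
  if m is m'.+1 then
    let v := b m *m gs_proj b m' in gs_proj b m' - (sqnorm v)^-1 *: (v^T *m v)
  else 1%:M.

Lemma eq_gs_proj b b' m : (forall i, (1 <= i <= m)%N -> b i = b' i) -> gs_proj b m = gs_proj b' m.
Proof.
elim: m => [//|m IH] bb' /=; rewrite IH => [|i /andP[i1 im]].
  by rewrite bb' // leqnn.
by apply: bb'; rewrite i1 (leq_trans im).
Qed.

Lemma mulmx_rank1 x v : x *m (v^T *m v) = dotv x v *: v.
Proof.
rewrite mulmxA -mul_scalar_mx; congr (_ *m v).
by rewrite dotvE [LHS]mx11_scalar.
Qed.

Lemma gsES b m : gs b m.+1 = b m.+1 *m gs_proj b m.
Proof.
suff H x : x *m gs_proj b m =
    x - \sum_(1 <= i < m.+1) (dotv x (gs b i) / sqnorm (gs b i)) *: gs b i by rewrite gsE // H.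
elim: m x => [|m IH] x; first by rewrite big_geq // subr0 mulmx1.
have gsm : b m.+1 *m gs_proj b m = gs b m.+1 by rewrite IH gsE.
rewrite big_nat_recr //= gsm mulmxBr IH -scalemxAr mulmx_rank1 scalerA opprD addrA.
by rewrite [_^-1 * _]mulrC.
Qed.

Lemma gs_proj_ortho b m : ortho_proj (gs_proj b m).
Proof.
elim: m => [|m [QT QQ]] /=; first by rewrite /ortho_proj trmx1 mulmx1.
set Q := gs_proj b m in QT QQ *; set v := b m.+1 *m Q.
have vQ : v *m Q = v by rewrite /v -mulmxA QQ.
have Qv : Q *m v^T = v^T by rewrite -[in LHS]QT -trmx_mul vQ.
split; first by rewrite linearB linearZ /= trmx_mul trmxK QT.
have SQ : v^T *m v *m Q = v^T *m v by rewrite -mulmxA vQ.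
have QS : Q *m (v^T *m v) = v^T *m v by rewrite mulmxA Qv.
have SS : v^T *m v *m (v^T *m v) = sqnorm v *: (v^T *m v).
  by rewrite -mulmxA mulmx_rank1 -scalemxAr.
rewrite mulmxBl !mulmxBr -!scalemxAl -!scalemxAr QQ SQ QS SS !scalerA.
(* If v = 0, the projection stays unchanged since the inverse of 0 is 0. *)
have [v0|v0] := eqVneq (sqnorm v) 0; first by rewrite v0 invr0 !mul0r !scale0r !subr0.
by rewrite -mulrA mulVf // mulr1 subrr subr0.
Qed.

(** Each nonzero Gram-Schmidt vector removes a projection of rank one, hence of trace 1. *)
Lemma trace_gs_proj b m : (forall i, (1 <= i <= m)%N -> gs b i != 0) ->
  \tr (gs_proj b m) = n%:R - m%:R.
Proof.
elim: m => [|m IH] gs0 /=; first by rewrite mxtrace1 subr0.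
rewrite -gsES raddfB /= IH => [|i /andP[i1 im]]; last by apply: gs0; rewrite i1 (leq_trans im).
rewrite linearZ /= mxtrace_mulC [X in \tr X]mx11_scalar mxtrace_scalar -dotvE -/(sqnorm _).
by rewrite mulVf ?sqnorm_eq0 ?gs0 ?leqnn // -natr1 opprD addrA.
Qed.

Lemma sqnorm_gs b m : sqnorm (gs b m.+1) = frac (gs_proj b m) (b m.+1) * sqnorm (b m.+1).
Proof.
rewrite gsES /frac; have [b0|b0] := eqVneq (b m.+1) 0; last by rewrite divfK ?sqnorm_eq0.
by rewrite b0 mul0mx (_ : sqnorm 0 = 0) ?mulr0 //; apply/eqP; rewrite sqnorm_eq0.
Qed.

Lemma measurable_gs_proj d (T : measurableType d) (b : T -> nat -> 'rV[R]_n) m :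
  (forall i c, measurable_fun setT (fun w => b w i 0 c)) ->
  forall i j, measurable_fun setT (fun w => gs_proj (b w) m i j).
Proof.
move=> mb; elim: m => [|m IH] i j /=; first exact: measurable_cst.
have mv k : measurable_fun setT (fun w => (b w m.+1 *m gs_proj (b w) m) 0 k).
  exact: measurable_row.
have -> : (fun w => (gs_proj (b w) m - (sqnorm (b w m.+1 *m gs_proj (b w) m))^-1 *:
    ((b w m.+1 *m gs_proj (b w) m)^T *m (b w m.+1 *m gs_proj (b w) m))) i j) =
  (fun w => gs_proj (b w) m i j - (sqnorm (b w m.+1 *m gs_proj (b w) m))^-1 *
    ((b w m.+1 *m gs_proj (b w) m) 0 i * (b w m.+1 *m gs_proj (b w) m) 0 j)).
  apply/funext => w; set v := b w m.+1 *m _.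
  have vvE : (v^T *m v) i j = v 0 i * v 0 j by rewrite mxE big_ord1 mxE.
  by rewrite -vvE !mxE.
apply: measurable_funB => //; apply: measurable_funM.
  by apply: measurable_funV; exact: measurable_sqnorm.
exact: measurable_funM.
Qed.

Lemma measurable_gs d (T : measurableType d) (b : T -> nat -> 'rV[R]_n) m :
  (forall i c, measurable_fun setT (fun w => b w i 0 c)) ->
  forall c, measurable_fun setT (fun w => gs (b w) m 0 c).
Proof.
move=> mb c; case: m => [|m].
  by rewrite /gs /=; exact: measurable_cst.
under eq_fun do rewrite gsES.
by apply: measurable_row => // *; exact: measurable_gs_proj.
Qed.

End gram_schmidt.

Section gamma_positive.
Context {R : realType} d {T : measurableType d} (P : probability T R).

(** Where X <= 0 one has e^(-k X) >= 1, so by Markov's inequality this event has probability at most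
    (1 + k)^(-a) for every k. *)
Lemma gamma_law_gt0 a (X : T -> R) : 0 < a -> gamma_law P a X -> {ae P, forall w, 0 < X w}.
Proof.
move=> a0 [mX Xl].
have mS : measurable [set w | X w <= 0].
  by rewrite -[Z in measurable Z]setTI; exact: measurable_fun_ler.
exists [set w | X w <= 0]; split => //; last by move=> w /= /negP; rewrite -leNgt.
have bound (k : nat) : (P [set w | X w <= 0]%R <= ((1 + k%:R) `^ (- a))%:E)%E.
  have k1 : -1 < k%:R :> R by apply: lt_le_trans (ler0n _ k); rewrite ltrN10.
  have mf : measurable_fun setT (fun w => expR (- (k%:R * X w))).
    by apply: measurableT_comp => //; apply: measurable_funN; exact: measurable_funM.
  have mA : measurable [set w | 1 <= expR (- (k%:R * X w))].
    by rewrite -[Z in measurable Z]setTI; exact: measurable_fun_ler.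
  have := markov_ineq P mf (fun w => expR_ge0 _) ler01; rewrite mul1e Xl //.
  apply: le_trans; apply: le_measure; rewrite ?inE // => w /= Xw.
  by rewrite -expR0 ler_expR oppr_ge0 mulr_ge0_le0.
apply/eqP; rewrite eq_le measure_ge0 andbT; apply/lee_addgt0Pr => e e0; rewrite add0e.
have [k hk] : exists k : nat, (1 + k%:R) `^ (- a) <= e.
  (* Then 1 + k exceeds e^(-1/a), so that (1 + k)^(-a) <= e. *)
  exists (Num.truncn (e `^ (- a^-1))).+1.
  apply: (@le_trans _ _ ((e `^ (- a^-1)) `^ (- a))).
    apply: powRN_le; [by rewrite powR_gt0| |exact: ltW].
    by apply: ltW; apply: lt_trans (truncnS_gt _) _; rewrite ltrDr.
  by rewrite -powRrM mulrNN mulVf ?gt_eqF // powRr1 // ltW.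
by apply: le_trans (bound k) _; rewrite lee_fin.
Qed.

End gamma_positive.

(** * The law of the product of a gamma variable and a projected fraction *)

Section projected_gamma.
Context {R : realType} {n : nat} (nu : probability 'rV[R]_n R) (Q : 'M[R]_n) (m : nat).
Hypothesis nu_inv : forall (U : 'M[R]_n) (A : set 'rV[R]_n),
  rotation U -> measurable A -> nu [set x | A (x *m U)] = nu A.
Hypothesis nu0 : nu [set 0] = 0%E.
Hypotheses (projQ : ortho_proj Q) (trQ : \tr Q = m%:R) (m0 : (0 < m)%N) (n0 : (0 < n)%N).
Context d1 {T1 : measurableType d1} (P1 : probability T1 R) (H : T1 -> R).
Hypothesis HH : gamma_law P1 (n%:R / 2) H.
Context d2 {T2 : measurableType d2} (P2 : probability T2 R) (Y : T2 -> R).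
Hypothesis YY : gamma_law P2 (m%:R / 2) Y.

Let mfrac : measurable_fun setT (frac Q).
Proof. by apply: measurable_frac => // i; exact: measurable_coord. Qed.

Let mH : measurable_fun setT H. Proof. by case: HH. Qed.

Let mHX : measurable_fun setT (fun xw : 'rV[R]_n * T1 => H xw.2 * frac Q xw.1).
Proof.
apply: measurable_funM; first exact: (measurableT_comp mH measurable_snd).
exact: (measurableT_comp mfrac measurable_fst).
Qed.

(** Given x, the transform of H u at p is (1 + p u)^(-n/2); averaged over x by [spherical_laplace]
    at t = ln (1 + p), it becomes (1 + p)^(-m/2), the transform of [Y]. *)
Lemma projected_gamma (A : set R) : measurable A ->
  (\int[nu]_x P1 [set w | A (H w * frac Q x)%R] = P2 (Y @^-1` A))%E.
Proof.
move=> mA.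
have nR : 0 < n%:R / 2 :> R by rewrite divr_gt0 ?ltr0n.
have mR : 0 < m%:R / 2 :> R by rewrite divr_gt0 ?ltr0n.
pose PP : probability ('rV[R]_n * T1)%type R := (nu \x P1)%E.
have <- := @laplace_unique _ _ _ PP _ _ P2 _ Y (fun p => (1 + p%:R) `^ (- (m%:R / 2)))
  mHX (proj1 YY) _ _ _ (gamma_law_moments YY) A mA.
- transitivity (PP ((fun xw => H xw.2 * frac Q xw.1) @^-1` A)) => //.
  have -> (B : set ('rV[R]_n * T1)) : (PP B = \int[nu]_x P1 (xsection B x))%E by [].
  apply: eq_integral => x _; congr (P1 _).
  by apply/seteqP; split => w; rewrite /xsection /= in_setE.
- have [N [mN N0 HN]] := gamma_law_gt0 nR HH.
  exists (setT `*` N); split; first exact: measurableX.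
    by rewrite [LHS]product_measure1E // [X in (_ * X)%E](N0 : _ = 0%E) mule0.
  move=> [x w] /= h; split => //; apply: HN => /= Hw; apply: h.
  by rewrite mulr_ge0 ?frac_ge0 // ltW.
- by apply: filterS (gamma_law_gt0 mR YY) => w /ltW.
- move=> p; have p1 : -1 < p%:R :> R by apply: lt_le_trans (ler0n _ p); rewrite ltrN10.
  rewrite fubini_tonelli1 /fubini_F /=; last first.
  + by move=> xw; rewrite lee_fin expR_ge0.
  + apply/measurable_EFinP; apply: measurableT_comp => //; apply: measurable_funN.
    exact: measurable_funM.
  have inner x : (\int[P1]_y (expR (- (p%:R * (H y * frac Q x))))%:E =
      ((1 + p%:R * frac Q x) `^ (- (n%:R / 2)))%:E)%E.
    under eq_integral do rewrite [H _ * _]mulrC mulrA.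
    by have [_ ->] := HH => //; apply: lt_le_trans (mulr_ge0 (ler0n _ p) (frac_ge0 _ _)); rewrite ltrN10.
  under eq_integral do rewrite inner.
  have c0 : 0 < 1 + p%:R :> R by rewrite ltr_pwDl.
  have := spherical_laplace nu_inv nu0 projQ (ln (1 + p%:R)).
  rewrite lnK ?posrE // [1 + p%:R]addrC addrK trQ => E.
  have fin : nu.-integrable setT (fun x => ((1 + p%:R * frac Q x) `^ (- (n%:R / 2)))%:E).
    apply: (@Rintegrable_bounded _ _ _ nu (fun x => (1 + p%:R * frac Q x) `^ (- (n%:R / 2))) 1).
      apply: (measurableT_comp (measurable_powR _)).
      by apply: measurable_funD => //; exact: measurable_funM.
    have one : (1 : R) `^ (- (n%:R / 2)) = 1 by rewrite powR1.
    move=> x; rewrite ger0_norm ?powR_ge0 // -[leRHS]one.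
    apply: powRN_le; [exact: ltr01| |exact: ltW].
    by rewrite lerDl mulr_ge0 ?frac_ge0.
  have := integrable_fin_num measurableT fin => /fineK <-; congr EFin.
  rewrite -[LHS]/(\int[nu]_x _) E addrC /powR gt_eqF //.
  by rewrite mulNr.
Qed.

(** Where the fraction vanishes so does H u, and H u has the law of [Y], which is almost surely
    positive. *)
Lemma frac_eq0_null : nu [set x | frac Q x = 0] = 0%E.
Proof.
have mS : measurable [set x | frac Q x = 0].
  by rewrite -[Z in measurable Z]setTI; exact: (mfrac measurableT (measurable_set1 0)).
have mY : measurable_fun setT Y by case: YY.
have Y0 : P2 (Y @^-1` [set 0]) = 0%E.
  have mR : 0 < m%:R / 2 :> R by rewrite divr_gt0 ?ltr0n.
  have [N [mN N0 HN]] := gamma_law_gt0 mR YY.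
  apply/eqP; rewrite eq_le measure_ge0 andbT -N0; apply: le_measure; rewrite ?inE //.
    by rewrite -[Z in measurable Z]setTI; exact: mY.
  by move=> w /= Yw; apply: HN => /=; rewrite Yw ltxx.
apply/eqP; rewrite eq_le measure_ge0 andbT -Y0 -projected_gamma //.
have -> : nu [set x | frac Q x = 0] = (\int[nu]_x (\1_[set x | frac Q x = 0] x)%:E)%E.
  by rewrite integral_indic // setIT.
apply: ge0_le_integral => //.
- exact/measurable_EFinP/measurable_indic.
- rewrite (_ : (fun x => _) = P1 \o xsection ((fun xw => H xw.2 * frac Q xw.1) @^-1` [set 0])).
    by apply: measurable_fun_xsection; rewrite -[Z in measurable Z]setTI; exact: mHX.
  apply/funext => x /=; congr (P1 _).
  by apply/seteqP; split => w; rewrite /xsection /= in_setE.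
- move=> x _; rewrite indicE; case: (boolP (x \in _)) => [/set_mem /= ->|_]; last exact: measure_ge0.
  rewrite (_ : [set w | _] = setT) ?[leRHS](probability_setT P1) //.
  by apply/seteqP; split => // w _ /=; rewrite mulr0.
Qed.

End projected_gamma.

Lemma independent_tuple_reindex (R : realType) d (Om : measurableType d) (P : probability Om R)
    d' (T : measurableType d') (N M : nat) (X : 'I_N -> Om -> T) (f : 'I_M -> 'I_N) :
  injective f -> independent_tuple P X -> independent_tuple P (fun i => X (f i)).
Proof.
move=> f_inj iX A mA.
pose E (l : 'I_N) : set T := if [pick i | f i == l] is Some i then A i else setT.
have Ef i : E (f i) = A i.
  rewrite /E; case: pickP => [j /eqP /f_inj -> //|/(_ i)]; by rewrite eqxx.
have mE l : measurable (E l) by rewrite /E; case: pickP.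
transitivity (P [set w | forall l, E l (X l w)]).
  congr (P _); apply/seteqP; split => w /= h; last by move=> i; have := h (f i); rewrite Ef.
  by move=> l; rewrite /E; case: pickP => // i /eqP <-.
rewrite iX // (bigID (fun l => l \in codom f)) /= [X in (_ * X)%E]big1 ?mule1 => [|l lf].
  rewrite -big_uniq; last by rewrite map_inj_uniq // enum_uniq.
  rewrite /codom /image_mem big_map big_enum /=.
  by apply: eq_bigr => i _; rewrite Ef.
rewrite /E; case: pickP => [i /eqP fi|_]; first by move: lf; rewrite -fi codom_f.
by rewrite preimage_setT -[RHS](probability_setT P).
Qed.

(** * Joint law of the products along the Gram-Schmidt process *)

Section peeling.
Context {R : realType} {n : nat} (n0 : (0 < n)%N) (nu : probability 'rV[R]_n R).
Hypothesis nu_inv : forall (U : 'M[R]_n) (A : set 'rV[R]_n),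
  rotation U -> measurable A -> nu [set x | A (x *m U)] = nu A.
Hypothesis nu0 : nu [set 0] = 0%E.
Context (g : nat) d {Om : measurableType d} (P : probability Om R) (b : nat -> {RV P >-> 'rV[R]_n}).
Hypothesis basis : random_basis nu g b.
Context d' {T' : measurableType d'} (P' : probability T' R) (eta : nat -> {RV P' >-> R}).
Hypothesis ieta : independent_RVs [set i | (1 <= i)%N] eta.
Hypothesis geta : forall i, (1 <= i)%N -> gamma_distributed (i%:R / 2) (eta i).

Local Notation N := (n - g)%N.
Let bX (i : 'I_N) (w : Om) : 'rV[R]_n := b i.+1 w.
Let bw (w : Om) (j : nat) : 'rV[R]_n := b j w.

Let mbX i : measurable_fun setT (bX i). Proof. exact: (measurable_funPT (b i.+1)). Qed.

Let ibX : independent_tuple P bX.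
Proof.
have [ib _] := basis.
have -> : bX = subfamily (fun i => (1 <= i <= N)%N) b (fun i : 'I_N => i.+1) 0.
  by apply/funext => i; apply/funext => w; rewrite /subfamily /= ltn_ord.
by apply: independent_subfamily => // i j /succn_inj /ord_inj.
Qed.

Let seqv (t : N.-tuple 'rV[R]_n) (j : nat) : 'rV[R]_n := nth 0 t j.-1.

Let seqvS t (j : nat) (jN : (j < N)%N) : seqv t j.+1 = tnth t (Ordinal jN).
Proof. by rewrite (tnth_nth 0). Qed.

Let mseqv j c : measurable_fun setT (fun t => seqv t j 0 c).
Proof.
rewrite /seqv; have [jN|jN] := ltnP j.-1 N.
  under eq_fun do rewrite -[j.-1]/(val (Ordinal jN)) -tnth_nth.
  exact: (measurableT_comp (measurable_coord c) (measurable_tnth _)).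
under eq_fun do rewrite nth_default ?size_tuple //.
exact: measurable_cst.
Qed.

Let tfrac (i : 'I_N) (t : N.-tuple 'rV[R]_n) : R := frac (gs_proj (seqv t) i) (tnth t i).

Let mtfrac i : measurable_fun setT (tfrac i).
Proof.
apply: measurable_frac; first exact: measurable_gs_proj.
by move=> c; exact: (measurableT_comp (measurable_coord c) (measurable_tnth _)).
Qed.

Let tfrac_past (i : 'I_N) t t' : (forall j : 'I_N, (j <= i)%N -> tnth t j = tnth t' j) ->
  tfrac i t = tfrac i t'.
Proof.
move=> h; rewrite /tfrac h //; congr frac; apply: eq_gs_proj => -[//|j] /= ji.
have jN : (j < N)%N by apply: leq_ltn_trans (ltnW ji) (ltn_ord i).
by rewrite !(seqvS _ jN); apply: h; exact: ltnW.
Qed.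

Let seqv_tuple_of w j : (1 <= j <= N)%N -> seqv (tuple_of bX w) j = bw w j.
Proof.
by case: j => [//|j] jN; rewrite (seqvS _ jN) tnth_mktuple.
Qed.

Let tfrac_tuple_of i w : tfrac i (tuple_of bX w) = frac (gs_proj (bw w) i) (bw w i.+1).
Proof.
rewrite /tfrac tnth_mktuple; congr frac; apply: eq_gs_proj => j /andP[j1 ji].
by apply: seqv_tuple_of; rewrite j1 (leq_trans ji) // ltnW.
Qed.

Let tfrac_resample i w w' :
  tfrac i (resample bX i w w') = frac (gs_proj (bw w) i) (bw w' i.+1).
Proof.
rewrite /tfrac tnth_mktuple eqxx; congr frac; apply: eq_gs_proj => -[//|j] /= ji.
have jN : (j < N)%N by apply: leq_ltn_trans (ltnW ji) (ltn_ord i).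
rewrite (seqvS _ jN) tnth_mktuple.
by rewrite ifN // -val_eqE /= ltn_eqF.
Qed.

(** Resampling draws b_{i+1} afresh from [nu], while the projection remains that of the earlier
    vectors. *)
Let inner_integral (h : R -> \bar R) i w : measurable_fun setT h -> (forall u, 0 <= h u)%E ->
  (\int[P]_w' h (tfrac i (resample bX i w w')) = \int[nu]_x h (frac (gs_proj (bw w) i) x))%E.
Proof.
move=> mh h0; under eq_integral do rewrite tfrac_resample.
have [_ law] := basis.
have mf : measurable_fun setT (fun x : 'rV[R]_n => h (frac (gs_proj (bw w) i) x)).
  apply: (measurableT_comp mh); apply: measurable_frac => // c; exact: measurable_coord.
transitivity (\int[distribution P (b i.+1)]_x h (frac (gs_proj (bw w) i) x))%E.
  by rewrite ge0_integral_distribution.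
by apply: eq_measure_integral => A mA _; apply: law => //; rewrite /= ltn_ord.
Qed.

Let nondegenerate w (m : nat) := forall i, (1 <= i <= m)%N -> gs (bw w) i != 0.

Let trace_nat w m : (m <= n)%N -> nondegenerate w m -> \tr (gs_proj (bw w) m) = (n - m)%N%:R.
Proof. by move=> mn nd; rewrite trace_gs_proj // natrB. Qed.

Let ord_lt_n (i : 'I_N) : (i < n)%N.
Proof. by apply: leq_trans (ltn_ord i) (leq_subr _ _). Qed.

Let P2 : probability (T' * T')%type R := (P' \x P')%E.

Let gsum_law (i : 'I_n) : gamma_law P2 (n%:R / 2) (gamma_sum eta i).
Proof. exact: gamma_law_sum. Qed.

(** If the first m vectors are nondegenerate, the next projection has trace n - m > 0, and by
    [frac_eq0_null] a fresh vector almost surely has a nonzero image. *)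
Lemma ae_nondegenerate m : (m <= N)%N -> {ae P, forall w, nondegenerate w m}.
Proof.
elim: m => [_|m IH mN]; first by apply: aeW => w i; rewrite leqn0 => /andP[]; case: i.
pose l := Ordinal mN.
have {}IH := IH (ltnW mN).
pose h (u : R) : \bar R := (\1_[set (0:R)] u)%:E.
have mh : measurable_fun setT h by exact/measurable_EFinP/measurable_indic.
have h0 u : (0 <= h u)%E by rewrite lee_fin.
have mZ : measurable_fun setT (fun w => tfrac l (tuple_of bX w)).
  exact: (measurableT_comp (mtfrac l) (measurable_tuple_of mbX)).
pose Z := (fun w => tfrac l (tuple_of bX w)) @^-1` [set 0].
have mSZ : measurable Z by rewrite -[X in measurable X]setTI; exact: mZ.
have Z0 : P Z = 0%E.
  transitivity (\int[P]_w h (tfrac l (tuple_of bX w)))%E.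
    by rewrite -{1}(setIT Z) -integral_indic.
  have mF : measurable_fun setT (h \o tfrac l) by exact: (measurableT_comp mh (mtfrac l)).
  rewrite (ge0_integral_resample mbX ibX l mF) => [|t]; last exact: h0.
  rewrite (ae_eq_integral (cst 0%E)) ?integral0 //.
    apply: (@measurable_fun_fubini_tonelli_F _ _ _ _ _ P (fun ww => h (tfrac l (resample bX l ww.1 ww.2)))) => //.
      by apply: (measurableT_comp (measurableT_comp mh (mtfrac l)) (measurable_resample mbX l)).
  apply: filterS IH => w nd _ /=.
  rewrite inner_integral //.
  rewrite (_ : (fun x => _) = fun x => (\1_[set x | frac (gs_proj (bw w) l) x = 0] x)%:E) //.
  rewrite integral_indic ?setIT //.
    have m0 : (0 < n - l)%N by rewrite subn_gt0; exact: (ord_lt_n l).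
    exact: (frac_eq0_null nu_inv nu0 (gs_proj_ortho _ _) (trace_nat (ltnW (ord_lt_n l)) nd) m0 n0
      (gsum_law (Ordinal n0)) (gamma_law_eta geta m0)).
  rewrite -[X in measurable X]setTI.
  have mf : measurable_fun setT (frac (gs_proj (bw w) l)).
    by apply: measurable_frac => // c; exact: measurable_coord.
  exact: (mf measurableT [set (0:R)] (measurable_set1 (0:R))).
have nZ : {ae P, forall w, ~ Z w} by exists Z; split => // w /= /contrapT.
apply: filterS2 IH nZ => w nd nZw i /andP[i1]; rewrite leq_eqVlt => /orP[/eqP ->|im].
  apply/negP => /eqP gs0; apply: nZw; rewrite /Z /= tfrac_tuple_of /frac -gsES gs0.
  by rewrite (_ : sqnorm 0 = 0) ?mul0r //; apply/eqP; rewrite sqnorm_eq0.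
by apply: nd; rewrite i1.
Qed.

Let PP : probability (Om * (T' * T'))%type R := (P \x P2)%E.

(* The vector b_{i+1} corresponds to the index j = n - i of the statement. *)
Definition gs_index (i : 'I_N) : 'I_n := rev_ord (widen_ord (leq_subr g n) i).

Definition gs_frac (i : 'I_N) (w : Om) : R := frac (gs_proj (bw w) i) (bw w i.+1).

Definition zeta (i : 'I_N) (ww : Om * (T' * T')) : R :=
  gamma_sum eta (gs_index i) ww.2 * gs_frac i ww.1.

Lemma measurable_gs_frac i : measurable_fun setT (gs_frac i).
Proof.
have mb j c : measurable_fun setT (fun w => bw w j 0 c).
  exact: (measurableT_comp (measurable_coord c) (measurable_funPT (b j))).
by apply: measurable_frac => //; exact: measurable_gs_proj.
Qed.

Lemma measurable_zeta i : measurable_fun setT (zeta i).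
Proof.
apply: measurable_funM.
  exact: (measurableT_comp (measurable_gamma_sum eta (gs_index i)) measurable_snd).
exact: (measurableT_comp (measurable_gs_frac i) measurable_fst).
Qed.

(** For fixed vectors the gamma factors are independent, so the conditional probability is a product
    of functions h_i of the fractions. Given the earlier vectors, h_i has the constant mean
    P(eta_{n-i} in A_i) by [projected_gamma], and [sequential_product] applies. *)
Lemma zeta_rect (A : 'I_N -> set R) : (forall i, measurable (A i)) ->
  PP [set ww | forall i, A i (zeta i ww)] = P' [set w | forall i : 'I_N, A i (eta (n - i)%N w)].
Proof.
move=> mA.
have idx_inj : injective gs_index.
  by move=> i j /rev_ord_inj /(congr1 val) /= /ord_inj.
have iG := independent_tuple_reindex idx_inj (independent_gamma_sum ieta (n := n)).
have iE : independent_tuple P' (subfamily (fun i => (1 <= i)%N) eta (fun i : 'I_N => (n - i)%N) 0).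
  apply: independent_subfamily => // i j /= ij; apply: ord_inj.
  by rewrite -(subKn (ltnW (ord_lt_n i))) ij (subKn (ltnW (ord_lt_n j))).
have subE : subfamily (fun i => (1 <= i)%N) eta (fun i : 'I_N => (n - i)%N) 0 =
    (fun (i : 'I_N) w => eta (n - i)%N w).
  by apply/funext => i; apply/funext => w; rewrite /subfamily subn_gt0 ord_lt_n.
rewrite subE in iE; rewrite [RHS]iE //.
pose h (i : 'I_N) (u : R) : \bar R := P2 [set ww | A i (gamma_sum eta (gs_index i) ww * u)%R].
have mset (i : 'I_N) : measurable
    [set uw : R * (T' * T') | A i (gamma_sum eta (gs_index i) uw.2 * uw.1)].
  rewrite -[X in measurable X]setTI.
  have mf : measurable_fun setT (fun uw : R * (T' * T') => gamma_sum eta (gs_index i) uw.2 * uw.1).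
    apply: measurable_funM; last exact: measurable_fst.
    exact: (measurableT_comp (measurable_gamma_sum eta (gs_index i)) measurable_snd).
  exact: mf.
have mh i : measurable_fun setT (h i).
  rewrite (_ : h i = P2 \o xsection [set uw : R * (T' * T') | A i (gamma_sum eta (gs_index i) uw.2 * uw.1)]).
    exact: measurable_fun_xsection.
  apply/funext => u; rewrite /h /=; congr (P2 _).
  by apply/seteqP; split => w; rewrite /xsection /= in_setE.
have h0 i u : (0 <= h i u)%E by exact: measure_ge0.
have sec (B : set (Om * (T' * T'))) : (PP B = \int[P]_w P2 (xsection B w))%E by [].
rewrite sec.
transitivity (\int[P]_w \prod_(i < N) h i (tfrac i (tuple_of bX w)))%E.
  apply: eq_integral => w _.
  have := iG (fun i => [set x | A i (x * gs_frac i w)]) _.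
  rewrite (_ : [set ww | _] = xsection [set ww | forall i, A i (zeta i ww)] w); last first.
    by apply/seteqP; split => ww; rewrite /xsection /= in_setE.
  move=> ->; last first.
    move=> i; rewrite -[X in measurable X]setTI.
    have mf : measurable_fun setT (fun x : R => x * gs_frac i w).
      by apply: measurable_funM; [exact: measurable_id|exact: measurable_cst].
    exact: (mf measurableT _ (mA i)).
  by apply: eq_bigr => i _; rewrite /h tfrac_tuple_of.
apply: (sequential_product mbX ibX (Phi := fun i t => h i (tfrac i t))).
- by move=> i; exact: (measurableT_comp (mh i) (mtfrac i)).
- by [].
- by move=> i t t' /tfrac_past ->.
- by move=> i; exact: measure_ge0.
- move=> i; have := ae_nondegenerate (ltnW (ltn_ord i)); apply: filterS => w nd.
  rewrite inner_integral //.
  have m0 : (0 < n - i)%N by rewrite subn_gt0; exact: ord_lt_n.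
  exact: (projected_gamma nu_inv nu0 (gs_proj_ortho _ _) (trace_nat (ltnW (ord_lt_n i)) nd) m0 n0
    (gsum_law (gs_index i)) (gamma_law_eta geta m0) (mA i)).
Qed.

Lemma zeta_law (E : set (N.-tuple R)) : measurable E ->
  PP [set ww | E [tuple zeta i ww | i < N]] = P' [set w | E [tuple eta (n - i)%N w | i < N]].
Proof.
move=> mE.
have m1 : measurable_fun setT (tuple_of zeta) by apply: measurable_tuple_of => i; exact: measurable_zeta.
have m2 : measurable_fun setT (tuple_of (fun (i : 'I_N) w => eta (n - i)%N w)).
  apply: measurable_tuple_of => i; exact: (measurable_funPT (eta (n - i)%N)).
pose Y1 : {RV PP >-> N.-tuple R} := RV_of PP m1.
pose Y2 : {RV P' >-> N.-tuple R} := RV_of P' m2.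
apply: (@tuple_measure_unique _ _ _ _ (distribution PP Y1) (distribution P' Y2)) => // A mA.
transitivity (PP [set ww | forall i, A i (zeta i ww)]).
  congr (PP _); apply/seteqP; split => w /= h i; have := h i; by rewrite tnth_mktuple.
rewrite zeta_rect //.
congr (P' _); apply/seteqP; split => w /= h i; have := h i; by rewrite tnth_mktuple.
Qed.

Lemma sqnorm_gs_zeta (i : 'I_N) w ww : 0 < gamma_sum eta (gs_index i) ww ->
  sqnorm (gs (fun j => b j w) i.+1) =
  sqnorm (b i.+1 w) / gamma_sum eta (gs_index i) ww * zeta i (w, ww).
Proof.
move=> G0; rewrite sqnorm_gs /zeta /gs_frac /bw /= mulrC -mulrA; congr (_ * _).
by rewrite mulrA mulVf ?mul1r // gt_eqF.
Qed.

End peeling.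

(** * Minimal ratios of a sequence *)

Section levels.
Context {R : realType}.
Implicit Types (e : nat -> R) (i j k n : nat).

(** The common form of the reduction level and of the truncated limit level, so that Gram-Schmidt
    norms and gamma variables enter the same functional. *)
Definition level n k e : R :=
  \big[Order.min/lim_ratio e k.+1]_(k.+1 <= j < n) lim_ratio e j.

Definition windex n k e : nat :=
  \big[minn/n]_(k.+1 <= j < n | lim_ratio e j == level n k e) j.

Lemma level_le n k e j : (k < j < n)%N -> level n k e <= lim_ratio e j.
Proof. by move=> kjn; apply: bigmin_inf_seq => //; rewrite mem_index_iota. Qed.

Lemma le_level n k e c : c <= lim_ratio e k.+1 ->
  (forall j, (k < j < n)%N -> c <= lim_ratio e j) -> c <= level n k e.
Proof.
move=> c1 cj; rewrite /level big_nat_cond; apply: (big_ind (fun x => c <= x)) => //.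
  by move=> x y cx cy; rewrite le_min cx.
by move=> j; rewrite andbT => /cj.
Qed.

Lemma level_strict_min n k e i : (k < i < n)%N ->
  (forall j, (k < j < n)%N -> j != i -> lim_ratio e i < lim_ratio e j) ->
  level n k e = lim_ratio e i.
Proof.
move=> kin mini; have le_i j : (k < j < n)%N -> lim_ratio e i <= lim_ratio e j.
  by move=> kjn; have [->//|ji] := eqVneq j i; exact/ltW/mini.
apply/eqP; rewrite eq_le level_le //= le_level // le_i // ltnS leqnn /=.
by case/andP: kin; exact: leq_ltn_trans.
Qed.

Lemma windex_strict_min n k e i : (k < i < n)%N ->
  (forall j, (k < j < n)%N -> j != i -> lim_ratio e i < lim_ratio e j) ->
  windex n k e = i.
Proof.
move=> kin mini; rewrite /windex (level_strict_min kin mini).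
have i_n : (i < n)%N by case/andP: kin.
apply/eqP; rewrite eqn_leq; apply/andP; split; last first.
  rewrite big_nat_cond; apply: (big_ind (fun x => (i <= x)%N)).
  - exact: ltnW.
  - by move=> x y ix iy; rewrite leq_min ix.
  - move=> j /andP[kjn /eqP Rj]; have [->//|ji] := eqVneq j i.
    by have := mini j kjn ji; rewrite Rj ltxx.
have : i \in index_iota k.+1 n by rewrite mem_index_iota.
elim: (index_iota _ _) => // j s IH; rewrite inE big_cons => /predU1P[<-|/IH le_i].
  by rewrite eqxx geq_minl.
by case: ifP => // _; rewrite geq_min le_i orbT.
Qed.

Lemma lim_level_strict_min k e i : (k < i)%N ->
  (forall j, (k < j)%N -> j != i -> lim_ratio e i < lim_ratio e j) ->
  lim_level k e = lim_ratio e i.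
Proof.
move=> ki mini; have lb : lbound [set lim_ratio e j | j in [set j | (k < j)%N]] (lim_ratio e i).
  by move=> _ [j /= kj <-]; have [->//|ji] := eqVneq j i; exact/ltW/mini.
apply/eqP; rewrite eq_le; apply/andP; split.
  by apply: ge_inf; [exists (lim_ratio e i)|exists i].
by apply: lb_le_inf => //; exists (lim_ratio e i), i.
Qed.

Lemma lim_index_strict_min k e i : (k < i)%N ->
  (forall j, (k < j)%N -> j != i -> lim_ratio e i < lim_ratio e j) ->
  lim_index k e = i.
Proof.
move=> ki mini; have Ri := lim_level_strict_min ki mini.
rewrite /lim_index; case: xgetP => [j _ [[kj Rj] _]|/(_ i)] /=.
  by have [//|ji] := eqVneq j i; have := mini j kj ji; rewrite Rj Ri ltxx.
case; split=> // j [kj Rj]; have [//|ji] := eqVneq j i.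
by have := mini j kj ji; rewrite Rj Ri ltxx.
Qed.

(* A limit point of the ratios exceeds one of them, so the infimum is attained. *)
Lemma ratio_gap k e (s : R) j0 : (k < j0)%N -> lim_ratio e j0 < s -> 
  (forall j, 0 < lim_ratio e j.+1) ->
  (\forall j \near \oo, s < lim_ratio e j) ->
  (forall i j, (k < i)%N -> (k < j)%N -> i != j -> lim_ratio e i != lim_ratio e j) ->
  exists (i : nat) (c : R), [/\ (k < i)%N, 1 < c &
    forall j, (k < j)%N -> j != i -> lim_ratio e i * c < lim_ratio e j].
Proof.
move=> kj0 Rs pos [J _ Js] inj.
have R0 j : (k < j)%N -> 0 < lim_ratio e j by case: j.
(* A minimizer over a finite range suffices: from J on, the ratios exceed s and hence the ratio at
   j0. *)
have [i [ki iJ0 mini]] : exists i, [/\ (k < i)%N, (lim_ratio e i <= lim_ratio e j0) &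
    forall j, (k < j < maxn J j0.+1)%N -> lim_ratio e i <= lim_ratio e j].
  elim: (maxn J j0.+1) => [|m [i [ki ij0 mini]]].
    by exists j0; split=> // j; rewrite ltn0 andbF.
  have [km|mk] := ltnP k m; last first.
    exists i; split=> // j /andP[kj]; rewrite ltnS => jm.
    by have := leq_trans kj (leq_trans jm mk); rewrite ltnn.
  have [im|mi] := leP (lim_ratio e i) (lim_ratio e m).
    exists i; split=> // j /andP[kj]; rewrite ltnS leq_eqVlt => /orP[/eqP->//|jm].
    by apply: mini; rewrite kj.
  exists m; split=> //; first exact: le_trans (ltW mi) ij0.
  move=> j /andP[kj]; rewrite ltnS leq_eqVlt => /orP[/eqP->//|jm].
  by apply: le_trans (ltW mi) (mini _ _); rewrite kj.
have Ri := R0 _ ki.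
have {}mini j : (k < j)%N -> j != i -> lim_ratio e i < lim_ratio e j.
  move=> kj ji; rewrite lt_neqAle inj //=; last by rewrite eq_sym.
  have [jJ|jJ] := ltnP j (maxn J j0.+1); first by apply: mini; rewrite kj.
  apply: ltW; apply: le_lt_trans iJ0 (lt_trans Rs (Js j _)).
  by rewrite /=; apply: leq_trans jJ; exact: leq_maxl.
exists i.
(* The factor [c] is the least of finitely many midpoints between 1 and a quotient by the minimal
   ratio: one for s, which handles all j >= J, and one for each other competitor. *)
have [c [c1 cs cj]] : exists c, [/\ 1 < c, lim_ratio e i * c < s &
    forall j, (k < j < J)%N -> j != i -> lim_ratio e i * c < lim_ratio e j].
  elim: J {Js} => [|m [c [c1 cs cj]]].
    have is_ := le_lt_trans iJ0 Rs.
    exists ((1 + s / lim_ratio e i) / 2); split.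
    - by have : 1 < s / lim_ratio e i by [rewrite ltr_pdivlMr // mul1r]; lra.
    - by rewrite mulrA mulrDr mulr1 mulrCA divff ?gt_eqF // mulr1; lra.
    - by move=> j; rewrite ltn0 andbF.
  have [km|mk] := ltnP k m; last first.
    exists c; split=> // j /andP[kj]; rewrite ltnS => jm.
    by have := leq_trans kj (leq_trans jm mk); rewrite ltnn.
  have [mi|mi] := eqVneq m i.
    exists c; split=> // j /andP[kj]; rewrite ltnS leq_eqVlt => /orP[/eqP->|jm].
      by rewrite mi eqxx.
    by apply: cj; rewrite kj.
  have Rim := mini m km mi.
  have q1 : 1 < lim_ratio e m / lim_ratio e i by rewrite ltr_pdivlMr // mul1r.
  pose c' := (1 + lim_ratio e m / lim_ratio e i) / 2.
  have c'1 : 1 < c' by rewrite /c'; lra.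
  have c'm : lim_ratio e i * c' < lim_ratio e m.
    by rewrite /c' mulrA mulrDr mulr1 mulrCA divff ?gt_eqF // mulr1; lra.
  exists (Num.min c c'); split.
  - by rewrite lt_min c1.
  - by apply: le_lt_trans cs; rewrite ler_pM2l // ge_min lexx.
  move=> j /andP[kj]; rewrite ltnS leq_eqVlt => /orP[/eqP->|jm] ji.
    by apply: le_lt_trans c'm; rewrite ler_pM2l // ge_min lexx orbT.
  by apply: le_lt_trans (cj j _ ji); rewrite ?kj // ler_pM2l // ge_min lexx.
exists c; split=> // j kj ji; have [jJ|jJ] := ltnP j J; first by apply: cj; rewrite ?kj.
exact: lt_trans cs (Js j jJ).
Qed.

End levels.

Section perturbation.
Context {R : realType} (n k : nat) (e e' : nat -> R) (c : R).
Hypothesis c1 : 1 < c.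
Hypothesis close : forall j, (k < j < n)%N ->
  lim_ratio e j / c <= lim_ratio e' j <= c * lim_ratio e j.
Hypothesis kn : (k.+1 < n)%N.

Let c0 : 0 < c. Proof. exact: lt_trans c1. Qed.

Let k1 : (k < k.+1 < n)%N. Proof. by rewrite leqnn. Qed.

Lemma level_perturbation : level n k e / c <= level n k e' <= c * level n k e.
Proof.
apply/andP; split.
  have H j : (k < j < n)%N -> level n k e / c <= lim_ratio e' j.
    move=> kj; have /andP[+ _] := close kj; apply: le_trans.
    by rewrite ler_pM2r ?invr_gt0 //; exact: level_le.
  by apply: le_level => //; exact: H.
rewrite mulrC -ler_pdivrMr //.
have H j : (k < j < n)%N -> level n k e' / c <= lim_ratio e j.
  move=> kj; have /andP[_] := close kj; rewrite (ler_pdivrMr _ _ c0) [_ * c]mulrC.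
  by apply: le_trans; exact: level_le.
by apply: le_level => //; exact: H.
Qed.

(** The square appears because the minimal ratio may grow by a factor c while a competitor shrinks
    by the same factor. *)
Lemma windex_perturbation i : (k < i < n)%N ->
  (forall j, (k < j < n)%N -> j != i -> lim_ratio e i * c ^+ 2 < lim_ratio e j) ->
  windex n k e' = i.
Proof.
move=> ki gap; apply: windex_strict_min => // j kj ji.
have /andP[_ h1] := close ki; have /andP[h2 _] := close kj.
apply: le_lt_trans h1 _; apply: lt_le_trans h2.
by rewrite ltr_pdivlMr // mulrAC -expr2 mulrC; exact: gap.
Qed.

End perturbation.

(** * Measurability of levels and indices *)

Section measurability.
Context {R : realType} d {Om : measurableType d} (e : nat -> Om -> R).
Hypothesis me : forall j, measurable_fun setT (e j).
Implicit Types (j k n : nat).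

Let path (w : Om) (j : nat) : R := e j w.

Lemma measurable_lim_ratio j : measurable_fun setT (fun w => lim_ratio (path w) j).
Proof. exact: (measurable_funM (me j) (measurable_funV (me j.+1))). Qed.

Lemma measurable_level n k : measurable_fun setT (fun w => level n k (path w)).
Proof.
rewrite /level; elim: (index_iota _ _) => [|j s IH].
  by under eq_fun do rewrite big_nil; exact: measurable_lim_ratio.
under eq_fun do rewrite big_cons.
by apply: measurable_minr => //; exact: measurable_lim_ratio.
Qed.

Lemma measurable_nat_fun d1 (T1 : measurableType d1) (f : nat -> T1) (X : Om -> nat) :
  measurable_fun setT X -> measurable_fun setT (fun w => f (X w)).
Proof. by move=> mX _ A mA; exact: (mX measurableT (f @^-1` A)). Qed.

Lemma measurable_windex n k : measurable_fun setT (fun w => windex n k (path w)).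
Proof.
rewrite /windex; elim: (index_iota _ _) => [|j s IH].
  by under eq_fun do rewrite big_nil; exact: measurable_cst.
under eq_fun do rewrite big_cons.
apply: measurable_fun_ifT => //; last exact: (measurable_nat_fun (minn j)).
by apply: measurable_fun_eqr; [exact: measurable_lim_ratio|exact: measurable_level].
Qed.

Let measurable_setb (c : Om -> bool) : measurable_fun setT c -> measurable [set w | c w].
Proof. by move=> mc; rewrite -[X in measurable X]setTI; exact: (mc measurableT [set true]). Qed.

(** [inf] is 0 on a set without lower bound, so [lim_level] is below r through some ratio only on
    the event [LB]; off [LB] this amounts to 0 < r. *)
Lemma measurable_lim_level k : measurable_fun setT (fun w => lim_level k (path w)).
Proof.
have R_lt j (r : R) : measurable [set w | lim_ratio (path w) j < r].
  by apply: measurable_setb; apply: measurable_fun_ltr => //; exact: measurable_lim_ratio.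
pose S w := [set lim_ratio (path w) j | j in [set j | (k < j)%N]].
pose LB := \bigcup_m \bigcap_(j in [set j | (k < j)%N]) ~` [set w | lim_ratio (path w) j < - m%:R].
have mLB : measurable LB.
  apply: bigcup_measurable => m _; apply: bigcap_measurable; first by exists k.+1 => /=.
  by move=> j _; exact: measurableC.
have LBP w : LB w <-> has_lbound (S w).
  split=> [[m _ h]|[x lb]].
    exists (- m%:R) => _ [j kj <-]; rewrite leNgt; apply/negP; exact: (h j kj).
  exists (Num.bound `|x|) => // j kj /=; apply/negP; rewrite -leNgt.
  apply: le_trans (lb _ _); last by exists j.
  by have := archi_boundP (normr_ge0 x); have := ler_norm (- x); rewrite normrN; lra.
apply: (measurability _ (RGenInftyO.measurableE R)) => _ [_ [r ->] <-].
rewrite setTI (_ : _ @^-1` _ = (LB `&` \bigcup_(j in [set j | (k < j)%N])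
    [set w | lim_ratio (path w) j < r]) `|` (~` LB `&` [set w | 0 < r])).
  apply: measurableU; apply: measurableI => //.
  - by apply: bigcup_measurable => j _.
  - exact: measurableC.
  - exact: measurable_setb (measurable_cst (0 < r)).
apply/seteqP; split => w; rewrite /= in_itv /=.
  move=> wr; have [lb|nlb] := pselect (has_lbound (S w)); [left|right].
    have hi : has_inf (S w) by split=> //; exists (lim_ratio (path w) k.+1), k.+1 => /=.
    split; first exact/LBP.
    have wr0 : 0 < r - inf (S w) by rewrite subr_gt0.
    have [_ [j kj <-] Rj] := inf_adherent wr0 hi.
    by exists j => //=; rewrite addrC subrK in Rj.
  split; first by move/LBP.
  by rewrite -[0](@inf_out R (S w)) // => -[].
move=> [[/LBP lb [j /= kj Rj]]|[/LBP nlb r0]].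
  by apply: le_lt_trans Rj; apply: ge_inf => //; exists j.
by rewrite /lim_level inf_out // => -[].
Qed.

Lemma measurable_lim_index k : measurable_fun setT (fun w => lim_index k (path w)).
Proof.
pose Q (j : nat) : set Om := [set w | (k < j)%N && (lim_ratio (path w) j == lim_level k (path w))].
have mQ j : measurable (Q j).
  apply: measurable_setb; apply: measurable_and; first exact: measurable_cst.
  by apply: measurable_fun_eqr; [exact: measurable_lim_ratio|exact: measurable_lim_level].
pose U j := Q j `&` \bigcap_(i in [set i | i != j]) ~` Q i.
have mU j : measurable (U j).
  apply: measurableI => //; apply: bigcap_measurable; last by move=> i _; exact: measurableC.
  by exists j.+1; rewrite /= gtn_eqF.
(* Where no unique minimizer exists, the index takes the default value 0. *)
pose V := \bigcap_j ~` U j.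
have mV : measurable V by apply: bigcap_measurable => // j _; exact: measurableC.
have UP w j : U j w <-> unique (fun i => (k < i)%N /\ lim_ratio (path w) i = lim_level k (path w)) j.
  split=> [[/andP[kj /eqP Rj] h]|[[kj Rj] h]].
    split=> // i [ki Ri]; apply/esym/eqP; apply: contrapT => /negP ij.
    by apply: (h i ij); rewrite /Q /= ki Ri eqxx.
  split; first by rewrite /Q /= kj Rj eqxx.
  by move=> i /eqP ij /= /andP[ki /eqP Ri]; apply: ij; rewrite (h i).
move=> _ A _; rewrite setTI (_ : _ @^-1` _ = (\bigcup_(j in A) U j) `|` (if `[<A 0%N>] then V else set0)).
  by apply: measurableU; [apply: bigcup_measurable => j _|case: ifP].
apply/seteqP; split => w.
  rewrite /preimage /= /lim_index; case: xgetP => [j _ /UP Uj Aj|h A0]; first by left; exists j.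
  by right; rewrite asboolT // => j _ /UP; exact: h.
case=> [[j Aj /UP Uj]|].
  rewrite /preimage /= /lim_index; case: xgetP => [i _ Ui|/(_ j)] //.
  by have [_ h] := Uj; have [Qi _] := Ui; rewrite -(h i).
case: asboolP => // A0 Vw; rewrite /preimage /= /lim_index; case: xgetP => // j _ /UP Uj.
by have := Vw j I.
Qed.

End measurability.

(** * Almost sure behaviour of the gamma ratios *)

Section borel_cantelli.
Context {R : realType} d {T : measurableType d} (P : probability T R).

Lemma ae_cvg_geometric (X : nat -> T -> R) (l : R) :
  (forall j, measurable_fun setT (X j)) ->
  (forall rho, 0 < rho < 1 -> exists2 s : R, 0 < s < 1 &
    forall j, (P [set w | rho <= `|X j w - l|]%R <= (2 * s ^+ j)%:E)%E) ->
  {ae P, forall w, X j w @[j --> \oo] --> l}.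
Proof.
move=> mX tail; pose rho (m : nat) : R := m.+2%:R^-1.
have rho01 m : 0 < rho m < 1 by rewrite invr_gt0 ltr0n invf_lt1 ?ltr0n // ltr1n.
pose F m j := [set w | rho m <= `|X j w - l|].
have mF m j : measurable (F m j).
  rewrite -[X in measurable X]setTI.
  have mf : measurable_fun setT (fun w => rho m <= `|X j w - l|).
    apply: measurable_fun_ler => //; apply: measurableT_comp => //.
    by apply: measurable_funB.
  exact: (mf measurableT [set true]).
have limsup0 m : P (lim_sup_set (F m)) = 0%E.
  have [s /andP[s0 s1] tl] := tail _ (rho01 m).
  apply: lim_sup_set_cvg0 => //.
  apply: (@le_lt_trans _ _ (2 * (1 - s)^-1)%:E); last exact: ltry.
  apply: lime_le; first by apply: is_cvg_nneseries => *; exact: measure_ge0.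
  apply: nearW => n; apply: (@le_trans _ _ (\sum_(0 <= j < n) (2 * s ^+ j)%:E)%E).
    by apply: lee_sum => j _; exact: tl.
  rewrite sumEFin lee_fin -big_distrr /= ler_wpM2l //.
  have -> : \sum_(0 <= j < n) s ^+ j = series (geometric 1 s) n.
    by rewrite /series /=; apply: eq_bigr => j _; rewrite mul1r.
  rewrite geometric_seriesE ?lt_eqF //= mul1r -[leRHS]mul1r ler_wpM2r ?invr_ge0 ?subr_ge0 ?(ltW s1) //.
  by rewrite gerBl exprn_ge0 // ltW.
have ae_m m : {ae P, forall w, ~ lim_sup_set (F m) w}.
  exists (lim_sup_set (F m)); split => //; last by move=> w /= /contrapT.
  by apply: bigcap_measurable => // k _; exact: bigcup_measurable.
apply: filterS (ae_foralln ae_m) => w nF.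
apply/cvgrPdist_lt => eps eps0; pose m := Num.bound eps^-1.
have rho_eps : rho m < eps.
  rewrite -[eps]invrK ltf_pV2 ?posrE ?ltr0n ?invr_gt0 //.
  have e1 : eps^-1 < m%:R by apply: archi_boundP; rewrite invr_ge0 ltW.
  by apply: lt_le_trans e1 _; rewrite ler_nat -addn2 leq_addr.
have /existsNP[N /not_implyP[_ hN]] := nF m.
exists N => // j /= Nj; rewrite distrC; apply: lt_trans rho_eps; rewrite ltNge; apply/negP => Fj.
by apply: hN; exists j.
Qed.

End borel_cantelli.

Section gamma_ratios.
Context {R : realType} d {T : measurableType d} (P : probability T R) (eta : nat -> {RV P >-> R}).
Hypothesis ieta : independent_RVs [set i | (1 <= i)%N] eta.
Hypothesis geta : forall i, (1 <= i)%N -> gamma_distributed (i%:R / 2) (eta i).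
Local Notation ratio w := (lim_ratio (fun i => eta i w)).

Lemma ae_gamma_cvg : {ae P, forall w, eta j.+1 w / (j.+1%:R / 2) @[j --> \oo] --> (1 : R)}.
Proof.
apply: (ae_cvg_geometric (X := fun j w => eta j.+1 w / (j.+1%:R / 2))) => [j|rho rho01].
  by apply: measurable_funM => //; exact: measurable_funPT.
have [q /andP[q0 q1] chern] := chernoff rho01.
(* The parameter is (j + 1)/2, so the tail decays like a power of the square root of q. *)
exists (q `^ (1 / 2)) => [|j].
  have one : (1 : R) `^ (1 / 2) = 1 by rewrite powR1.
  rewrite powR_gt0 //= -[X in _ < X]one.
  by apply: gt0_ltr_powR; rewrite ?nnegrE ?ltW //; lra.
apply: le_trans (chern _ _ _ _ _ _ (gamma_law_eta geta _)) _ => //.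
rewrite lee_fin ler_wpM2l // -powR_mulrn ?powR_ge0 // -powRrM.
apply: ger_powR; first by rewrite q0 ltW.
by rewrite -[j.+1%:R]natr1; lra.
Qed.

Lemma ae_ratio_cvg : {ae P, forall w, ratio w j @[j --> \oo] --> (1 : R)}.
Proof.
apply: filterS ae_gamma_cvg => w h.
rewrite -(cvg_shiftS (fun j => ratio w j)) /=.
pose u (j : nat) : R := eta j.+1 w / (j.+1%:R / 2).
have hS : u j.+1 @[j --> \oo] --> (1 : R) by move: h; rewrite -(cvg_shiftS u).
have hh : (harmonic j.+1 : R) @[j --> \oo] --> (0 : R).
  by rewrite (cvg_shiftS (fun j => harmonic j : R)); exact: cvg_harmonic.
(* The last factor is (j + 1)/(j + 2), the quotient of the two normalizations. *)
have lim : u j / u j.+1 * (1 - harmonic j.+1) @[j --> \oo] --> (1 / 1 * (1 - 0) : R).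
  apply: cvgM; first by apply: cvgM h _; apply: cvgV => //; exact: oner_neq0.
  by apply: cvgB; [exact: cvg_cst|exact: hh].
rewrite subr0 divr1 mulr1 in lim.
apply: cvg_trans lim; apply: near_eq_cvg; apply: nearW => j.
rewrite /u /lim_ratio /harmonic /= !invfM !invrK.
have j2 : j.+2%:R != 0 :> R by rewrite pnatr_eq0.
have e1 : 1 - j.+2%:R^-1 = j.+1%:R / j.+2%:R :> R.
  by apply: (mulIf j2); rewrite mulrBl mulVf // divfK // mul1r -[j.+2%:R]natr1 addrK.
rewrite e1; have j1 : j.+1%:R != 0 :> R by rewrite pnatr_eq0.
move: (j.+1%:R : R) (j.+2%:R : R) j1 j2 => x y x0 y0.
have [->|e0] := eqVneq (eta j.+2 w) 0; first by rewrite !(invr0, mul0r, mulr0).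
by field; rewrite e0 x0 y0.
Qed.

Lemma ae_gamma_gt0 : {ae P, forall w j, 0 < eta j.+1 w}.
Proof.
apply: ae_foralln => j; have j0 : 0 < j.+1%:R / 2 :> R by rewrite divr_gt0 ?ltr0n.
exact: gamma_law_gt0 j0 (gamma_law_eta geta (ltn0Sn j)).
Qed.

(** The variable eta_{j+2} has the largest index involved. Given the others, equality of the ratios
    would force a single value on it, and its law has no atoms. *)
Lemma ae_ratio_neq i j : (i < j)%N -> {ae P, forall w, ratio w i.+1 != ratio w j.+1}.
Proof.
move=> ij; pose X (l : 'I_j.+2) w := eta l.+1 w.
have mX l : measurable_fun setT (X l) by exact: (measurable_funPT (eta l.+1)).
have iX : independent_tuple P X.
  have -> : X = subfamily (fun i => (1 <= i)%N) eta (fun l : 'I_j.+2 => l.+1) 0 by [].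
  by apply: independent_subfamily => // l l' /succn_inj /ord_inj.
have i0 : (i < j.+2)%N by rewrite ltnS ltnW // ltnW.
have i1 : (i.+1 < j.+2)%N by rewrite !ltnS ltnW.
have j0 : (j < j.+2)%N by rewrite ltnS ltnW.
pose a : 'I_j.+2 := Ordinal i0; pose b : 'I_j.+2 := Ordinal i1.
pose c : 'I_j.+2 := Ordinal j0; pose z : 'I_j.+2 := ord_max.
pose C (t : j.+2.-tuple R) : bool := [&& 0 < tnth t a, 0 < tnth t b, 0 < tnth t c, 0 < tnth t z
   & tnth t a / tnth t b == tnth t c / tnth t z].
have mtn (l : 'I_j.+2) : measurable_fun setT (fun t : j.+2.-tuple R => tnth t l).
  exact: measurable_tnth.
have mC : measurable_fun setT C.
  do 4! (apply: measurable_and; first exact: measurable_fun_ltr).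
  by apply: measurable_fun_eqr; apply: measurable_funM => //; exact: measurable_funV.
have mS : measurable [set t | C t].
  by rewrite -[Z in measurable Z]setTI; exact: (mC measurableT [set true]).
pose F t : \bar R := (\1_[set t | C t] t)%:E.
have mF : measurable_fun setT F by apply/measurable_EFinP; exact: measurable_indic.
have F0 t : (0 <= F t)%E by rewrite lee_fin.
pose B := [set w | C (tuple_of X w)].
have mB : measurable B.
  by rewrite -[Z in measurable Z]setTI; exact: (measurable_tuple_of mX measurableT mS).
have PB0 : P B = 0%E.
  transitivity (\int[P]_w F (tuple_of X w))%E; first by rewrite -{1}(setIT B) -integral_indic.
  rewrite (ge0_integral_resample mX iX z mF F0) -(integral0 P setT).
  apply: eq_integral => w _.
  (* The solution v of eta_{i+1} / eta_{i+2} = eta_{j+1} / v; positivity is part of [C] to allow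
     this division. *)
  pose r := eta j.+1 w * eta i.+2 w / eta i.+1 w.
  have mr : measurable (eta j.+2 @^-1` [set r]).
    by rewrite -[Z in measurable Z]setTI; apply: measurable_funPT.
  apply/eqP; rewrite eq_le integral_ge0 // andbT.
  have := eta_neq geta r (ltn0Sn j.+1) => <-.
  rewrite -[X in P X](setIT) -integral_indic //.
  apply: ge0_le_integral => //.
  - exact: (measurableT_comp mF (measurable_resample2 mX z w)).
  - by apply/measurable_EFinP; exact: measurable_indic.
  move=> w' _; rewrite lee_fin !indicE; case: (_ \in [set t | C t]) / boolP => // /[!inE].
  rewrite /= /C /resample !tnth_mktuple eqxx !ifN -?val_eqE /= ?ltn_eqF // ?ltnS 1?ltnW //.
  move=> /and5P[a0 b0 c0 z0 /eqP E].
  rewrite mem_set //=; move: a0 b0 c0 z0 E; rewrite /r /X /=.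
  move: (eta i.+1 w) (eta i.+2 w) (eta j.+1 w) (eta j.+2 w') => p q u v p0 q0 u0 v0 E.
  have -> : v = u / (p / q) by rewrite E invfM invrK mulrA divff ?gt_eqF // mul1r.
  by rewrite invfM invrK mulrA mulrAC.
have nB : {ae P, forall w, ~ B w} by exists B; split => // w /= /contrapT.
apply: filterS2 ae_gamma_gt0 nB => w e0 nBw; apply/negP => Rij; apply: nBw.
rewrite /B /C /= !tnth_mktuple /X /= !e0 /=; exact: Rij.
Qed.

Lemma ae_ratio_inj : {ae P, forall w i j, (0 < i)%N -> (0 < j)%N -> i != j -> ratio w i != ratio w j}.
Proof.
have H : {ae P, forall w i j, (i < j)%N -> ratio w i.+1 != ratio w j.+1}.
  apply: ae_foralln => i; apply: ae_foralln => j; have [ij|ij] := boolP (i < j)%N.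
    by apply: filterS (ae_ratio_neq ij) => w h _.
  by apply: aeW.
apply: filterS H => w h [//|i] [//|j] _ _ ij.
have [lt|lt|E] := ltngtP i j; first exact: h.
- by rewrite eq_sym; exact: h.
- by rewrite E eqxx in ij.
Qed.

(* If no ratio beyond k were below 1, eta would be nonincreasing, whereas it grows linearly. *)
Lemma ae_ratio_gap : {ae P, forall w k, exists (i : nat) (c : R), [/\ (k < i)%N, 1 < c &
    forall j, (k < j)%N -> j != i -> ratio w i * c < ratio w j]}.
Proof.
apply: filterS2 (filterI ae_gamma_cvg ae_ratio_cvg) (filterI ae_gamma_gt0 ae_ratio_inj).
move=> w [gc rc] [e0 inj] k.
have [j0 [kj0 Rj0]] : exists j0, (k < j0)%N /\ ratio w j0 < 1.
  apply: contrapT => no.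
  have mono j : (k <= j)%N -> eta j.+1 w <= eta k.+1 w.
    elim: j => [|j IH]; first by rewrite leqn0 => /eqP ->.
    rewrite leq_eqVlt => /orP[/eqP ->//|kj]; apply: le_trans (IH kj).
    have : 1 <= ratio w j.+1 by rewrite leNgt; apply/negP => h; apply: no; exists j.+1.
    by rewrite /lim_ratio ler_pdivlMr // mul1r.
  have : (eta j.+1 w / (j.+1%:R / 2)) @[j --> \oo] --> (0 : R).
    apply: (@squeeze_cvgr _ _ _ _ (cst 0) (fun j => eta k.+1 w * 2 * harmonic j)).
    - near=> j; have kj : (k <= j)%N by near: j; exact: nbhs_infty_ge.
      rewrite divr_ge0 ?(ltW (e0 _)) //= invfM invrK [_^-1 * 2]mulrC mulrA.
      by rewrite ler_wpM2r ?invr_ge0 // ler_wpM2r // mono.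
    - exact: cvg_cst.
    - rewrite -[X in _ --> X](mulr0 (eta k.+1 w * 2)).
      by apply: cvgM; [exact: cvg_cst|exact: cvg_harmonic].
  move=> /(cvg_lim (@Rhausdorff R)) E; move/(cvg_lim (@Rhausdorff R)): gc; rewrite E => /eqP.
  by rewrite eq_sym oner_eq0.
have Rpos j : 0 < ratio w j.+1 by rewrite divr_gt0.
have [i [c [ki c1 gap]]] : exists (i : nat) (c : R), [/\ (k < i)%N, 1 < c &
    forall j, (k < j)%N -> j != i -> ratio w i * c < ratio w j].
  (* The threshold is halfway between the ratio at j0 and the limit 1. *)
  apply: (ratio_gap (s := (1 + ratio w j0) / 2) kj0) => //; first by lra.
    have /cvgrPdist_lt/(_ ((1 - ratio w j0) / 2)) := rc.
    move=> /(_ ltac:(by rewrite divr_gt0 ?subr_gt0)); apply: filterS => j.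
    by rewrite ltr_norml => /andP[_]; lra.
  by move=> a b ka kb; apply: inj; [exact: leq_ltn_trans _ ka|exact: leq_ltn_trans _ kb].
by exists i, c.
Unshelve. all: by end_near.
Qed.

End gamma_ratios.

Section eventual_levels.
Context {R : realType}.
Implicit Types (e : nat -> R) (k : nat).

Lemma eq_level n k e e' : (k.+1 < n)%N -> (forall j, (k < j <= n)%N -> e j = e' j) ->
  level n k e = level n k e'.
Proof.
move=> kn ee'; have eqr j : (k < j < n)%N -> lim_ratio e j = lim_ratio e' j.
  by move=> /andP[kj jn]; rewrite /lim_ratio !ee' // ?kj ?(ltnW jn) // ltnW.
by rewrite /level eqr ?leqnn //; apply: eq_big_nat => j; exact: eqr.
Qed.

Lemma eq_windex n k e e' : (k.+1 < n)%N -> (forall j, (k < j <= n)%N -> e j = e' j) ->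
  windex n k e = windex n k e'.
Proof.
move=> kn ee'; rewrite /windex (eq_level kn ee') big_nat_cond [RHS]big_nat_cond.
apply: eq_bigl => j; case: (boolP (k < j < n)%N) => //= /andP[kj jn].
by rewrite /lim_ratio !ee' // ?kj ?(ltnW jn) // ltnW.
Qed.

Lemma near_level_windex k e (i : nat) (c : R) : (k < i)%N -> 1 < c -> 0 < lim_ratio e i ->
  (forall j, (k < j)%N -> j != i -> lim_ratio e i * c < lim_ratio e j) ->
  \forall n \near \oo, level n k e = lim_level k e /\ windex n k e = lim_index k e.
Proof.
move=> ki c1 Ri gap; exists i.+1 => // n /= i_n.
have strict j : (k < j)%N -> j != i -> lim_ratio e i < lim_ratio e j.
  by move=> kj ji; apply: lt_trans (gap j kj ji); rewrite ltr_pMr.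
have kin : (k < i < n)%N by rewrite ki.
rewrite (level_strict_min kin) => [|j /andP[kj _]]; last exact: strict.
rewrite (windex_strict_min kin) => [|j /andP[kj _]]; last exact: strict.
by rewrite (lim_level_strict_min ki strict) (lim_index_strict_min ki strict).
Qed.

End eventual_levels.

Section uniform_probability.
Context {R : realType} d {T : measurableType d} (P : probability T R).

Lemma Rintegral_indic (S : set T) : measurable S -> \int[P]_w (\1_S w : R) = fine (P S).
Proof. by move=> mS; rewrite /Rintegral integral_indic // setIT. Qed.

(** Turns an almost sure eventual property into a bound uniform in n >= m: the indicator of the
    complement of [V m] tends to 0 almost surely, hence in mean. *)
Lemma eventually_likely (good : nat -> nat -> set T) :
  (forall m n, measurable (good m n)) ->
  {ae P, forall w, \forall m \near \oo, forall n, (m <= n)%N -> good m n w} ->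
  forall eps : R, 0 < eps -> exists m, forall n, (m <= n)%N -> (P (~` good m n) <= eps%:E)%E.
Proof.
move=> mg ae_good eps eps0; pose V m := \bigcap_(n in [set n | (m <= n)%N]) good m n.
have mV m : measurable (V m).
  by apply: bigcap_measurable => [|n _]; [exists m => /=|exact: mg].
have mVC m : measurable (~` V m) by exact: measurableC.
have lim : {ae P, forall w, (\1_(~` V m) w : R) @[m --> \oo] --> (cst 0 w : R)}.
  apply: filterS ae_good => w gw; apply: cvg_near_cst; apply: filterS gw => m gm.
  by rewrite indicE memNset // => /(_ gm).
have : (\int[P]_w (\1_(~` V m) w : R)) @[m --> \oo] --> \int[P]_w (cst 0 w : R).
  apply: (bounded_convergence (C := 1) _ _ lim) => //; first by move=> m; exact: measurable_indic.
  by apply: aeW => w m; rewrite indicE; case: (_ \in _); rewrite ?normr0 ?normr1.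
rewrite Rintegral_cst_prob => /cvgrPdist_lt/(_ _ eps0)[m _ /(_ m (leqnn m))] /=.
rewrite sub0r normrN Rintegral_indic // ger0_norm ?fine_ge0 // => Vm.
exists m => n mn; apply: (@le_trans _ _ (P (~` V m))).
  by apply: le_measure; rewrite ?inE //; [exact: measurableC|move=> w ng Vw; apply/ng/Vw].
by rewrite -[P _]fineK ?lee_fin ?ltW // fin_num_measure.
Qed.

Lemma Rintegral_small (f : T -> R) (S : set T) (M eps : R) :
  measurable_fun setT f -> measurable S -> 0 <= eps -> (forall w, `|f w| <= M) ->
  (forall w, ~ S w -> `|f w| <= eps) -> `|\int[P]_w f w| <= eps + M * fine (P S).
Proof.
move=> mf mS eps0 fM f_eps; have M0 : 0 <= M by apply: le_trans (normr_ge0 _) (fM point).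
have mS1 : measurable_fun setT (fun w => \1_S w : R) by exact: measurable_indic.
have i1 : P.-integrable setT (EFin \o (fun w => M * \1_S w)).
  apply: (@Rintegrable_bounded _ _ _ P _ M); first exact: measurable_funM.
  move=> w; rewrite ger0_norm ?mulr_ge0 // indicE; case: (_ \in _); by rewrite ?mulr1 ?mulr0.
have i2 : P.-integrable setT (EFin \o (fun w => \1_S w : R)).
  by apply: (@Rintegrable_bounded _ _ _ P _ 1) => // w; rewrite indicE; case: (_ \in _); rewrite ?normr0 ?normr1.
have i3 : P.-integrable setT (EFin \o cst eps).
  by apply: (@Rintegrable_bounded _ _ _ P _ `|eps|).
have if_ : P.-integrable setT (EFin \o f) by exact: (@Rintegrable_bounded _ _ _ P _ M).
apply: le_trans (le_normr_Rintegral _ if_) _ => //.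
have <- : \int[P]_w (cst eps w + M * \1_S w) = eps + M * fine (P S).
  by rewrite RintegralD // RintegralZl // Rintegral_indic // Rintegral_cst_prob.
apply: le_Rintegral => //.
- by apply: (@Rintegrable_bounded _ _ _ P _ M) => [|w]; [exact: measurableT_comp|rewrite normr_id].
- exact: (integrableD _ i3 i1).
move=> w _; rewrite /= indicE; case: (boolP (w \in S)) => [_|]; first by rewrite mulr1 ler_wpDl.
by rewrite notin_setE mulr0 addr0; exact: f_eps.
Qed.

End uniform_probability.

(** * Coupling with the gamma variables *)

Lemma measurable_exists_ord d (T : measurableType d) (N : nat) (S : 'I_N -> set T) :
  (forall i, measurable (S i)) -> measurable [set w | exists i, S i w].
Proof.
move=> mS; rewrite (_ : [set w | _] = \bigcup_(i in [set: 'I_N]) S i).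
  by apply: fin_bigcup_measurable => //; exact: finite_finset.
by apply/seteqP; split => w [i]; [exists i|move=> _ Si; exists i].
Qed.

Lemma union_bound (R : realType) d (T : measurableType d) (P : probability T R) (N : nat)
    (S : 'I_N -> set T) (p : R) :
  (forall i, measurable (S i)) -> (forall i, (P (S i) <= p%:E)%E) ->
  (P [set w | exists i, S i w] <= (N%:R * p)%:E)%E.
Proof.
move=> mS Sp; rewrite (_ : [set w | _] = \big[setU/set0]_(i < N) S i); last first.
  rewrite -(bigcup_seq (index_enum 'I_N)); apply/seteqP; split => w.
    by move=> [i Si]; exists i => //=; rewrite mem_index_enum.
  by move=> [i _ Si]; exists i.
have [_ +] : measurable (\big[setU/set0]_(i < N) S i) /\
    (P (\big[setU/set0]_(i < N) S i) <= \sum_(i < N) p%:E)%E.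
  apply: (big_ind2 (fun A (x : \bar R) => measurable A /\ (P A <= x)%E)).
  - by rewrite measure0.
  - move=> A x B y [mA Ax] [mB By]; split; first exact: measurableU.
    by apply: le_trans (measureU2 _ mA mB) _; exact: leeD.
  - by move=> i _.
by rewrite sumEFin sumr_const card_ord mulr_natl.
Qed.

Lemma scaled_ratio (F : fieldType) (k x1 y1 x2 y2 z1 z2 : F) : k != 0 ->
  k * (x1 / y1) * z1 / (k * (x2 / y2) * z2) = x1 * y2 / (x2 * y1) * (z1 / z2).
Proof.
move=> k0; rewrite !invfM !invrK.
rewrite -[RHS]mul1r -(divff k0).
by move: k^-1 y1^-1 x2^-1 z2^-1 => k' y1' x2' z2'; ring.
Qed.

(** The condition on rho says exactly that (1 + rho)^2 <= c (1 - rho)^2. *)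
Lemma near_one_product (F : realFieldType) (c rho x1 y1 x2 y2 : F) :
  1 < c -> 0 < rho -> 0 < 1 - rho -> 4 * rho <= (c - 1) * (1 - rho) ^+ 2 ->
  1 - rho < x1 -> 1 - rho < y1 -> x2 < 1 + rho -> y2 < 1 + rho ->
  1 - rho < x2 -> 1 - rho < y2 -> x2 * y2 <= c * (x1 * y1).
Proof.
move=> c1 r0 r1 rc h1 h2 h3 h4 h5 h6.
have A : x2 * y2 <= (1 + rho) ^+ 2 by rewrite expr2; apply: ler_pM; lra.
have B : (1 - rho) ^+ 2 <= x1 * y1 by rewrite expr2; apply: ler_pM; lra.
have c0 : 0 <= c by lra.
apply: le_trans A _; apply: le_trans (ler_wpM2l c0 B).
have -> : (1 + rho) ^+ 2 = (1 - rho) ^+ 2 + 4 * rho by ring.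
by rewrite -lerBrDl; apply: le_trans rc _; rewrite mulrBl mul1r.
Qed.

Section coupling.
Context {R : realType} {n : nat} (n0 : (0 < n)%N) (nu : probability 'rV[R]_n R).
Hypothesis nu_inv : forall (U : 'M[R]_n) (A : set 'rV[R]_n),
  rotation U -> measurable A -> nu [set x | A (x *m U)] = nu A.
Hypothesis nu0 : nu [set 0] = 0%E.
Context (g : nat) d {Om : measurableType d} (P : probability Om R) (b : nat -> {RV P >-> 'rV[R]_n}).
Hypothesis basis : random_basis nu g b.
Context d' {T' : measurableType d'} (P' : probability T' R) (eta : nat -> {RV P' >-> R}).
Hypothesis ieta : independent_RVs [set i | (1 <= i)%N] eta.
Hypothesis geta : forall i, (1 <= i)%N -> gamma_distributed (i%:R / 2) (eta i).
Hypothesis gn : (g.+1 < n)%N.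

Local Notation N := (n - g)%N.
Let P2 : probability (T' * T')%type R := (P' \x P')%E.
Let PP : probability (Om * (T' * T'))%type R := (P \x P2)%E.

(** Tuples are listed in Gram-Schmidt order, so entry i carries the index j = n - i; the meaningful
    range is g < j <= n. *)
Definition tuple_path (t : N.-tuple R) (j : nat) : R := nth 0 t (n - j).

Definition gs_path (w : Om) (j : nat) : R := sqnorm (gs (fun i => b i w) (n.+1 - j)).

Lemma gs_ratio_path w j : (j <= n)%N -> gs_ratio (fun i => b i w) j = lim_ratio (gs_path w) j.
Proof. by move=> jn; rewrite /gs_ratio /lim_ratio /gs_path subSn // subSS. Qed.

Lemma reduction_level_path w : reduction_level g (fun i => b i w) = level n g (gs_path w).
Proof.
rewrite /reduction_level /level gs_ratio_path ?(ltnW gn) //.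
by apply: eq_big_nat => j /andP[_ jn]; rewrite gs_ratio_path // ltnW.
Qed.

Lemma worst_index_path w : worst_index g (fun i => b i w) = windex n g (gs_path w).
Proof.
rewrite /worst_index /windex reduction_level_path big_nat_cond [RHS]big_nat_cond.
apply: eq_bigl => j; case: (boolP (g < j < n)%N) => //= /andP[_ jn].
by rewrite gs_ratio_path // ltnW.
Qed.

Lemma measurable_gs_path j : measurable_fun setT (fun w => gs_path w j).
Proof.
apply: measurable_sqnorm => c; apply: measurable_gs => i c'.
exact: (measurableT_comp (measurable_coord c') (measurable_funPT (b i))).
Qed.

Lemma measurable_tuple_path j : measurable_fun setT (fun t => tuple_path t j).
Proof.
rewrite /tuple_path; have [jN|jN] := ltnP (n - j) N.
  under eq_fun do rewrite -[(n - j)%N]/(val (Ordinal jN)) -tnth_nth.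
  exact: measurable_tnth.
under eq_fun do rewrite nth_default ?size_tuple //.
exact: measurable_cst.
Qed.

Definition eta_tuple (w : T') : N.-tuple R := [tuple eta (n - i)%N w | i < N].

Lemma eta_path w j : (g < j <= n)%N -> tuple_path (eta_tuple w) j = eta j w.
Proof.
move=> /andP[gj jn]; have jN : (n - j < N)%N by rewrite ltn_sub2l // (leq_trans gj).
by rewrite /tuple_path -[(n - j)%N]/(val (Ordinal jN)) -tnth_nth tnth_mktuple /= subKn.
Qed.

Definition close_ratios (c : R) (e e' : nat -> R) := forall j, (g < j < n)%N ->
  0 <= lim_ratio e j /\ lim_ratio e j / c <= lim_ratio e' j <= c * lim_ratio e j.

Variables (a rho p : R).
Hypothesis rho01 : 0 < rho < 1.

Definition deviant : set (Om * (T' * T')) :=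
  [set ww | exists i : 'I_N, rho <= `|sqnorm (b i.+1 ww.1) / a - 1|] `|`
  [set ww | exists i : 'I_N, rho <= `|gamma_sum eta (gs_index i) ww.2 / (n%:R / 2) - 1|].

Let measurable_dev d1 (T1 : measurableType d1) (f : T1 -> R) (r : R) : measurable_fun setT f ->
  measurable [set w | rho <= `|f w / r - 1|].
Proof.
move=> mf; rewrite -[X in measurable X]setTI.
have m1 : measurable_fun setT (fun w => rho <= `|f w / r - 1|).
  apply: measurable_fun_ler => //; apply: measurableT_comp => //.
  by apply: measurable_funB => //; exact: measurable_funM.
exact: (m1 measurableT [set true]).
Qed.

Let msq i : measurable_fun setT (fun w => sqnorm (b i w)).
Proof.
apply: measurable_sqnorm => c.
exact: (measurableT_comp (measurable_coord c) (measurable_funPT (b i))).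
Qed.

Let mdev1 (i : 'I_N) : measurable [set ww : Om * (T' * T') | rho <= `|sqnorm (b i.+1 ww.1) / a - 1|].
Proof. exact: (measurable_dev _ (measurableT_comp (msq i.+1) measurable_fst)). Qed.

Let mdev2 (i : 'I_N) : measurable
  [set ww : Om * (T' * T') | rho <= `|gamma_sum eta (gs_index i) ww.2 / (n%:R / 2) - 1|].
Proof.
exact: (measurable_dev _ (measurableT_comp (measurable_gamma_sum eta (gs_index i)) measurable_snd)).
Qed.

Lemma measurable_deviant : measurable deviant.
Proof.
by apply: measurableU; exact: measurable_exists_ord.
Qed.

Lemma deviant_bound (q1 q2 : R) :
  (nu [set x | rho <= `|sqnorm x / a - 1|]%R <= q1%:E)%E ->
  (forall i : 'I_n, (P2 [set ww | rho <= `|gamma_sum eta i ww / (n%:R / 2) - 1|]%R <= q2%:E)%E) ->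
  (PP deviant <= (n%:R * (q1 + q2))%:E)%E.
Proof.
move=> h1 h2; have NR : N%:R <= n%:R :> R by rewrite ler_nat leq_subr.
have q10 : 0 <= q1 by rewrite -lee_fin; apply: le_trans h1.
have q20 : 0 <= q2 by rewrite -lee_fin; apply: le_trans (h2 (Ordinal n0)).
apply: le_trans (measureU2 _ (measurable_exists_ord mdev1) (measurable_exists_ord mdev2)) _.
rewrite mulrDr EFinD; apply: leeD.
  apply: (@le_trans _ _ (N%:R * q1)%:E); last by rewrite lee_fin ler_wpM2r.
  apply: union_bound => // i; have [_ law] := basis.
  pose S := [set x : 'rV[R]_n | rho <= `|sqnorm x / a - 1|].
  have mS : measurable S by apply: measurable_dev; apply: measurable_sqnorm => c; exact: measurable_coord.
  have mbS : measurable (b i.+1 @^-1` S) by rewrite -[X in measurable X]setTI; apply: measurable_funPT.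
  rewrite (_ : [set ww | _] = (b i.+1 @^-1` S) `*` setT); last first.
    by apply/seteqP; split => ww //= [].
  rewrite [leLHS](product_measure1E P P2 mbS measurableT) [X in (_ * X)%E](probability_setT P2 : _ = 1%E) mule1.
  have iN : (1 <= i.+1 <= N)%N by rewrite /= ltn_ord.
  have E : P (b i.+1 @^-1` S) = nu S by exact: (law i.+1 iN S mS).
  by rewrite [leLHS]E.
apply: (@le_trans _ _ (N%:R * q2)%:E); last by rewrite lee_fin ler_wpM2r.
apply: union_bound => // i.
pose S := [set ww | rho <= `|gamma_sum eta (gs_index i) ww / (n%:R / 2) - 1|].
have mS : measurable S by apply: measurable_dev; exact: measurable_gamma_sum.
rewrite (_ : [set ww | _] = setT `*` S); last by apply/seteqP; split => ww //= [].
rewrite [leLHS](product_measure1E P P2 measurableT mS) [X in (X * _)%E](probability_setT P : _ = 1%E) mul1e.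
exact: h2.
Qed.

Definition zeta_tuple ww : N.-tuple R := [tuple zeta b eta i ww | i < N].

Lemma zeta_path ww j (jN : (n - j < N)%N) :
  tuple_path (zeta_tuple ww) j = zeta b eta (Ordinal jN) ww.
Proof. by rewrite /tuple_path -[(n - j)%N]/(val (Ordinal jN)) -tnth_nth tnth_mktuple. Qed.

(** Each Gram-Schmidt norm is the corresponding [zeta] times k u_i / v_i, with normalized norm u_i
    and normalized gamma factor v_i. The common scale k cancels in the ratios, which leaves a
    product of quotients close to 1. *)
Lemma close_coupling c ww : 1 < c -> 4 * rho <= (c - 1) * (1 - rho) ^+ 2 -> ~ deviant ww ->
  close_ratios c (tuple_path (zeta_tuple ww)) (gs_path ww.1).
Proof.
move=> c1 rc ndev; have /andP[r0 r1] := rho01; have c0 : 0 < c by apply: lt_trans c1.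
have h0 : 0 < n%:R / 2 :> R by rewrite divr_gt0 ?ltr0n.
pose u (i : 'I_N) : R := sqnorm (b i.+1 ww.1) / a.
pose v (i : 'I_N) : R := gamma_sum eta (gs_index i) ww.2 / (n%:R / 2).
have near1 (x : R) : ~~ (rho <= `|x - 1|) -> 1 - rho < x < 1 + rho.
  by rewrite -ltNge ltr_norml => /andP[h1 h2]; apply/andP; split; lra.
have uP (i : 'I_N) : 1 - rho < u i < 1 + rho.
  by apply: near1; apply/negP => h; apply: ndev; left; exists i.
have vP (i : 'I_N) : 1 - rho < v i < 1 + rho.
  by apply: near1; apply/negP => h; apply: ndev; right; exists i.
have a0 (i : 'I_N) : a != 0.
  apply/eqP => a0; have /andP[h _] := uP i.
  by move: h; rewrite /u a0 invr0 mulr0 subr_lt0 ltNge (ltW r1).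
have Hpos (i : 'I_N) : 0 < gamma_sum eta (gs_index i) ww.2.
  have /andP[h _] := vP i; rewrite -(divfK (lt0r_neq0 h0) (gamma_sum _ _ _)) mulr_gt0 //.
  by apply: lt_trans h; rewrite subr_gt0.
have zeta_ge0 (i : 'I_N) : 0 <= zeta b eta i ww by rewrite mulr_ge0 ?frac_ge0 // ltW.
have idx j : (g < j <= n)%N -> (n - j < N)%N.
  by move=> /andP[gj jn]; rewrite ltn_sub2l // (leq_trans gj).
pose k : R := a / (n%:R / 2).
have pathE j (gj : (g < j <= n)%N) : gs_path ww.1 j =
    k * (u (Ordinal (idx j gj)) / v (Ordinal (idx j gj))) * tuple_path (zeta_tuple ww) j.
  have /andP[_ jn] := gj.
  have -> : gs_path ww.1 j = sqnorm (gs (fun i => b i ww.1) (Ordinal (idx j gj)).+1).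
    by rewrite /gs_path subSn.
  rewrite (sqnorm_gs_zeta b ww.1 (Hpos _)) (zeta_path _ (idx j gj)) -surjective_pairing.
  congr (_ * _); rewrite /u /v /k.
  move: (sqnorm _) (gamma_sum _ _ _) (lt0r_neq0 (Hpos (Ordinal (idx j gj)))) => x y y0.
  by field; rewrite (a0 (Ordinal (idx j gj))) y0 pnatr_eq0 -lt0n n0.
move=> j /andP[gj jn].
have gj1 : (g < j <= n)%N by rewrite gj ltnW.
have gj2 : (g < j.+1 <= n)%N by rewrite ltnW.
set e := tuple_path _.
have e0 i : (g < i <= n)%N -> 0 <= e i by move=> gi; rewrite /e (zeta_path _ (idx _ gi)).
have re0 : 0 <= lim_ratio e j by rewrite divr_ge0 ?e0.
split=> //.
set i1 := Ordinal (idx _ gj1); set i2 := Ordinal (idx _ gj2).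
have k0 : k != 0 by rewrite mulf_neq0 ?(a0 i1) // invr_neq0 // lt0r_neq0.
have -> : lim_ratio (gs_path ww.1) j = (u i1 * v i2) / (u i2 * v i1) * lim_ratio e j.
  rewrite /lim_ratio (pathE _ gj1) (pathE _ gj2) -/e -/i1 -/i2.
  exact: scaled_ratio.
have /andP[u1l u1r] := uP i1; have /andP[u2l u2r] := uP i2.
have /andP[v1l v1r] := vP i1; have /andP[v2l v2r] := vP i2.
have r1' : 0 < 1 - rho by rewrite subr_gt0.
have key := near_one_product c1 r0 r1' rc.
have pos (x y : R) : 1 - rho < x -> 1 - rho < y -> 0 < x * y.
  by move=> h1 h2; apply: mulr_gt0; [exact: lt_trans h1|exact: lt_trans h2].
apply/andP; split.
  rewrite mulrC ler_wpM2r // ler_pdivlMr ?pos // mulrC ler_pdivrMr // [_ * c]mulrC.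
  exact: key.
by rewrite ler_wpM2r // ler_pdivrMr ?pos //; exact: key.
Qed.

Lemma measurable_zeta_tuple : measurable_fun setT zeta_tuple.
Proof. by apply: measurable_tuple_of => i; exact: measurable_zeta. Qed.

Lemma measurable_eta_tuple : measurable_fun setT eta_tuple.
Proof.
by apply: (measurable_tuple_of (X := fun (i : 'I_N) w => eta (n - i)%N w)) => i; exact: measurable_funPT.
Qed.

(** Both integrals are moved to the product space, where [zeta_tuple] has the law of [eta_tuple].
    There the integrands differ by at most eps off [deviant] and [Bad], and by at most 2 C
    elsewhere. *)
Lemma coupling_transfer c (A : Om -> R) (B : N.-tuple R -> R) (Bad : set (N.-tuple R)) (C eps s : R) :
  1 < c -> 4 * rho <= (c - 1) * (1 - rho) ^+ 2 ->
  (PP deviant <= p%:E)%E -> (P' (eta_tuple @^-1` Bad) <= s%:E)%E ->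
  measurable_fun setT A -> measurable_fun setT B -> measurable Bad ->
  (forall w, `|A w| <= C) -> (forall t, `|B t| <= C) -> 0 <= eps ->
  (forall w t, close_ratios c (tuple_path t) (gs_path w) -> ~ Bad t -> `|A w - B t| <= eps) ->
  `|\int[P]_w A w - \int[P']_w B (eta_tuple w)| <= eps + 2 * C * (p + s).
Proof.
move=> c1 rc dev_p bad_s mA mB mBad AC BC eps0 AB.
have C0 : 0 <= C by apply: le_trans (normr_ge0 _) (AC point).
have zlaw (E : set (N.-tuple R)) : measurable E -> PP (zeta_tuple @^-1` E) = P' (eta_tuple @^-1` E).
  by move=> mE; exact: (zeta_law n0 nu_inv nu0 basis ieta geta mE).
have mz := measurable_zeta_tuple; have me := measurable_eta_tuple.
have intA : \int[P]_w A w = \int[PP]_ww A ww.1.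
  pose Y : {RV PP >-> Om} := RV_of PP (measurable_fst : measurable_fun setT (@fst Om (T' * T'))).
  rewrite /Rintegral; congr fine.
  transitivity (\int[distribution PP Y]_w (A w)%:E)%E.
    apply: eq_measure_integral => E mE _.
    transitivity (PP (E `*` setT)).
      rewrite [RHS](product_measure1E P P2 mE measurableT).
      by rewrite [X in (_ * X)%E](probability_setT P2 : _ = 1%E) mule1.
    by congr (PP _); apply/seteqP; split => ww //= [].
  rewrite integral_distribution //; first exact/measurable_EFinP.
  apply: (@Rintegrable_bounded _ _ _ PP (A \o fst) C) => [|w]; last exact: AC.
  exact: measurableT_comp mA measurable_fst.
have intB : \int[P']_w B (eta_tuple w) = \int[PP]_ww B (zeta_tuple ww).
  pose Y1 : {RV P' >-> N.-tuple R} := RV_of P' me.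
  pose Y2 : {RV PP >-> N.-tuple R} := RV_of PP mz.
  rewrite /Rintegral; congr fine.
  transitivity (\int[distribution P' Y1]_t (B t)%:E)%E.
    rewrite integral_distribution //; first exact/measurable_EFinP.
    by apply: (@Rintegrable_bounded _ _ _ P' (B \o eta_tuple) C) => [|w]; [exact: measurableT_comp|exact: BC].
  transitivity (\int[distribution PP Y2]_t (B t)%:E)%E.
    by apply: eq_measure_integral => E mE _; apply/esym; exact: zlaw.
  rewrite integral_distribution //; first exact/measurable_EFinP.
  by apply: (@Rintegrable_bounded _ _ _ PP (B \o zeta_tuple) C) => [|w]; [exact: measurableT_comp|exact: BC].
have mA1 : measurable_fun setT (fun ww : Om * (T' * T') => A ww.1) by exact: measurableT_comp mA measurable_fst.
have mB1 : measurable_fun setT (fun ww => B (zeta_tuple ww)) by exact: measurableT_comp mB mz.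
have iA : PP.-integrable setT (EFin \o (fun ww => A ww.1)) by apply: (@Rintegrable_bounded _ _ _ PP _ C).
have iB : PP.-integrable setT (EFin \o (fun ww => B (zeta_tuple ww))).
  by apply: (@Rintegrable_bounded _ _ _ PP _ C).
rewrite intA intB -RintegralB //.
pose S := deviant `|` zeta_tuple @^-1` Bad.
have mzB : measurable (zeta_tuple @^-1` Bad) by rewrite -[X in measurable X]setTI; exact: mz.
have mS : measurable S by apply: measurableU => //; exact: measurable_deviant.
have PS : fine (PP S) <= p + s.
  rewrite -lee_fin fineK ?fin_num_measure //.
  apply: le_trans (measureU2 _ measurable_deviant mzB) _.
  by rewrite EFinD; apply: leeD => //; rewrite [leLHS](zlaw _ mBad).
apply: (@le_trans _ _ (eps + 2 * C * fine (PP S))); last by rewrite lerD2l ler_wpM2l // mulr_ge0.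
apply: Rintegral_small => // [|ww|ww nS].
- exact: measurable_funB.
- by apply: le_trans (ler_normB _ _) _; rewrite mulr2n mulrDl mul1r lerD.
- apply: AB => [|badt]; last by apply: nS; right.
  by apply: close_coupling => // dev; apply: nS; left.
Qed.

End coupling.

Lemma cvg_mul_exp_powR (R : realType) (d1 e q : R) : 0 < e -> 0 < q < 1 ->
  (n%:R * (d1 * expR (- (n%:R * e)) + 2 * q `^ (n%:R / 2))) @[n --> \oo] --> (0 : R).
Proof.
move=> e0 /andP[q0 q1]; pose e' := - ln q / 2.
have e'0 : 0 < e' by rewrite divr_gt0 // oppr_gt0 ln_lt0 // q0.
have E n : n%:R * (d1 * expR (- (n%:R * e)) + 2 * q `^ (n%:R / 2)) =
    d1 * (n%:R * expR (- (n%:R * e))) + 2 * (n%:R * expR (- (n%:R * e'))).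
  rewrite /powR gt_eqF // (_ : n%:R / 2 * ln q = - (n%:R * e')); last by rewrite /e'; field.
  by rewrite mulrDr; congr (_ + _); rewrite mulrCA.
under eq_fun do rewrite E.
have lim : (d1 * (n%:R * expR (- (n%:R * e))) + 2 * (n%:R * expR (- (n%:R * e')))) @[n --> \oo]
    --> (d1 * 0 + 2 * 0 : R).
  by apply: cvgD; (apply: cvgM; [exact: cvg_cst|exact: expR_mulN_cvg0]).
by rewrite !mulr0 addr0 in lim.
Qed.

(** Only x is confined to the segment; y may leave it, as the perturbed level can. *)
Lemma uniform_at_compact (R : realType) (f : R -> R) (m eps : R) : continuous f -> 0 < eps ->
  exists2 del : R, 0 < del & forall x y, 0 <= x <= m -> `|y - x| <= del -> `|f y - f x| <= eps.
Proof.
move=> cf eps0.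
have /compact_near_coveringP/(_ R (0^'+) (fun del x => forall y, `|y - x| <= del -> `|f y - f x| <= eps)) :=
  @segment_compact R 0 m.
have cov : forall x, `[0, m]%classic x -> \forall x' \near x & del \near 0^'+,
    forall y, `|y - x'| <= del -> `|f y - f x'| <= eps.
  move=> x _; have eps2 : 0 < eps / 2 by rewrite divr_gt0.
  have /cvgrPdist_lt/(_ _ eps2)/nbhs_ballP[r /= r0 hr] := cf x.
  have r2 : 0 < r / 2 by rewrite divr_gt0.
  exists (ball x (r / 2), [set del | del < r / 2]).
    split; first exact: nbhsx_ballx.
    exact: nbhs_right_lt.
  move=> [x' del] [/= bx' del_r] y yx'.
  have h1 : `|f x - f x'| < eps / 2.
    by apply: hr; rewrite /ball /= in bx' *; lra.
  have h2 : `|f x - f y| < eps / 2.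
    apply: hr; rewrite /ball /= in bx' *.
    have := ler_distD x' x y; rewrite (distrC x' y); lra.
  have := ler_distD (f x) (f y) (f x'); rewrite (distrC (f y) (f x)); lra.
move=> /(_ _ cov) near_del.
have [del [del0 h]] : exists del : R, 0 < del /\ `[0, m]%classic `<=`
    (fun x => forall y, `|y - x| <= del -> `|f y - f x| <= eps).
  have := @filter_ex _ (0 : R)^'+ _ _ (filterI (nbhs_right_gt 0) near_del).
  by move=> [del [del0 h]]; exists del.
by exists del => // x y x0m; apply: h; rewrite /= in_itv.
Qed.

Lemma expectation_bounded (R : realType) d (T : measurableType d) (P : probability T R) (X : T -> R) (C : R) :
  measurable_fun setT X -> (forall w, `|X w| <= C) -> ('E_P[X] = (\int[P]_w X w)%:E)%E.
Proof.
move=> mX XC; have iX : P.-integrable setT (EFin \o X) by exact: (Rintegrable_bounded P mX XC).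
by rewrite unlock /Rintegral fineK //; exact: integrable_fin_num.
Qed.

(** From rho <= 1/2 one gets (1 - rho)^2 >= 1/4, so rho <= (c - 1)/16 is enough. *)
Lemma closeness_radius (R : realFieldType) (c rho0 : R) : 1 < c -> 0 < rho0 ->
  exists rho : R, [/\ 0 < rho < 1, rho < rho0 & 4 * rho <= (c - 1) * (1 - rho) ^+ 2].
Proof.
move=> c1 r0; pose rho := Num.min (Num.min ((c - 1) / 16) (1 / 2)) (rho0 / 2).
have h1 : rho <= (c - 1) / 16 by rewrite /rho !ge_min lexx.
have h2 : rho <= 1 / 2 by rewrite /rho !ge_min lexx orbT.
have h3 : rho <= rho0 / 2 by rewrite /rho !ge_min lexx !orbT.
have h0 : 0 < rho by rewrite /rho !lt_min !divr_gt0 // subr_gt0.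
exists rho; split; [by rewrite h0; lra|lra|].
have h4 : 1 / 4 <= (1 - rho) ^+ 2 by nra.
have c0 : 0 <= c - 1 by lra.
by have := ler_wpM2l c0 h4; lra.
Qed.

(** * Transfer of functionals from the gamma variables to random bases *)

Section transfer.
Context {R : realType} (nu : forall n : nat, probability 'rV[R]_n R).
Context (a : nat -> R) (d1 d2 alpha rho0 : R).
Context d' {T' : measurableType d'} (P' : probability T' R) (eta : nat -> {RV P' >-> R}).
Hypothesis model : spherical_model nu.
Hypotheses (d20 : 0 < d2) (rho00 : 0 < rho0).
Hypothesis concentration : forall (n : nat) (rho : R), (1 <= n)%N -> 0 < rho < rho0 ->
  (nu n [set x : 'rV[R]_n | rho <= `|sqnorm x / a n - 1|]%R
   <= (d1 * expR (- (n%:R * d2 * rho `^ alpha)))%:E)%E.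
Hypothesis ieta : independent_RVs [set i | (1 <= i)%N] eta.
Hypothesis geta : forall i, (1 <= i)%N -> gamma_distributed (i%:R / 2) (eta i).

(** The threshold precedes the codimension and the functionals, so that both may vary with n. The
    union bound costs a factor n, which the exponential tails absorb. *)
Lemma transfer_eventually (c C eps s : R) : 1 < c -> 0 <= eps -> 0 < s -> exists M, forall n g,
  (M <= n)%N -> (g < n)%N ->
  forall d (Om : measurableType d) (P : probability Om R) (b : nat -> {RV P >-> 'rV[R]_n}),
  random_basis (nu n) g b ->
  forall (A : Om -> R) (B : (n - g).-tuple R -> R) (Bad : set ((n - g).-tuple R)),
  (P' (eta_tuple (n := n) g eta @^-1` Bad) <= s%:E)%E ->
  measurable_fun setT A -> measurable_fun setT B -> measurable Bad ->
  (forall w, `|A w| <= C) -> (forall t, `|B t| <= C) ->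
  (forall w t, close_ratios (n := n) g c (tuple_path t) (gs_path b w) -> ~ Bad t -> `|A w - B t| <= eps) ->
  `|\int[P]_w A w - \int[P']_w B (eta_tuple (n := n) g eta w)| <= eps + 2 * C * (s + s).
Proof.
move=> c1 eps0 s0; have [rho [rho01 rho_lt rc]] := closeness_radius c1 rho00.
have /andP[r0 r1] := rho01.
have [q q01 chern] := chernoff rho01.
have e0 : 0 < d2 * rho `^ alpha by rewrite mulr_gt0 // powR_gt0.
have /cvgrPdist_lt/(_ _ s0)[M _ hM] := cvg_mul_exp_powR d1 e0 q01.
exists M => n g Mn gn d Om P b basis A B Bad bad_s mA mB mBad AC BC AB.
have n0 : (0 < n)%N by exact: leq_trans gn.
have [nu0 nu_inv] := model n0.
have dev : ((P \x (P' \x P')) (deviant g b eta (a n) rho) <= s%:E)%E.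
  apply: le_trans (deviant_bound n0 basis (q1 := d1 * expR (- (n%:R * (d2 * rho `^ alpha))))
    (q2 := 2 * q `^ (n%:R / 2)) _ _) _.
  - by rewrite mulrA; apply: concentration => //; rewrite r0.
  - move=> i; apply: chern; first by rewrite divr_gt0 ?ltr0n.
    exact: gamma_law_sum.
  - by rewrite lee_fin; have := hM n Mn; rewrite sub0r normrN => /ltW; apply: le_trans (ler_norm _).
exact: (coupling_transfer n0 nu_inv nu0 basis ieta geta rho01 c1 rc dev bad_s mA mB mBad AC BC eps0 AB).
Qed.

Section functionals.
Context (k : nat) (Lam : nat -> (nat -> R) -> R) (Linf : (nat -> R) -> R) (C : R).
Local Notation eta_ w := (fun j => eta j w).
Hypothesis Lam_le : forall n e, `|Lam n e| <= C.
Hypothesis Linf_le : forall e, `|Linf e| <= C.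
Hypothesis mLam : forall n d (Om : measurableType d) (e : nat -> Om -> R),
  (forall j, measurable_fun setT (e j)) -> measurable_fun setT (fun w => Lam n (fun j => e j w)).
Hypothesis mLinf : measurable_fun setT (fun w => Linf (eta_ w)).
Hypothesis eq_Lam : forall n e e', (k.+1 < n)%N ->
  (forall j, (k < j <= n)%N -> e j = e' j) -> Lam n e = Lam n e'.
Hypothesis Lam_cvg : {ae P', forall w, \forall n \near \oo, Lam n (eta_ w) = Linf (eta_ w)}.
Hypothesis stable : forall eps : R, 0 < eps -> exists good : nat -> nat -> (nat -> R) -> Prop,
  [/\ (forall m n d (Om : measurableType d) (e : nat -> Om -> R),
        (forall j, measurable_fun setT (e j)) -> measurable [set w | good m n (fun j => e j w)]),
      (forall m n e e', (k.+1 < n)%N -> (forall j, (k < j <= n)%N -> e j = e' j) ->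
        good m n e -> good m n e'),
      {ae P', forall w, \forall m \near \oo, forall n, (m <= n)%N -> good m n (eta_ w)} &
      forall m, exists2 c : R, 1 < c & forall n e e', (k.+1 < n)%N ->
        close_ratios (n := n) k c e e' -> good m n e -> `|Lam n e' - Lam n e| <= eps].

(** The order of choices matters: m makes [good m n] likely for all n >= m at once, then [stable]
    yields a tolerance c depending on m, and the transfer holds for large n with this c. *)
Lemma functional_cvg (d : nat -> measure_display) (T : forall n, measurableType (d n))
    (P : forall n, probability (T n) R) (b : forall n, nat -> {RV P n >-> 'rV[R]_n}) :
  (forall n, random_basis (nu n) k (b n)) ->
  (\int[P n]_w Lam n (gs_path (b n) w)) @[n --> \oo] --> \int[P']_w Linf (eta_ w).
Proof.
move=> basis; have C0 : 0 <= C by apply: le_trans (normr_ge0 _) (Linf_le (fun=> 0)).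
have meta j : measurable_fun setT (eta j : T' -> R) by exact: measurable_funPT.
apply/cvgrPdist_le => eps eps0.
have e3 : 0 < eps / 3 by rewrite divr_gt0.
(* The bad events then cost 2 C (s + s) <= eps / 3; adding 1 covers C = 0. *)
pose s := eps / 3 / (4 * (C + 1)).
have s0 : 0 < s by rewrite divr_gt0 // mulr_gt0 // ltr_wpDl.
have Cs : 2 * C * (s + s) <= eps / 3.
  have -> : 2 * C * (s + s) = C / (C + 1) * (eps / 3).
    by rewrite /s; field; rewrite gt_eqF // ltr_wpDl.
  by rewrite ler_piMl ?(ltW e3) // ler_pdivrMr ?ltr_wpDl // mul1r lerDl.
have [good [mgood eq_good ae_good stab]] := stable e3.
have [m likely] : exists m, forall n, (m <= n)%N -> (P' (~` [set w | good m n (eta_ w)]) <= s%:E)%E.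
  by apply: eventually_likely => // m n; exact: mgood.
have [c c1 hc] := stab m.
have [M transfer] := transfer_eventually C c1 (ltW e3) s0.
have lim : (\int[P']_w Lam n (eta_ w)) @[n --> \oo] --> \int[P']_w Linf (eta_ w).
  apply: (bounded_convergence (C := C)) => //; first by move=> n; exact: mLam.
    by apply: filterS Lam_cvg => w; exact: cvg_near_cst.
  by apply: aeW => w n.
move/cvgrPdist_le/(_ _ e3) : lim => near_lim.
near=> n.
have kn : (k.+1 < n)%N by near: n; exact: nbhs_infty_gt.
have h1 : `|\int[P']_w Linf (eta_ w) - \int[P']_w Lam n (eta_ w)| <= eps / 3 by near: n.
pose B (t : (n - k).-tuple R) := Lam n (tuple_path t).
have pathE w j : (k < j <= n)%N -> tuple_path (eta_tuple (n := n) k eta w) j = eta j w by exact: eta_path.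
have BE w : B (eta_tuple (n := n) k eta w) = Lam n (eta_ w) by apply: eq_Lam => // j; exact: pathE.
pose Bad := [set t : (n - k).-tuple R | ~ good m n (tuple_path t)].
have h2 : `|\int[P n]_w Lam n (gs_path (b n) w) - \int[P']_w B (eta_tuple (n := n) k eta w)| <=
    eps / 3 + 2 * C * (s + s).
  apply: (transfer n k _ _ _ _ _ _ (basis n) _ B Bad) => //.
  - by near: n; exact: nbhs_infty_ge.
  - exact: ltnW.
  - rewrite (_ : _ @^-1` Bad = ~` [set w | good m n (eta_ w)]).
      by apply: likely; near: n; exact: nbhs_infty_ge.
    apply/seteqP; split => w /= ng; apply: contra_not ng; apply: eq_good => // j kj.
      by rewrite pathE.
    by rewrite pathE.
  - by apply: mLam => j; exact: measurable_gs_path.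
  - by apply: mLam => j; exact: measurable_tuple_path.
  - by apply: measurableC; apply: mgood => j; exact: measurable_tuple_path.
  - by move=> t; exact: Lam_le.
  - by move=> w t cl /contrapT gd; exact: hc.
have := ler_distD (\int[P']_w Lam n (eta_ w)) (\int[P']_w Linf (eta_ w)) (\int[P n]_w Lam n (gs_path (b n) w)).
rewrite (distrC (\int[P']_w Lam n (eta_ w))) => /le_trans; apply.
have BI : \int[P']_w B (eta_tuple (n := n) k eta w) = \int[P']_w Lam n (eta_ w).
  by apply: eq_Rintegral => w _; rewrite BE.
by rewrite BI in h2; lra.
Unshelve. all: by end_near.
Qed.

End functionals.

End transfer.

(** * Convergence *)

Section main.
Context {R : realType} (nu : forall n : nat, probability 'rV[R]_n R).
Context (a : nat -> R) (d1 d2 alpha rho0 : R).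
Context d' {T' : measurableType d'} (P' : probability T' R) (eta : nat -> {RV P' >-> R}).
Hypothesis model : spherical_model nu.
Hypotheses (d20 : 0 < d2) (rho00 : 0 < rho0).
Hypothesis concentration : forall (n : nat) (rho : R), (1 <= n)%N -> 0 < rho < rho0 ->
  (nu n [set x : 'rV[R]_n | rho <= `|sqnorm x / a n - 1|]%R
   <= (d1 * expR (- (n%:R * d2 * rho `^ alpha)))%:E)%E.
Hypothesis ieta : independent_RVs [set i | (1 <= i)%N] eta.
Hypothesis geta : forall i, (1 <= i)%N -> gamma_distributed (i%:R / 2) (eta i).
Local Notation eta_ w := (fun j => eta j w).

Let meta j : measurable_fun setT (eta j : T' -> R). Proof. exact: measurable_funPT. Qed.

Lemma ae_near_level_windex k : {ae P', forall w, \forall n \near \oo,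
  level n k (eta_ w) = lim_level k (eta_ w) /\ windex n k (eta_ w) = lim_index k (eta_ w)}.
Proof.
apply: filterS2 (ae_ratio_gap ieta geta) (ae_gamma_gt0 geta) => w gap e0.
have [i [c [ki c1 gi]]] := gap k; apply: near_level_windex gi => //.
by case: i ki => // i _; rewrite divr_gt0.
Qed.

Lemma bounded_fun_bound (S : Type) (f : S -> R) : bounded_fun f -> exists C : R, forall x, `|f x| <= C.
Proof. by move=> [M [_ hM]]; exists (M + 1) => x; apply: hM => //; rewrite ltrDl. Qed.

Lemma cvg_expectation (d : nat -> measure_display) (T : forall n, measurableType (d n))
    (P : forall n, probability (T n) R) (X : forall n, T n -> R) (Y : T' -> R) (C : R) :
  (\forall n \near \oo, measurable_fun setT (X n)) -> measurable_fun setT Y ->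
  (forall n w, `|X n w| <= C) -> (forall w, `|Y w| <= C) ->
  (\int[P n]_w X n w) @[n --> \oo] --> \int[P']_w Y w ->
  ('E_(P n)[X n] @[n --> \oo] --> 'E_P'[Y])%E.
Proof.
move=> mX mY XC YC lim; rewrite (expectation_bounded P' mY YC).
have : (\int[P n]_w X n w)%:E @[n --> \oo] --> (\int[P']_w Y w)%:E by apply: cvg_EFin; [exact: nearW|exact: lim].
apply: cvg_trans; apply: near_eq_cvg; apply: filterS mX => n mXn.
by rewrite (expectation_bounded (P n) mXn (XC n)).
Qed.

Section families.
Context (d : nat -> measure_display) (T : forall n, measurableType (d n)).
Context (P : forall n, probability (T n) R).

Lemma reduction_level_cvg (k : nat) (b : forall n, nat -> {RV P n >-> 'rV[R]_n}) :
  (forall n, random_basis (nu n) k (b n)) ->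
  cvg_in_distribution P P' (fun n w => reduction_level k (fun i => b n i w))
    (fun w => lim_level k (eta_ w)).
Proof.
move=> basis f cf bf; have [C fC] := bounded_fun_bound bf.
have mf : measurable_fun setT f by exact: continuous_measurable_fun.
have mfY : measurable_fun setT (f \o (fun w => lim_level k (eta_ w))).
  by apply: measurableT_comp => //; exact: measurable_lim_level.
have lim : (\int[P n]_w f (level n k (gs_path (b n) w))) @[n --> \oo] -->
    \int[P']_w f (lim_level k (eta_ w)).
  apply: (functional_cvg model d20 rho00 concentration ieta geta (k := k) (C := C)
    (Lam := fun n e => f (level n k e)) (Linf := fun e => f (lim_level k e))) => //.
  - by move=> n d0 Om e me; apply: measurableT_comp => //; exact: measurable_level.
  - by move=> n e e' kn ee'; rewrite (eq_level kn ee').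
  - by apply: filterS (ae_near_level_windex k) => w; apply: filterS => n [-> _].
  (* As f is uniformly continuous on compact sets only, good paths are those whose level stays below
     m. *)
  move=> eps eps0; exists (fun m n e => level n k e <= m%:R); split.
  - move=> m n d0 Om e me; rewrite -[X in measurable X]setTI.
    have mle := measurable_fun_ler (measurable_level me n k) (measurable_cst (m%:R : R)).
    exact: (mle measurableT [set true]).
  - by move=> m n e e' kn ee'; rewrite (eq_level kn ee').
  - apply: filterS (ae_near_level_windex k) => w [M _ hM].
    exists (maxn M (Num.bound `|lim_level k (eta_ w)|)) => // m /= Mm n mn.
    have [-> _] := hM n (leq_trans (leq_trans (leq_maxl _ _) Mm) mn).
    apply: le_trans (ler_norm _) _; apply: ltW; apply: lt_le_trans (archi_boundP (normr_ge0 _)) _.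
    by rewrite ler_nat; apply: leq_trans Mm; exact: leq_maxr.
  move=> m; have [del del0 unif] := uniform_at_compact m%:R cf eps0.
  (* With this factor a level at most m moves by at most [del]. *)
  exists (1 + del / (m%:R + 1)); first by rewrite ltrDl divr_gt0 // ltr_wpDl.
  move=> n e e' kn cl lm; set c := 1 + _ in cl.
  have m1 : 0 < m%:R + 1 :> R by rewrite ltr_wpDl.
  have c1 : 1 < c by rewrite ltrDl divr_gt0.
  have cl' j : (k < j < n)%N -> lim_ratio e j / c <= lim_ratio e' j <= c * lim_ratio e j.
    by move=> /cl[].
  have /andP[p1 p2] := level_perturbation c1 cl' kn.
  have l0 : 0 <= level n k e.
    by apply: le_level => [|j /cl[]//]; have [|] := cl k.+1; rewrite ?leqnn.
  apply: unif; first by rewrite l0.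
  have cm : (c - 1) * level n k e <= del.
    rewrite /c addrC addKr mulrAC ler_pdivrMr // ler_pM2l //.
    by apply: le_trans lm _; rewrite lerDl.
  have c0 : 0 < c by apply: lt_trans c1.
  (* This is 2 - c <= 1 / c, that is (c - 1)^2 >= 0. *)
  have h : level n k e - (c - 1) * level n k e <= level n k e / c.
    rewrite -{1}[level n k e]mul1r -mulrBl mulrC ler_wpM2l // -[leRHS]mul1r ler_pdivlMr //.
    have : 0 <= (c - 1) ^+ 2 by exact: sqr_ge0.
    by rewrite expr2; lra.
  by rewrite ler_norml; apply/andP; split; lra.
have lim' : (\int[P n]_w f (reduction_level k (fun i => b n i w))) @[n --> \oo] -->
    \int[P']_w f (lim_level k (eta_ w)).
  apply: cvg_trans lim; apply: near_eq_cvg; exists k.+2 => // n /= kn.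
  by apply: eq_Rintegral => w _; rewrite (reduction_level_path _ kn).
apply: cvg_expectation lim' => //; exists k.+2 => // n /= kn.
apply: measurableT_comp => //; under eq_fun do rewrite (reduction_level_path _ kn).
by apply: measurable_level => j; exact: measurable_gs_path.
Qed.

Lemma worst_index_cvg (k : nat) (b : forall n, nat -> {RV P n >-> 'rV[R]_n}) :
  (forall n, random_basis (nu n) k (b n)) ->
  cvg_in_distribution P P' (fun n w => worst_index k (fun i => b n i w))
    (fun w => lim_index k (eta_ w)).
Proof.
move=> basis f _ bf; have [C fC] := bounded_fun_bound bf.
have mfY : measurable_fun setT (f \o (fun w => lim_index k (eta_ w))).
  by apply: measurable_nat_fun; exact: measurable_lim_index.
have lim : (\int[P n]_w f (windex n k (gs_path (b n) w))) @[n --> \oo] -->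
    \int[P']_w f (lim_index k (eta_ w)).
  apply: (functional_cvg model d20 rho00 concentration ieta geta (k := k) (C := C)
    (Lam := fun n e => f (windex n k e)) (Linf := fun e => f (lim_index k e))) => //.
  - by move=> n d0 Om e me; apply: measurable_nat_fun; exact: measurable_windex.
  - by move=> n e e' kn ee'; rewrite (eq_windex kn ee').
  - by apply: filterS (ae_near_level_windex k) => w; apply: filterS => n [_ ->].
  move=> eps eps0; pose c (m : nat) : R := 1 + m.+1%:R^-1.
  have c1 m : 1 < c m by rewrite ltrDl invr_gt0.
  pose D n := [set i | (k < i < n)%N].
  (* Good paths have a minimizer separated by the factor [c m ^+ 2], which [windex_perturbation]
     shows to be preserved. *)
  exists (fun m n e => exists2 i, D n i & forall j, D n j /\ j != i ->
    lim_ratio e i * c m ^+ 2 < lim_ratio e j); split.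
  - move=> m n d0 Om e me.
    pose G i j := [set w | lim_ratio (fun j => e j w) i * c m ^+ 2 < lim_ratio (fun j => e j w) j].
    rewrite (_ : [set w | _] = \bigcup_(i in D n) \bigcap_(j in [set j | D n j /\ j != i]) G i j) //.
    apply: bigcup_measurable => i _; apply: bigcap_measurableType => j _.
    rewrite -[X in measurable X]setTI.
    have mlt : measurable_fun setT (fun w => lim_ratio (fun j => e j w) i * c m ^+ 2 < lim_ratio (fun j => e j w) j).
      by apply: measurable_fun_ltr; [apply: measurable_funM => //|]; exact: measurable_lim_ratio.
    exact: (mlt measurableT [set true]).
  - move=> m n e e' kn ee' [i Di gap]; exists i => // j Dj.
    have eqr l : D n l -> lim_ratio e l = lim_ratio e' l.
      by move=> /andP[kl ln]; rewrite /lim_ratio !ee' // ?kl ?(ltnW ln) // ltnW.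
    by rewrite -(eqr _ Di) -(eqr _ Dj.1); exact: gap.
  - apply: filterS2 (ae_ratio_gap ieta geta) (ae_gamma_gt0 geta) => w gap e0.
    have [i [c' [ki c'1 gi]]] := gap k.
    have Ri : 0 < lim_ratio (eta_ w) i by case: i ki {gi} => // i _; rewrite divr_gt0.
    (* Then x = 1/(m + 1) <= (c' - 1)/3, so that (1 + x)^2 <= 1 + 3 x <= c'. *)
    pose M := Num.bound (3 / (c' - 1)).
    exists (maxn M i.+1) => // m /= Mm n mn.
    have i_n : (i < n)%N by apply: leq_trans (leq_trans (leq_maxr _ _) Mm) mn.
    exists i => [|j [/andP[kj _] ji]]; first by rewrite /D /= ki.
    apply: le_lt_trans (gi j kj ji); rewrite ler_pM2l // /c.
    have m0 : 0 < m.+1%:R :> R by rewrite ltr0n.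
    have c'0 : 0 < c' - 1 by rewrite subr_gt0.
    have h : m.+1%:R^-1 <= (c' - 1) / 3 :> R.
      rewrite -[(c' - 1) / 3]invrK lef_pV2 ?posrE ?invr_gt0 ?divr_gt0 // invfM invrK mulrC.
      apply: ltW; apply: lt_le_trans (archi_boundP _) _; first by rewrite divr_ge0 // ltW.
      by rewrite ler_nat -/M; apply: leqW; apply: leq_trans Mm; exact: leq_maxl.
    have h0 : 0 < m.+1%:R^-1 :> R by rewrite invr_gt0.
    have h1 : m.+1%:R^-1 <= 1 :> R by rewrite invf_le1 // ler1n.
    by move: (m.+1%:R^-1 : R) h h0 h1 => x h h0 h1; nra.
  move=> m; exists (c m) => // n e e' kn cl [i Di gap].
  have cl' j : (k < j < n)%N -> lim_ratio e j / c m <= lim_ratio e' j <= c m * lim_ratio e j.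
    by move=> /cl[].
  have gap' j : (k < j < n)%N -> j != i -> lim_ratio e i * c m ^+ 2 < lim_ratio e j.
    by move=> kj ji; apply: gap.
  rewrite (windex_perturbation (c1 m) cl' Di gap').
  rewrite (windex_strict_min Di) ?subrr ?normr0 ?(ltW eps0) // => j kj ji.
  apply: le_lt_trans (gap' j kj ji); rewrite ler_peMr //; first by have [] := cl i Di.
  by apply: exprn_ege1; exact: ltW.
have lim' : (\int[P n]_w f (worst_index k (fun i => b n i w))) @[n --> \oo] -->
    \int[P']_w f (lim_index k (eta_ w)).
  apply: cvg_trans lim; apply: near_eq_cvg; exists k.+2 => // n /= kn.
  by apply: eq_Rintegral => w _; rewrite (worst_index_path _ kn).
apply: cvg_expectation lim' => //; exists k.+2 => // n /= kn.
apply: measurable_nat_fun; under eq_fun do rewrite (worst_index_path _ kn).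
by apply: measurable_windex => j; exact: measurable_gs_path.
Qed.

Lemma reduction_level_cvg1 (g : nat -> nat) (b : forall n, nat -> {RV P n >-> 'rV[R]_n}) :
  (forall n, (2 <= n)%N -> (g n <= n - 2)%N) -> g n @[n --> \oo] --> \oo ->
  (forall n, random_basis (nu n) (g n) (b n)) ->
  cvg_in_probability P (fun n w => reduction_level (g n) (fun i => b n i w)) 1.
Proof.
move=> gn g_oo basis e e0.
(* A level within [del] of 1, perturbed by a factor 1 + del, stays between 1 - 2 del and (1 + del)^2
   < 1 + 4 del, hence within e of 1. *)
pose del := Num.min (e / 4) (1 / 2).
have del0 : 0 < del by rewrite /del lt_min !divr_gt0.
have del_e : del <= e / 4 by rewrite /del ge_min lexx.
have del_1 : del <= 1 / 2 by rewrite /del ge_min lexx orbT.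
have gn2 n : (2 <= n)%N -> ((g n).+1 < n)%N.
  by move=> n2; have := gn n n2; rewrite -(leq_add2r 2) subnK // addn2.
pose S n := [set w : T n | e <= `|reduction_level (g n) (fun i => b n i w) - 1|].
pose good (n : nat) (p : nat -> R) := `|level n (g n) p - 1| <= del.
have mgood n d0 (Om : measurableType d0) (p : nat -> Om -> R) :
    (forall j, measurable_fun setT (p j)) -> measurable [set w | good n (fun j => p j w)].
  move=> mp; rewrite -[X in measurable X]setTI.
  have mle : measurable_fun setT (fun w => good n (fun j => p j w)).
    apply: measurable_fun_ler => //; apply: measurableT_comp => //.
    by apply: measurable_funB => //; exact: measurable_level.
  exact: (mle measurableT [set true]).
have mS n : (2 <= n)%N -> measurable (S n).
  move=> n2; rewrite -[X in measurable X]setTI.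
  have mle : measurable_fun setT (fun w => e <= `|reduction_level (g n) (fun i => b n i w) - 1|).
    under eq_fun do rewrite (reduction_level_path _ (gn2 n n2)).
    apply: measurable_fun_ler => //; apply: measurableT_comp => //.
    by apply: measurable_funB => //; apply: measurable_level => j; exact: measurable_gs_path.
  exact: (mle measurableT [set true]).
have ae_good : {ae P', forall w, \forall m \near \oo, forall n, (m <= n)%N -> good n (eta_ w)}.
  (* Since g(n) tends to infinity, eventually all ratios in the range, hence their minimum, are
     within [del] of 1. *)
  apply: filterS (ae_ratio_cvg geta) => w /cvgrPdist_le/(_ _ del0)[J _ hJ].
  have [M _ hM] : \forall n \near \oo, (J <= g n)%N by exact: (g_oo _ (nbhs_infty_ge J)).
  exists (maxn M 2) => // m /= Mm n mn.
  have n2 : (2 <= n)%N by apply: leq_trans (leq_trans (leq_maxr _ _) Mm) mn.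
  have Jg : (J <= g n)%N by apply: hM; apply: leq_trans (leq_trans (leq_maxl _ _) Mm) mn.
  have near1 j : (g n < j)%N -> 1 - del <= lim_ratio (eta_ w) j <= 1 + del.
    move=> gj; have := hJ j (leq_trans Jg (ltnW gj)); rewrite ler_distlC /= => /andP[h1 h2].
    by apply/andP; split; lra.
  rewrite /good ler_distl; apply/andP; split.
    apply: le_level => [|j /andP[gj _]]; last by have /andP[] := near1 j gj.
    by have /andP[] := near1 (g n).+1 (leqnn _).
  have kn : (g n < (g n).+1 < n)%N by rewrite leqnn gn2.
  apply: le_trans (level_le _ kn) _.
  by have /andP[_] := near1 (g n).+1 (leqnn _).
have small : fine (P n (S n)) @[n --> \oo] --> (0 : R).
  apply/cvgrPdist_le => eps eps0; have s0 : 0 < eps / 4 by rewrite divr_gt0.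
  have [m likely] := eventually_likely (fun _ n => mgood n _ _ _ meta) ae_good s0.
  have c1 : 1 < 1 + del by rewrite ltrDl.
  have [M transfer] := transfer_eventually model d20 rho00 concentration ieta geta 1 c1 (lexx 0) s0.
  near=> n.
  have n2 : (2 <= n)%N by near: n; exact: nbhs_infty_ge.
  have kn := gn2 n n2.
  pose Bad := [set t : (n - g n).-tuple R | ~ good n (tuple_path t)].
  (* The indicator of the deviation event is compared with 0: off the bad set the two agree exactly,
     so the error eps of the transfer is 0. *)
  have h : `|\int[P n]_w (\1_(S n) w) - \int[P']_w (cst 0 (eta_tuple (n := n) (g n) eta w))| <=
      0 + 2 * 1 * (eps / 4 + eps / 4).
    apply: (transfer n (g n) _ _ _ _ _ _ (basis n) _ (cst 0) Bad) => //.
    - by near: n; exact: nbhs_infty_ge.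
    - exact: ltnW.
    - rewrite (_ : _ @^-1` Bad = ~` [set w | good n (eta_ w)]).
        by apply: likely; near: n; exact: nbhs_infty_ge.
      have E w : level n (g n) (tuple_path (eta_tuple (n := n) (g n) eta w)) = level n (g n) (eta_ w).
        by apply: eq_level => // j; exact: eta_path.
      by apply/funext => w; rewrite /Bad /preimage /setC /mkset /good E.
    - by apply: measurable_indic; exact: mS.
    - by apply: measurableC; apply: mgood => j; exact: measurable_tuple_path.
    - by move=> w; rewrite indicE; case: (_ \in _); rewrite ?normr0 ?normr1.
    - by move=> t; rewrite normr0.
    move=> w t cl /contrapT; rewrite /good ler_distl => /andP[l1 l2].
    have cl' j : (g n < j < n)%N -> lim_ratio (tuple_path t) j / (1 + del) <=
        lim_ratio (gs_path (b n) w) j <= (1 + del) * lim_ratio (tuple_path t) j.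
      by move=> /cl[].
    have /andP[p1 p2] := level_perturbation c1 cl' kn.
    rewrite subr0 indicE memNset ?normr0 // /S /= (reduction_level_path _ kn).
    apply/negP; rewrite -ltNge ltr_distl.
    move: (level n (g n) (tuple_path t)) (level n (g n) (gs_path (b n) w)) l1 l2 p1 p2 => x y l1 l2 p1 p2.
    have p3 : x <= y * (1 + del) by rewrite -ler_pdivrMr //; lra.
    by apply/andP; split; nra.
  have I0 : \int[P']_w (cst 0 (eta_tuple (n := n) (g n) eta w)) = 0 :> R by exact: (Rintegral_cst_prob P' 0).
  rewrite I0 subr0 (Rintegral_indic _ (mS n n2)) in h.
  by rewrite sub0r normrN; apply: le_trans h _; lra.
apply: (cvg_EFin _ small); exists 2%N => // n /= n2; exact: fin_num_measure (mS n n2).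
Unshelve. all: by end_near.
Qed.

End families.

End main.

Theorem theorem1p8 (R : realType)
    (nu : forall n : nat, probability 'rV[R]_n R)
    (a : nat -> R) (d1 d2 alpha rho0 : R)
    (* a sequence of probability spaces carrying the random bases *)
    (d : nat -> measure_display) (T : forall n, measurableType (d n))
    (P : forall n, probability (T n) R)
    (* a probability space carrying the gamma variables *)
    (d' : measure_display) (T' : measurableType d') (P' : probability T' R)
    (eta : nat -> {RV P' >-> R}) :
  spherical_model nu ->
  (forall n, a n != 0) -> 0 < d1 -> 0 < d2 -> 0 < alpha -> 0 < rho0 < 1 ->
  (forall (n : nat) (rho : R), (1 <= n)%N -> 0 < rho < rho0 ->
     (nu n [set x : 'rV[R]_n | rho <= `|sqnorm x / a n - 1|]%R
      <= (d1 * expR (- (n%:R * d2 * rho `^ alpha)))%:E)%E) ->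
  independent_RVs [set i | (1 <= i)%N] eta ->
  (forall i, (1 <= i)%N -> gamma_distributed (i%:R / 2) (eta i)) ->
  [/\ (forall (k : nat) (b : forall n, nat -> {RV P n >-> 'rV[R]_n}),
        (forall n, random_basis (nu n) k (b n)) ->
        cvg_in_distribution P P'
          (fun n w => reduction_level k (fun i => b n i w))
          (fun w => lim_level k (fun i => eta i w))),
      (forall (g : nat -> nat) (b : forall n, nat -> {RV P n >-> 'rV[R]_n}),
        (forall n, (2 <= n)%N -> (g n <= n - 2)%N) ->
        g n @[n --> \oo] --> \oo ->
        (forall n, random_basis (nu n) (g n) (b n)) ->
        cvg_in_probability P
          (fun n w => reduction_level (g n) (fun i => b n i w)) 1)
    & (forall (k : nat) (b : forall n, nat -> {RV P n >-> 'rV[R]_n}),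
        (1 <= k)%N ->
        (forall n, random_basis (nu n) k (b n)) ->
        cvg_in_distribution P P'
          (fun n w => worst_index k (fun i => b n i w))
          (fun w => lim_index k (fun i => eta i w)))].
Proof.
move=> model _ _ d20 _ /andP[rho00 _] conc ieta geta; split.
- by move=> k b basis; exact: (reduction_level_cvg model d20 rho00 conc ieta geta basis).
- by move=> g b gn g_oo basis; exact: (reduction_level_cvg1 model d20 rho00 conc ieta geta gn g_oo basis).
- by move=> k b _ basis; exact: (worst_index_cvg model d20 rho00 conc ieta geta basis).
Qed.
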